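(* Let $\alpha>0$. The map $q_\alpha(f)=\sum_{n\in\mathbb{Z}}k^{\alpha+1}(|n|)\,|W^\alpha f(n)|$ is a norm on $c_{0,0}(\mathbb{Z})$, and there is a constant $C_\alpha>0$ such that $$q_\alpha(f*g)\le C_\alpha\, q_\alpha(f)\,q_\alpha(g),\qquad f,g\in c_{0,0}(\mathbb{Z}).$$ Consequently the space $\tau^\alpha(|n|^\alpha)$ of complex sequences $f$ on $\mathbb{Z}$ with $f(n)\to0$ as $|n|\to\infty$ and $q_\alpha(f)<\infty$ is a Banach algebra under convolution. Moreover, for $\beta>\alpha>0$ one has $\|f\|_{\ell^1(\mathbb{Z})}\le q_\alpha(f)\le q_\beta(f)$ for all $f\in c_{0,0}(\mathbb{Z})$, giving continuous embeddings $\tau^\beta(|n|^\beta)\hookrightarrow\tau^\alpha(|n|^\alpha)\hookrightarrow\ell^1(\mathbb{Z})$, and $\lim_{\alpha\to0^+}q_\alpha(f)=\|f\|_{\ell^1(\mathbb{Z})}$ for $f\in c_{0,0}(\mathbb{Z})$.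
   Context: $c_{0,0}(\mathbb{Z})$ is the space of finitely supported complex sequences on $\mathbb{Z}$, with convolution $(f*g)(n)=\sum_{j\in\mathbb{Z}}f(n-j)g(j)$. For $\gamma\in\mathbb{R}$, $k^\gamma(0)=1$, $k^\gamma(n)=\frac{\gamma(\gamma+1)\cdots(\gamma+n-1)}{n!}$ for $n\ge1$. $W_+f(n)=f(n)-f(n+1)$, $W_-f(n)=f(n)-f(n-1)$, $W_\pm^m$ their powers. For $\alpha>0$: $W_+^{-\alpha}f(n)=\sum_{j\ge n}k^\alpha(j-n)f(j)$, $W_-^{-\alpha}f(n)=\sum_{j\le n}k^\alpha(n-j)f(j)$, $W_\pm^\alpha f=W_\pm^mW_\pm^{-(m-\alpha)}f$ with $m=[\alpha]+1$; $W^\alpha f(n)=W_+^\alpha f(n)$ for $n\ge0$ and $W^\alpha f(n)=W_-^\alpha f(n)$ for $n<0$ (for sequences not in $c_{0,0}$, these are defined whenever the series converge). *)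

(* Defs.v *)
From Stdlib Require Import Reals ZArith Lra Lia ClassicalEpsilon.
Open Scope R_scope.

Definition Cx : Type := (R * R)%type.
Definition C0 : Cx := (0, 0).
Definition Cadd (a b : Cx) : Cx := (fst a + fst b, snd a + snd b).
Definition Copp (a : Cx) : Cx := (- fst a, - snd a).
Definition Csub (a b : Cx) : Cx := Cadd a (Copp b).
Definition Cmul (a b : Cx) : Cx :=
  (fst a * fst b - snd a * snd b, fst a * snd b + snd a * fst b).
Definition RtoC (r : R) : Cx := (r, 0).
Definition Cnorm (a : Cx) : R := sqrt (fst a * fst a + snd a * snd a).

Definition seqZ : Type := Z -> Cx.
Definition zeroZ : seqZ := fun _ => C0.
Definition addZ (f g : seqZ) : seqZ := fun n => Cadd (f n) (g n).
Definition subZ (f g : seqZ) : seqZ := fun n => Csub (f n) (g n).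
Definition scalZ (l : Cx) (f : seqZ) : seqZ := fun n => Cmul l (f n).

Definition c00 (f : seqZ) : Prop :=
  exists N : Z, forall n : Z, (N < Z.abs n)%Z -> f n = C0.

(** Cesaro kernel k^gamma(n) = gamma(gamma+1)...(gamma+n-1)/n!. *)
Fixpoint kC (g : R) (n : nat) : R :=
  match n with
  | O => 1
  | S p => kC g p * (g + INR p) / INR (S p)
  end.

Definition sumC (u : nat -> Cx) (N : nat) : Cx :=
  (sum_f_R0 (fun j => fst (u j)) N, sum_f_R0 (fun j => snd (u j)) N).
Definition cv_C (u : nat -> Cx) (l : Cx) : Prop :=
  Un_cv (fun N => fst (sumC u N)) (fst l) /\ Un_cv (fun N => snd (sumC u N)) (snd l).
(** Value of a series (meaningful when it converges). *)
Definition seriesC (u : nat -> Cx) : Cx := epsilon (inhabits C0) (cv_C u).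

Definition sumZ_R (t : Z -> R) (N : nat) : R :=
  sum_f_R0 (fun i => t (Z.of_nat i - Z.of_nat N)%Z) (2 * N).
Definition cvZ_R (t : Z -> R) (l : R) : Prop := Un_cv (sumZ_R t) l.
Definition seriesZ_R (t : Z -> R) : R := epsilon (inhabits 0) (cvZ_R t).
Definition cvZ_C (t : Z -> Cx) (l : Cx) : Prop :=
  cvZ_R (fun n => fst (t n)) (fst l) /\ cvZ_R (fun n => snd (t n)) (snd l).
Definition seriesZ_C (t : Z -> Cx) : Cx := epsilon (inhabits C0) (cvZ_C t).

Definition conv (f g : seqZ) : seqZ :=
  fun n => seriesZ_C (fun j => Cmul (f (n - j)%Z) (g j)).

Definition l1norm (f : seqZ) : R := seriesZ_R (fun n => Cnorm (f n)).
Definition in_l1 (f : seqZ) : Prop := exists l, cvZ_R (fun n => Cnorm (f n)) l.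

Definition Wp (f : seqZ) : seqZ := fun n => Csub (f n) (f (n + 1)%Z).
Definition Wm (f : seqZ) : seqZ := fun n => Csub (f n) (f (n - 1)%Z).

Definition Wp_neg_terms (a : R) (f : seqZ) (n : Z) : nat -> Cx :=
  fun j => Cmul (RtoC (kC a j)) (f (n + Z.of_nat j)%Z).
Definition Wm_neg_terms (a : R) (f : seqZ) (n : Z) : nat -> Cx :=
  fun j => Cmul (RtoC (kC a j)) (f (n - Z.of_nat j)%Z).
Definition Wp_neg (a : R) (f : seqZ) : seqZ := fun n => seriesC (Wp_neg_terms a f n).
Definition Wm_neg (a : R) (f : seqZ) : seqZ := fun n => seriesC (Wm_neg_terms a f n).

Definition mexp (a : R) : nat := S (Z.to_nat (Int_part a)).

Definition Wp_frac (a : R) (f : seqZ) : seqZ :=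
  Nat.iter (mexp a) Wp (Wp_neg (INR (mexp a) - a) f).
Definition Wm_frac (a : R) (f : seqZ) : seqZ :=
  Nat.iter (mexp a) Wm (Wm_neg (INR (mexp a) - a) f).
Definition Wfrac (a : R) (f : seqZ) : seqZ :=
  fun n => if (0 <=? n)%Z then Wp_frac a f n else Wm_frac a f n.

(** W^alpha f is defined: all series used in it converge
    (W^alpha f(n), n >= 0, uses W_+^{-(m-a)} f at points >= 0;
     for n < 0 it uses W_-^{-(m-a)} f at points < 0). *)
Definition Wdef (a : R) (f : seqZ) : Prop :=
  (forall n : Z, (0 <= n)%Z -> exists l, cv_C (Wp_neg_terms (INR (mexp a) - a) f n) l) /\
  (forall n : Z, (n < 0)%Z -> exists l, cv_C (Wm_neg_terms (INR (mexp a) - a) f n) l).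

Definition q_terms (a : R) (f : seqZ) : Z -> R :=
  fun n => kC (a + 1) (Z.abs_nat n) * Cnorm (Wfrac a f n).
Definition q (a : R) (f : seqZ) : R := seriesZ_R (q_terms a f).
Definition q_finite (a : R) (f : seqZ) : Prop :=
  Wdef a f /\ exists l, cvZ_R (q_terms a f) l.

Definition tau (a : R) (f : seqZ) : Prop :=
  (forall eps, 0 < eps -> exists N : Z, forall n : Z, (N < Z.abs n)%Z -> Cnorm (f n) < eps)
  /\ q_finite a f.

Definition is_norm (S : seqZ -> Prop) (N : seqZ -> R) : Prop :=
  (forall f, S f -> 0 <= N f) /\
  (forall f, S f -> N f = 0 -> f = zeroZ) /\
  (forall l f, S f -> N (scalZ l f) = Cnorm l * N f) /\
  (forall f g, S f -> S g -> N (addZ f g) <= N f + N g).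

Definition BanachAlg (S : seqZ -> Prop) (N : seqZ -> R) (mul : seqZ -> seqZ -> seqZ) : Prop :=
  S zeroZ /\
  (forall f g, S f -> S g -> S (addZ f g)) /\
  (forall l f, S f -> S (scalZ l f)) /\
  (forall f g, S f -> S g -> S (mul f g)) /\
  is_norm S N /\
  (exists C, 0 < C /\ forall f g, S f -> S g -> N (mul f g) <= C * N f * N g) /\
  (forall f g h, S f -> S g -> S h -> mul f (mul g h) = mul (mul f g) h) /\
  (forall f g h, S f -> S g -> S h -> mul f (addZ g h) = addZ (mul f g) (mul f h)) /\
  (forall f g h, S f -> S g -> S h -> mul (addZ f g) h = addZ (mul f h) (mul g h)) /\
  (forall l f g, S f -> S g ->
     mul (scalZ l f) g = scalZ l (mul f g) /\ mul f (scalZ l g) = scalZ l (mul f g)) /\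
  (forall u : nat -> seqZ, (forall i, S (u i)) ->
     (forall eps, 0 < eps -> exists M, forall i j, (M <= i)%nat -> (M <= j)%nat ->
        N (subZ (u i) (u j)) < eps) ->
     exists f, S f /\ Un_cv (fun i => N (subZ (u i) f)) 0).

(* Main.v *)
(** Set [D^a u(n) = sum_(j >= 0) k^(-a)(j) u(n + j)]. The kernel [k^(-a)] is
    summable, [W^a f] is [D^a f] on [n >= 0] and [D^a] of the reflection of [f]
    on [n < 0], and [q_0] is the l^1 norm.

    For [0 <= s <= 1] the truncation of [k^s] at [M] inverts [k^(-s)] up to an
    error of mass at most 1 carried beyond [M]; hence [D^a u] is recovered from
    [D^(a+s) u] whenever [u] tends to 0, and [k^(a+1) * k^s = k^(a+s+1)] gives
    [q_a <= q_(a+s)]. Iterating, [q_0 <= q_a <= q_b], and completeness follows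
    because [D^a] is continuous for the sup norm.

    For the product, split both factors at 0. If [v] is carried by [n <= 0] then
    [D^a (u * v) = (D^a u) * v] only involves nonnegative arguments. On [n >= 0],
    [u] is an l^1 limit of combinations of atoms [e_l(n) = k^a(l - n)], and
    [D^a (e_l * e_m)(l + m - p) = k^a(p) (1 - [p > l] - [p > m])], whose weighted
    mass is at most [2 k^(a+1)(min l m) k^(a+1)(l + m)]; the doubling property of
    [k^(a+1)] concludes. *)

From Coquelicot Require Import Rcomplements Rbar Hierarchy Lim_seq Series.
From Stdlib Require Import Reals ZArith Lra Lia ClassicalEpsilon FunctionalExtensionality.
Require Import Defs.
Open Scope R_scope.

(** * Finite sums and Cauchy products *)

(** The obstacle is that [k^s] is not summable for s > 0, so on a sequence that merely tends to 0
    the series inverting [D^s] may diverge. Hence the inversion is done on finite sums with a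
    truncated kernel, and only the error is estimated. Steps are of size at most 1 because only then
    do all coefficients of [k^(-s)] after the first have the same sign, which yields comparison
    constants equal to 1. Summability of the elements of [tau] is a result of that comparison, not
    an assumption, and it must come before the product: without it [conv] would be an unspecified
    value. Fractional differences have no usable Leibniz rule. Atoms replace it: they are dual to
    the values of [D^a] on the half-line, and their products are explicit. Approximation by atoms in
    the l^1 norm is enough, since a bound on all partial weighted sums survives uniform limits. Both
    halves of [q] are treated by one argument through reflection; they differ only at the index 0,
    which is counted once. *)

Notation sumN := sum_f_R0.

Lemma sumN_ext (f g : nat -> R) N :
  (forall i, (i <= N)%nat -> f i = g i) -> sumN f N = sumN g N.
Proof. intros H; apply sum_eq; auto. Qed.

Lemma sumN_le (f g : nat -> R) N :
  (forall i, (i <= N)%nat -> f i <= g i) -> sumN f N <= sumN g N.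
Proof. intros H; apply sum_Rle; auto. Qed.

Lemma sumN_plus (f g : nat -> R) N :
  sumN (fun i => f i + g i) N = sumN f N + sumN g N.
Proof. apply sum_plus. Qed.

Lemma sumN_minus (f g : nat -> R) N :
  sumN (fun i => f i - g i) N = sumN f N - sumN g N.
Proof. induction N as [|N IH]; simpl; [|rewrite IH]; ring. Qed.

Lemma sumN_scal (c : R) (f : nat -> R) N :
  sumN (fun i => c * f i) N = c * sumN f N.
Proof. induction N as [|N IH]; simpl; [|rewrite IH]; ring. Qed.

Lemma sumN_scal_r (c : R) (f : nat -> R) N :
  sumN (fun i => f i * c) N = sumN f N * c.
Proof. induction N as [|N IH]; simpl; [|rewrite IH]; ring. Qed.

Lemma sumN_zero (f : nat -> R) N :
  (forall i, (i <= N)%nat -> f i = 0) -> sumN f N = 0.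
Proof.
  intros H; induction N as [|N IH]; simpl; [now apply H; lia|].
  rewrite IH by (intros; apply H; lia). rewrite H by lia. ring.
Qed.

Lemma sumN_nonneg (f : nat -> R) N :
  (forall i, (i <= N)%nat -> 0 <= f i) -> 0 <= sumN f N.
Proof.
  intros H. rewrite <- (sumN_zero (fun _ => 0) N) by auto. now apply sumN_le.
Qed.

Lemma sumN_exchange (F : nat -> nat -> R) M N :
  sumN (fun i => sumN (F i) N) M = sumN (fun j => sumN (fun i => F i j) M) N.
Proof.
  induction M as [|M IH]; simpl; [reflexivity|].
  now rewrite IH, <- sumN_plus.
Qed.

Lemma sumN_single (f : nat -> R) N k : (k <= N)%nat ->
  (forall i, (i <= N)%nat -> i <> k -> f i = 0) -> sumN f N = f k.
Proof.
  intros Hk H. induction N as [|N IH]; simpl.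
  - now replace k with 0%nat by lia.
  - destruct (Nat.eq_dec k (S N)) as [->|Hn].
    + rewrite sumN_zero; [ring|]. intros; apply H; lia.
    + rewrite IH by (try lia; intros; apply H; lia). rewrite (H (S N)) by lia. ring.
Qed.

Lemma sumN_extend (f : nat -> R) N M : (N <= M)%nat ->
  (forall i, (N < i <= M)%nat -> f i = 0) -> sumN f M = sumN f N.
Proof.
  intros HNM; induction HNM as [|M HNM IH]; intros H; [reflexivity|].
  simpl. rewrite IH by (intros; apply H; lia). rewrite H by lia. ring.
Qed.

Lemma sumN_mono (f : nat -> R) N M : (N <= M)%nat ->
  (forall i, 0 <= f i) -> sumN f N <= sumN f M.
Proof.
  intros HNM H; induction HNM as [|M HNM IH]; [lra|].
  simpl. specialize (H (S M)). lra.
Qed.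

Lemma sumN_shift_le (f : nat -> R) c N :
  (forall i, 0 <= f i) -> sumN (fun i => f (i + c)%nat) N <= sumN f (N + c).
Proof.
  intros H; induction N as [|N IH]; simpl.
  - destruct c as [|c]; [apply Rle_refl|].
    simpl. assert (0 <= sumN f c) by (apply sumN_nonneg; auto). lra.
  - lra.
Qed.

Lemma sumN_term_le (f : nat -> R) N k : (k <= N)%nat ->
  (forall i, 0 <= f i) -> f k <= sumN f N.
Proof.
  intros HkN H. apply Rle_trans with (sumN f k); [|now apply sumN_mono].
  destruct k; simpl; [lra|]. assert (0 <= sumN f k) by (apply sumN_nonneg; auto). lra.
Qed.

Lemma sumN_rev (f : nat -> R) N : sumN f N = sumN (fun i => f (N - i)%nat) N.
Proof.
  revert f; induction N as [|N IH]; intros f; [reflexivity|].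
  rewrite (decomp_sum (fun i => f (S N - i)%nat)) by lia.
  simpl pred. simpl sumN. rewrite IH. replace (S N - 0)%nat with (S N) by lia.
  rewrite Rplus_comm. f_equal.
Qed.

(** Exchange of summation over the triangle j + i <= L; every identity on Cauchy products below
    rests on it. *)
Lemma sumN_triangle (F : nat -> nat -> R) L :
  sumN (fun l => sumN (fun j => F j (l - j)%nat) l) L
  = sumN (fun j => sumN (F j) (L - j)) L.
Proof.
  induction L as [|L IH]; [reflexivity|].
  rewrite !(tech5 _ L), IH, Nat.sub_diag.
  rewrite (sumN_ext (fun j => sumN (F j) (S L - j))
    (fun j => sumN (F j) (L - j) + F j (S L - j)%nat)).
  - rewrite sumN_plus. simpl (sumN (F (S L)) 0). ring.
  - intros i Hi. replace (S L - i)%nat with (S (L - i)) by lia. reflexivity.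
Qed.

Definition cp (x y : nat -> R) (l : nat) : R := sumN (fun i => x i * y (l - i)%nat) l.

Lemma cp_ext x x' y y' l :
  (forall i, (i <= l)%nat -> x i = x' i) -> (forall i, (i <= l)%nat -> y i = y' i) ->
  cp x y l = cp x' y' l.
Proof. intros H1 H2; apply sumN_ext; intros i Hi. rewrite H1, H2 by lia. reflexivity. Qed.

Lemma cp_comm x y l : cp x y l = cp y x l.
Proof.
  unfold cp. rewrite sumN_rev. apply sumN_ext; intros i Hi.
  replace (l - (l - i))%nat with i by lia. ring.
Qed.

Lemma cp_assoc x y z l : cp x (cp y z) l = cp (cp x y) z l.
Proof.
  unfold cp at 1 3.
  transitivity (sumN (fun i => sumN (fun j => x i * (y j * z (l - (i + j))%nat)) (l - i)) l).
  - apply sumN_ext; intros i Hi. unfold cp. rewrite <- sumN_scal.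
    apply sumN_ext; intros j Hj. do 3 f_equal. lia.
  - rewrite <- (sumN_triangle (fun i j => x i * (y j * z (l - (i + j))%nat))).
    apply sumN_ext; intros p Hp. unfold cp. rewrite <- sumN_scal_r.
    apply sumN_ext; intros i Hi. replace (i + (p - i))%nat with p by lia. ring.
Qed.

Lemma cp_minus_l x x' y l : cp (fun i => x i - x' i) y l = cp x y l - cp x' y l.
Proof. unfold cp. rewrite <- sumN_minus. apply sumN_ext; intros; ring. Qed.

Lemma cp_minus_r x y y' l : cp x (fun i => y i - y' i) l = cp x y l - cp x y' l.
Proof. unfold cp. rewrite <- sumN_minus. apply sumN_ext; intros; ring. Qed.

Lemma sumN_cp x y L : sumN (cp x y) L = sumN (fun j => x j * sumN y (L - j)) L.
Proof.
  unfold cp. rewrite (sumN_triangle (fun j i => x j * y i)).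
  apply sumN_ext; intros j Hj. apply sumN_scal.
Qed.

Definition delta0 (n : nat) : R := match n with O => 1 | _ => 0 end.

Lemma cp_delta0_l x l : cp delta0 x l = x l.
Proof.
  unfold cp. rewrite (sumN_single _ l 0); [|lia|].
  - simpl. rewrite Nat.sub_0_r. ring.
  - intros [|i] _ Hi; [congruence|]. simpl. ring.
Qed.

(** * Cesaro kernels *)

Lemma kC_S g n : INR (S n) * kC g (S n) = (g + INR n) * kC g n.
Proof. cbn [kC]. field. apply not_0_INR; lia. Qed.

Lemma kC_0 n : kC 0 n = delta0 n.
Proof.
  induction n as [|n IH]; [reflexivity|].
  cbn [kC]. rewrite IH. destruct n; simpl; unfold Rdiv; ring.
Qed.

Lemma kC_1 n : kC 1 n = 1.
Proof.
  induction n as [|n IH]; [reflexivity|].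
  cbn [kC]. rewrite IH, S_INR. field. rewrite <- S_INR. apply not_0_INR; lia.
Qed.

(** Coefficients of (1-x)^(-s) (1-x)^(-t). The factor S n is split as i + (S n - i), so that [kC_S]
    applies to one kernel in each half: this is differentiation of the product, read on
    coefficients. *)
Lemma kC_add s t n : cp (kC s) (kC t) n = kC (s + t) n.
Proof.
  induction n as [|n IH]; [unfold cp; simpl; ring|].
  apply Rmult_eq_reg_l with (INR (S n)); [|apply not_0_INR; lia].
  rewrite kC_S, <- IH. unfold cp at 1. rewrite <- sumN_scal.
  rewrite (sumN_ext _ (fun i => INR i * kC s i * kC t (S n - i)%nat
    + kC s i * (INR (S n - i) * kC t (S n - i)%nat))).
  2:{ intros i Hi. rewrite minus_INR by lia. ring. }
  rewrite sumN_plus.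
  rewrite (decomp_sum (fun i => INR i * kC s i * kC t (S n - i)%nat)) by lia.
  simpl pred. rewrite (tech5 (fun i => kC s i * (INR (S n - i) * kC t (S n - i)%nat))).
  rewrite Nat.sub_diag. simpl (INR 0).
  rewrite (sumN_ext (fun i => INR (S i) * kC s (S i) * kC t (S n - S i)%nat)
    (fun i => (s + INR i) * (kC s i * kC t (n - i)%nat))).
  2:{ intros i Hi. rewrite kC_S. simpl Nat.sub. ring. }
  rewrite (sumN_ext (fun i => kC s i * (INR (S n - i) * kC t (S n - i)%nat))
    (fun i => (t + INR (n - i)) * (kC s i * kC t (n - i)%nat))).
  2:{ intros i Hi. replace (S n - i)%nat with (S (n - i)) by lia. rewrite kC_S. ring. }
  rewrite !Rmult_0_l, Rplus_0_l, Rmult_0_r, Rplus_0_r, <- sumN_plus.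
  unfold cp. rewrite <- sumN_scal. apply sumN_ext; intros i Hi.
  rewrite minus_INR by lia. ring.
Qed.

Lemma kC_cancel a n : cp (kC (- a)) (kC a) n = delta0 n.
Proof. rewrite kC_add, Rplus_opp_l. apply kC_0. Qed.

Lemma kC_sum g n : sumN (kC g) n = kC (g + 1) n.
Proof.
  rewrite <- kC_add. unfold cp. apply sumN_ext; intros. rewrite kC_1. ring.
Qed.

(** Multiplication of the generating function by 1 - x: one ordinary difference lowers the order by
    1. *)
Lemma kC_pascal g n : kC (g - 1) (S n) = kC g (S n) - kC g n.
Proof.
  pose proof (kC_sum (g - 1) (S n)) as H1. pose proof (kC_sum (g - 1) n) as H2.
  rewrite tech5 in H1. replace (g - 1 + 1) with g in * by ring. lra.
Qed.

Lemma kC_nonneg g n : 0 <= g -> 0 <= kC g n.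
Proof.
  intros Hg; induction n as [|n IH]; cbn [kC]; [lra|].
  apply Rdiv_le_0_compat; [|apply lt_0_INR; lia].
  apply Rmult_le_pos; [assumption|]. pose proof (pos_INR n); lra.
Qed.

(** The first coefficient is -s, and all later factors -s + j with j >= 1 are nonnegative. This is
    what limits the steps in the order to size 1. *)
Lemma kC_nonpos s n : 0 <= s <= 1 -> kC (- s) (S n) <= 0.
Proof.
  intros Hs; induction n as [|n IH].
  - cbn [kC]. simpl INR. lra.
  - pose proof (kC_S (- s) (S n)) as H.
    assert (Hp : 0 < INR (S (S n))) by (apply lt_0_INR; lia).
    assert (1 <= INR (S n)) by (rewrite S_INR; pose proof (pos_INR n); lra).
    destruct (Rle_or_lt (kC (- s) (S (S n))) 0) as [|Hc]; [assumption|exfalso].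
    assert (0 < INR (S (S n)) * kC (- s) (S (S n))) by (apply Rmult_lt_0_compat; auto).
    nra.
Qed.

Lemma kC_growing a n : 0 <= a -> kC (a + 1) n <= kC (a + 1) (S n).
Proof.
  intros Ha. pose proof (kC_pascal (a + 1) n) as H.
  replace (a + 1 - 1) with a in H by ring.
  pose proof (kC_nonneg a (S n) Ha). lra.
Qed.

Lemma kC_mono a n m : 0 <= a -> (n <= m)%nat -> kC (a + 1) n <= kC (a + 1) m.
Proof.
  intros Ha Hnm; induction Hnm as [|m Hnm IH]; [lra|].
  pose proof (kC_growing a m Ha); lra.
Qed.

(** Each ratio of consecutive values beyond n is 1 + a/(n+j+1) <= exp (a/(n+1)); the n factors
    leading to 2n multiply to at most exp a. *)
Lemma kC_doubling a n m : 0 <= a -> (m <= 2 * n)%nat ->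
  kC (a + 1) m <= exp a * kC (a + 1) n.
Proof.
  intros Ha Hm.
  assert (Hn1 : 0 < INR (S n)) by (apply lt_0_INR; lia).
  assert (Hg : forall j, kC (a + 1) (n + j) <= exp (INR j * (a / INR (S n))) * kC (a + 1) n).
  { induction j as [|j IH].
    - rewrite Nat.add_0_r. simpl INR. rewrite Rmult_0_l, exp_0. lra.
    - rewrite Nat.add_succ_r. cbn [kC]. rewrite (S_INR j), (Rmult_plus_distr_r (INR j)), Rmult_1_l, exp_plus.
      assert (Hj : 0 < INR (S (n + j))) by (apply lt_0_INR; lia).
      assert (Hle : (a + 1 + INR (n + j)) / INR (S (n + j)) <= exp (a / INR (S n))).
      { apply Rle_trans with (1 + a / INR (S n)).
        - replace (a + 1 + INR (n + j)) with (INR (S (n + j)) + a) by (rewrite S_INR; ring).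
          unfold Rdiv. rewrite Rmult_plus_distr_r, Rinv_r by lra.
          apply Rplus_le_compat_l, Rmult_le_compat_l; [assumption|].
          apply Rinv_le_contravar; [assumption|]. apply le_INR; lia.
        - destruct (Req_dec (a / INR (S n)) 0) as [->|Hz]; [rewrite exp_0; lra|].
          left; now apply exp_ineq1. }
      assert (0 <= kC (a + 1) (n + j)) by (apply kC_nonneg; lra).
      assert (0 <= kC (a + 1) n) by (apply kC_nonneg; lra).
      assert (0 < exp (INR j * (a / INR (S n)))) by apply exp_pos.
      assert (0 < exp (a / INR (S n))) by apply exp_pos.
      unfold Rdiv at 1. rewrite Rmult_assoc. fold (Rdiv (a + 1 + INR (n + j)) (INR (S (n + j)))).
      apply Rle_trans with (kC (a + 1) (n + j) * exp (a / INR (S n))).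
      + now apply Rmult_le_compat_l.
      + apply Rle_trans with (exp (INR j * (a / INR (S n))) * kC (a + 1) n * exp (a / INR (S n))).
        * apply Rmult_le_compat_r; lra.
        * lra. }
  assert (0 <= kC (a + 1) n) by (apply kC_nonneg; lra).
  apply Rle_trans with (kC (a + 1) (n + n)); [apply kC_mono; [assumption|lia]|].
  eapply Rle_trans; [apply Hg|].
  apply Rmult_le_compat_r; [assumption|].
  assert (Hx : INR n * (a / INR (S n)) <= a).
  { unfold Rdiv. rewrite (Rmult_comm a), <- Rmult_assoc.
    rewrite <- (Rmult_1_l a) at 2. apply Rmult_le_compat_r; [assumption|].
    apply Rmult_le_reg_r with (INR (S n)); [assumption|].
    rewrite Rmult_assoc, Rinv_l by lra. rewrite S_INR. lra. }
  destruct Hx as [Hx| ->]; [|lra]. left; now apply exp_increasing.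
Qed.

(** For a <= 1 the signs make the sum explicit; beyond, [kC_pascal] writes [k^(-a)] as a difference
    of [k^(-(a-1))], which at most doubles the bound. *)
Lemma kC_abs_sum a : 0 <= a ->
  exists K, 0 < K /\ forall N, sumN (fun j => Rabs (kC (- a) j)) N <= K.
Proof.
  assert (Hind : forall m a, 0 <= a <= INR (S m) ->
    exists K, 0 < K /\ forall N, sumN (fun j => Rabs (kC (- a) j)) N <= K).
  { clear a. induction m as [|m IH]; intros a Ha.
    - simpl INR in Ha. exists 2; split; [lra|]. intros N.
      (* Only the coefficient at 0 is positive, and it is 1; the sum is therefore 2 - k^(1-a)(N), at
         most 2. *)
      rewrite (sumN_ext _ (fun j => 2 * delta0 j - kC (- a) j)).
      + rewrite sumN_minus, sumN_scal, kC_sum.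
        assert (sumN delta0 N = 1) as ->.
        { rewrite (sumN_single _ N 0); [reflexivity|lia|].
          intros [|i] _ Hi; [congruence|reflexivity]. }
        assert (0 <= kC (- a + 1) N) by (apply kC_nonneg; lra). lra.
      + intros [|j] Hj.
        * simpl. rewrite Rabs_R1. ring.
        * rewrite Rabs_left1 by now apply kC_nonpos. simpl delta0. ring.
    - destruct (Rle_or_lt a (INR (S m))) as [Hle|Hlt]; [apply IH; lra|].
      rewrite S_INR in Ha, Hlt. pose proof (pos_INR m) as Hm.
      rewrite S_INR in Ha.
      destruct (IH (a - 1)) as [K [HK H]]; [rewrite S_INR; lra|].
      exists (2 * K); split; [lra|]. intros N.
      destruct N as [|N].
      { simpl. rewrite Rabs_R1. specialize (H 0%nat). simpl in H. rewrite Rabs_R1 in H. lra. }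
      rewrite decomp_sum by lia. simpl pred.
      apply Rle_trans with (Rabs (kC (- (a - 1)) 0)
        + sumN (fun i => Rabs (kC (- (a - 1)) (S i)) + Rabs (kC (- (a - 1)) i)) N).
      + simpl (kC _ 0). apply Rplus_le_compat_l, sumN_le. intros i Hi.
        replace (- a) with (- (a - 1) - 1) by ring. rewrite kC_pascal.
        replace (kC (- (a - 1)) (S i) - kC (- (a - 1)) i)
          with (kC (- (a - 1)) (S i) + - kC (- (a - 1)) i) by ring.
        eapply Rle_trans; [apply Rabs_triang|]. rewrite Rabs_Ropp. lra.
      + rewrite sumN_plus. pose proof (H N) as H1. pose proof (H (S N)) as H2.
        rewrite decomp_sum in H2 by lia. simpl pred in H2. lra. }
  intros Ha. destruct (INR_unbounded a) as [m Hm].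
  apply (Hind m). rewrite S_INR. lra.
Qed.

(** Needed for the orders m - a - i met when W_+ is iterated, all at most 1: for g in [0,1] the
    ratios are at most 1, for g < 0 the kernel is even summable. *)
Lemma kC_bounded g : g <= 1 -> exists K, 0 < K /\ forall n, Rabs (kC g n) <= K.
Proof.
  intros Hg. destruct (Rle_or_lt 0 g) as [H0|H0].
  - exists 1; split; [lra|]. intros n. rewrite Rabs_pos_eq by now apply kC_nonneg.
    induction n as [|n IH]; cbn [kC]; [lra|].
    assert (Hp : 0 < INR (S n)) by (apply lt_0_INR; lia).
    apply Rmult_le_reg_r with (INR (S n)); [assumption|].
    unfold Rdiv. rewrite Rmult_assoc, Rinv_l, Rmult_1_r, Rmult_1_l by lra.
    pose proof (kC_nonneg g n H0). pose proof (pos_INR n). rewrite S_INR. nra.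
  - destruct (kC_abs_sum (- g)) as [K [HK H]]; [lra|].
    rewrite Ropp_involutive in H. exists K; split; [assumption|]. intros n.
    eapply Rle_trans; [|apply (H n)].
    apply (sumN_term_le (fun j => Rabs (kC g j))); [lia|]. intros; apply Rabs_pos.
Qed.

(** * Complex numbers and series *)

Lemma Cnorm_nonneg z : 0 <= Cnorm z.
Proof. apply sqrt_pos. Qed.

Lemma Cnorm_sqr z : Cnorm z * Cnorm z = fst z * fst z + snd z * snd z.
Proof. apply sqrt_sqrt. nra. Qed.

Lemma Cnorm_le z B : 0 <= B -> fst z * fst z + snd z * snd z <= B * B -> Cnorm z <= B.
Proof.
  intros HB H. rewrite <- (sqrt_square B HB). now apply sqrt_le_1_alt.
Qed.

Lemma Cnorm_fst z : Rabs (fst z) <= Cnorm z.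
Proof.
  rewrite <- sqrt_Rsqr_abs. apply sqrt_le_1_alt. unfold Rsqr. nra.
Qed.

Lemma Cnorm_snd z : Rabs (snd z) <= Cnorm z.
Proof.
  rewrite <- sqrt_Rsqr_abs. apply sqrt_le_1_alt. unfold Rsqr. nra.
Qed.

Lemma Cnorm_le_abs z : Cnorm z <= Rabs (fst z) + Rabs (snd z).
Proof.
  pose proof (Rabs_pos (fst z)). pose proof (Rabs_pos (snd z)).
  apply Cnorm_le; [lra|].
  rewrite <- (Rabs_pos_eq (fst z * fst z)), <- (Rabs_pos_eq (snd z * snd z)), !Rabs_mult by nra.
  nra.
Qed.

Lemma Cnorm_triang a b : Cnorm (Cadd a b) <= Cnorm a + Cnorm b.
Proof.
  pose proof (Cnorm_nonneg a). pose proof (Cnorm_nonneg b).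
  pose proof (Cnorm_sqr a). pose proof (Cnorm_sqr b).
  apply Cnorm_le; [lra|]. simpl.
  assert (fst a * fst b + snd a * snd b <= Cnorm a * Cnorm b); [|nra].
  destruct (Rle_or_lt (fst a * fst b + snd a * snd b) 0); [nra|].
  apply Rsqr_incr_0; [|lra|nra]. unfold Rsqr.
  replace (Cnorm a * Cnorm b * (Cnorm a * Cnorm b))
    with ((Cnorm a * Cnorm a) * (Cnorm b * Cnorm b)) by ring.
  rewrite H1, H2.
  (* Cauchy-Schwarz through Lagrange's identity. *)
  pose proof (Rle_0_sqr (fst a * snd b - snd a * fst b)) as Hs. unfold Rsqr in Hs. nra.
Qed.

Lemma Cnorm_mul a b : Cnorm (Cmul a b) = Cnorm a * Cnorm b.
Proof.
  unfold Cnorm. rewrite <- sqrt_mult by nra. f_equal. simpl. ring.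
Qed.

Lemma Cnorm_real r : Cnorm (r, 0) = Rabs r.
Proof. rewrite <- sqrt_Rsqr_abs. unfold Cnorm, Rsqr. f_equal. simpl. ring. Qed.

Lemma Cnorm_scal r z : Cnorm (r * fst z, r * snd z) = Rabs r * Cnorm z.
Proof.
  rewrite <- Cnorm_real, <- Cnorm_mul. f_equal. unfold Cmul; simpl. f_equal; ring.
Qed.

Lemma Cnorm_opp z : Cnorm (Copp z) = Cnorm z.
Proof. unfold Cnorm; simpl. f_equal. ring. Qed.

Lemma Cnorm_C0 : Cnorm C0 = 0.
Proof. unfold C0. rewrite Cnorm_real. apply Rabs_R0. Qed.

Lemma Cnorm_eq_0 z : Cnorm z = 0 -> z = C0.
Proof.
  intros H. pose proof (Cnorm_fst z) as H1. pose proof (Cnorm_snd z) as H2.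
  rewrite H in H1, H2. destruct z as [x y]; simpl in *. unfold C0. f_equal.
  - destruct (Req_dec x 0) as [|Hx]; [assumption|]. apply Rabs_pos_lt in Hx; lra.
  - destruct (Req_dec y 0) as [|Hx]; [assumption|]. apply Rabs_pos_lt in Hx; lra.
Qed.

Lemma Cnorm_sumN_le (r : nat -> R) (z : nat -> Cx) N :
  Cnorm (sumN (fun i => r i * fst (z i)) N, sumN (fun i => r i * snd (z i)) N)
  <= sumN (fun i => Rabs (r i) * Cnorm (z i)) N.
Proof.
  induction N as [|N IH]; simpl; [rewrite Cnorm_scal; lra|].
  eapply Rle_trans.
  - apply (Cnorm_triang
      (sumN (fun i => r i * fst (z i)) N, sumN (fun i => r i * snd (z i)) N)
      (r (S N) * fst (z (S N)), r (S N) * snd (z (S N)))).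
  - rewrite Cnorm_scal. lra.
Qed.

Lemma Cnorm_lim_le (x y : nat -> R) (lx ly B : R) (L0 : nat) :
  is_lim_seq x lx -> is_lim_seq y ly -> 0 <= B ->
  (forall L, (L0 <= L)%nat -> Cnorm (x L, y L) <= B) -> Cnorm (lx, ly) <= B.
Proof.
  intros Hx Hy HB H. apply Cnorm_le; [assumption|]. simpl.
  apply (is_lim_seq_le_loc (fun L => x L * x L + y L * y L) (fun _ => B * B)
    (lx * lx + ly * ly) (B * B)).
  - exists L0. intros L HL. specialize (H L HL).
    pose proof (Cnorm_sqr (x L, y L)) as Hs. simpl in Hs. rewrite <- Hs.
    pose proof (Cnorm_nonneg (x L, y L)). nra.
  - apply is_lim_seq_plus'; apply is_lim_seq_mult'; assumption.
  - apply is_lim_seq_const.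
Qed.

Lemma is_series_Un_cv (f : nat -> R) l : is_series f l <-> Un_cv (sumN f) l.
Proof. apply is_series_Reals. Qed.

Lemma is_series_lim_sumN (f : nat -> R) l : is_series f l -> is_lim_seq (sumN f) l.
Proof. intros H. apply is_lim_seq_Reals, is_series_Un_cv, H. Qed.

Lemma ex_series_bounded (f : nat -> R) B :
  (forall n, 0 <= f n) -> (forall N, sumN f N <= B) -> ex_series f.
Proof.
  intros Hf HB. destruct (growing_cv (sumN f)) as [l Hl].
  - intros n. simpl. specialize (Hf (S n)). lra.
  - exists B. intros x [n ->]. apply HB.
  - exists l. now apply is_series_Un_cv.
Qed.

Lemma Un_cv_le_const (u : nat -> R) l B : Un_cv u l -> (forall n, u n <= B) -> l <= B.
Proof.
  intros H HB. apply is_lim_seq_Reals in H.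
  apply (is_lim_seq_le u (fun _ => B) l B HB H), is_lim_seq_const.
Qed.

Lemma Un_cv_ge_term (u : nat -> R) l n : Un_growing u -> Un_cv u l -> u n <= l.
Proof. intros Hg H. now apply growing_ineq. Qed.

Lemma Series_le_bound (f : nat -> R) B :
  ex_series f -> (forall N, sumN f N <= B) -> Series f <= B.
Proof.
  intros Hf HB. apply Un_cv_le_const with (sumN f); [|assumption].
  apply is_series_Un_cv, Series_correct, Hf.
Qed.

(** * The difference operators on bounded sequences *)

Definition reZ (f : seqZ) (n : Z) : R := fst (f n).
Definition imZ (f : seqZ) (n : Z) : R := snd (f n).
Definition reflZ {T : Type} (f : Z -> T) (n : Z) : T := f (- n)%Z.

(** The formal power (1 - shift)^a. In contrast to [Wp_frac] it is a single absolutely convergent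
    series on every bounded sequence, and a = 0 is allowed. *)
Definition DR (a : R) (u : Z -> R) (n : Z) : R :=
  Series (fun j => kC (- a) j * u (n + Z.of_nat j)%Z).
Definition Dc (a : R) (f : seqZ) (n : Z) : Cx := (DR a (reZ f) n, DR a (imZ f) n).

Definition bddR (u : Z -> R) : Prop := exists B, forall n, Rabs (u n) <= B.
Definition bddC (f : seqZ) : Prop := exists B, forall n, Cnorm (f n) <= B.
Definition null_right (f : seqZ) : Prop :=
  forall eps, 0 < eps -> exists N : Z, forall n : Z, (N < n)%Z -> Cnorm (f n) < eps.

Lemma bddC_re f : bddC f -> bddR (reZ f).
Proof. intros [B H]; exists B; intros n. eapply Rle_trans; [apply Cnorm_fst|apply H]. Qed.

Lemma bddC_im f : bddC f -> bddR (imZ f).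
Proof. intros [B H]; exists B; intros n. eapply Rle_trans; [apply Cnorm_snd|apply H]. Qed.

Lemma bddR_plus u v : bddR u -> bddR v -> bddR (fun n => u n + v n).
Proof.
  intros [A HA] [B HB]; exists (A + B); intros n.
  eapply Rle_trans; [apply Rabs_triang|]. specialize (HA n); specialize (HB n); lra.
Qed.

Lemma bddR_scal c u : bddR u -> bddR (fun n => c * u n).
Proof.
  intros [A HA]; exists (Rabs c * A); intros n. rewrite Rabs_mult.
  apply Rmult_le_compat_l; [apply Rabs_pos|apply HA].
Qed.

Lemma DR_ex_abs a u n : 0 <= a -> bddR u ->
  ex_series (fun j => Rabs (kC (- a) j * u (n + Z.of_nat j)%Z)).
Proof.
  intros Ha [B HB]. destruct (kC_abs_sum a Ha) as [K [HK H]].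
  assert (0 <= B) by (eapply Rle_trans; [apply Rabs_pos|apply (HB 0%Z)]).
  apply ex_series_bounded with (K * B); [intros; apply Rabs_pos|]. intros N.
  apply Rle_trans with (sumN (fun j => Rabs (kC (- a) j) * B) N).
  - apply sumN_le; intros j _. rewrite Rabs_mult.
    apply Rmult_le_compat_l; [apply Rabs_pos|apply HB].
  - rewrite sumN_scal_r. apply Rmult_le_compat_r; auto.
Qed.

Lemma DR_ex a u n : 0 <= a -> bddR u ->
  ex_series (fun j => kC (- a) j * u (n + Z.of_nat j)%Z).
Proof. intros. now apply ex_series_Rabs, DR_ex_abs. Qed.

(** K depends on a only: this sup-norm continuity carries the passages to the limit in the product
    estimate and in completeness. *)
Lemma DR_bound a : 0 <= a -> exists K, 0 < K /\ forall u B n, 0 <= B ->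
  (forall x, Rabs (u x) <= B) -> Rabs (DR a u n) <= K * B.
Proof.
  intros Ha. destruct (kC_abs_sum a Ha) as [K [HK H]]. exists K; split; [assumption|].
  intros u B n HB Hu.
  assert (Hex : ex_series (fun j => Rabs (kC (- a) j * u (n + Z.of_nat j)%Z))).
  { apply DR_ex_abs; [assumption|]. now exists B. }
  unfold DR. eapply Rle_trans; [now apply Series_Rabs|].
  apply Series_le_bound; [assumption|]. intros N.
  apply Rle_trans with (sumN (fun j => Rabs (kC (- a) j) * B) N).
  - apply sumN_le; intros j _. rewrite Rabs_mult.
    apply Rmult_le_compat_l; [apply Rabs_pos|apply Hu].
  - rewrite sumN_scal_r. apply Rmult_le_compat_r; auto.
Qed.

Lemma DR_ext a u v n : (forall x, (n <= x)%Z -> u x = v x) -> DR a u n = DR a v n.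
Proof. intros H. apply Series_ext; intros j. rewrite H by lia. reflexivity. Qed.

Lemma DR_plus a u v n : 0 <= a -> bddR u -> bddR v ->
  DR a (fun x => u x + v x) n = DR a u n + DR a v n.
Proof.
  intros Ha Hu Hv. unfold DR. rewrite <- Series_plus by now apply DR_ex.
  apply Series_ext; intros j; ring.
Qed.

Lemma DR_scal a c u n : DR a (fun x => c * u x) n = c * DR a u n.
Proof.
  unfold DR. rewrite <- Series_scal_l. apply Series_ext; intros j; ring.
Qed.

Lemma DR_minus a u v n : 0 <= a -> bddR u -> bddR v ->
  DR a (fun x => u x - v x) n = DR a u n - DR a v n.
Proof.
  intros Ha Hu Hv. unfold DR. rewrite <- Series_minus by now apply DR_ex.
  apply Series_ext; intros j; ring.
Qed.

Lemma DR_zero a u n : (forall x, (n <= x)%Z -> u x = 0) -> DR a u n = 0.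
Proof.
  intros H. rewrite (DR_ext a u (fun x => 0 * u x)), DR_scal; [ring|].
  intros x Hx. rewrite H by assumption. ring.
Qed.

Lemma DR_finite a u n L : (forall x, (n + Z.of_nat L < x)%Z -> u x = 0) ->
  DR a u n = sumN (fun j => kC (- a) j * u (n + Z.of_nat j)%Z) L.
Proof.
  intros H. apply is_series_unique, is_series_Un_cv.
  intros eps Heps. exists L; intros N HN.
  rewrite (sumN_extend _ L N) by (try lia; intros i Hi; rewrite H by lia; ring).
  rewrite R_dist_eq. assumption.
Qed.

Lemma DR_order_0 u n : DR 0 u n = u n.
Proof.
  unfold DR. apply is_series_unique, is_series_Un_cv. intros eps Heps.
  exists 0%nat; intros N _. rewrite (sumN_single _ N 0%nat).
  - simpl. rewrite Z.add_0_r, Rmult_1_l, R_dist_eq. assumption.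
  - lia.
  - intros i _ Hi. rewrite Ropp_0, kC_0. destruct i; [congruence|]. simpl; ring.
Qed.

(** * Recovering lower order differences *)

Lemma sumN_cp_weighted x c y L :
  sumN (fun l => cp x c l * y l) L = sumN (fun j => x j * sumN (fun i => c i * y (j + i)%nat) (L - j)) L.
Proof.
  transitivity (sumN (fun l => sumN (fun j => x j * (c (l - j)%nat * y (j + (l - j))%nat)) l) L).
  - apply sumN_ext; intros l Hl. unfold cp. rewrite <- sumN_scal_r.
    apply sumN_ext; intros j Hj. replace (j + (l - j))%nat with l by lia. ring.
  - rewrite (sumN_triangle (fun j i => x j * (c i * y (j + i)%nat))).
    apply sumN_ext; intros j Hj. apply sumN_scal.
Qed.

Definition low (M : nat) (x : nat -> R) (j : nat) : R := if (j <=? M)%nat then x j else 0.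
Definition high (M : nat) (x : nat -> R) (j : nat) : R := if (j <=? M)%nat then 0 else x j.

Lemma low_le M x j : (j <= M)%nat -> low M x j = x j.
Proof. intros H. unfold low. now rewrite (proj2 (Nat.leb_le j M) H). Qed.

Lemma low_gt M x j : (M < j)%nat -> low M x j = 0.
Proof. intros H. unfold low. now rewrite (proj2 (Nat.leb_gt j M) H). Qed.

Lemma high_le M x j : (j <= M)%nat -> high M x j = 0.
Proof. intros H. unfold high. now rewrite (proj2 (Nat.leb_le j M) H). Qed.

Lemma high_gt M x j : (M < j)%nat -> high M x j = x j.
Proof. intros H. unfold high. now rewrite (proj2 (Nat.leb_gt j M) H). Qed.

Lemma sumN_low M x (F : nat -> R) L : (M <= L)%nat ->
  sumN (fun j => low M x j * F j) L = sumN (fun j => x j * F j) M.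
Proof.
  intros H. rewrite (sumN_extend _ M L H).
  - apply sumN_ext; intros i Hi. now rewrite low_le.
  - intros i Hi. rewrite low_gt by lia. ring.
Qed.

(* The truncation k^s_{<= M} is an approximate inverse of k^{-s}: the error
   lives beyond M, has constant sign and total mass at most 1. *)
Section ApproximateInverse.

Variables (s : R) (M : nat).
Hypothesis Hs : 0 <= s <= 1.

Let err (l : nat) : R := cp (low M (kC s)) (kC (- s)) l - delta0 l.

Lemma err_eq_0 l : (l <= M)%nat -> err l = 0.
Proof.
  intros Hl. unfold err.
  rewrite (cp_ext _ (kC s) _ (kC (- s))) by (auto; intros; now rewrite low_le by lia).
  rewrite kC_add, Rplus_opp_r, kC_0. ring.
Qed.

(** Beyond M every term pairs k^s(j) >= 0 with k^(-s)(l-j) where l - j >= 1, so [kC_nonpos]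
    applies. *)
Lemma err_nonpos l : err l <= 0.
Proof.
  destruct (Nat.le_gt_cases l M) as [Hl|Hl]; [rewrite err_eq_0 by assumption; lra|].
  unfold err. destruct l as [|l]; [lia|]. simpl delta0.
  assert (cp (low M (kC s)) (kC (- s)) (S l) <= 0); [|lra].
  unfold cp. rewrite <- (sumN_zero (fun _ => 0) (S l)) by auto. apply sumN_le; intros j Hj.
  destruct (Nat.le_gt_cases j M) as [Hj'|Hj'].
  - rewrite low_le by assumption. replace (S l - j)%nat with (S (l - j)) by lia.
    pose proof (kC_nonneg s j (proj1 Hs)). pose proof (kC_nonpos s (l - j) Hs). nra.
  - rewrite low_gt by assumption. lra.
Qed.

(** By the constant sign the mass is 1 minus the sum of k^s(j) k^(1-s)(L-j) over j <= M, since
    partial sums of [k^(-s)] are values of [k^(1-s)]; that sum is nonnegative because s <= 1. *)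
Lemma err_mass L : sumN (fun l => Rabs (err l)) L <= 1.
Proof.
  rewrite (sumN_ext _ (fun l => delta0 l - cp (low M (kC s)) (kC (- s)) l)).
  2:{ intros l _. pose proof (err_nonpos l). rewrite Rabs_left1 by assumption. unfold err; ring. }
  rewrite sumN_minus, (sumN_single delta0 L 0); [|lia|].
  2:{ intros [|i] _ Hi; [congruence|reflexivity]. }
  rewrite sumN_cp. simpl delta0.
  assert (0 <= sumN (fun j => low M (kC s) j * sumN (kC (- s)) (L - j)) L); [|lra].
  apply sumN_nonneg; intros j Hj. rewrite kC_sum. apply Rmult_le_pos.
  - unfold low. destruct (j <=? M)%nat; [now apply kC_nonneg|lra].
  - apply kC_nonneg; lra.
Qed.

(** Associativity of [low M (kC s)], [k^(-s)] and [k^(-a)], weighted by y and cut at L. It is an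
    identity of finite sums, so it asks nothing of the divergent part of [k^s]. *)
Lemma approximate_inverse a y L : (M <= L)%nat ->
  sumN (fun j => kC s j * sumN (fun i => kC (- (a + s)) i * y (j + i)%nat) (L - j)) M
  = sumN (fun j => kC (- a) j * y j) L
    + sumN (fun i => err i * sumN (fun j => kC (- a) j * y (i + j)%nat) (L - i)) L.
Proof.
  intros HL. rewrite <- (sumN_low M (kC s) _ L HL).
  rewrite <- sumN_cp_weighted, <- sumN_cp_weighted, <- sumN_plus.
  apply sumN_ext; intros l _.
  rewrite <- Rmult_plus_distr_r. f_equal. unfold err.
  rewrite cp_minus_l, cp_delta0_l, <- cp_assoc.
  rewrite (cp_ext (low M (kC s)) (low M (kC s)) (kC (- (a + s))) (cp (kC (- s)) (kC (- a)))); auto.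
  - ring.
  - intros i _. rewrite kC_add. f_equal. ring.
Qed.

End ApproximateInverse.

Lemma sumN_lim_finite (c : nat -> R) (v : nat -> nat -> R) (l : nat -> R) M :
  (forall j, is_lim_seq (v j) (l j)) ->
  is_lim_seq (fun L => sumN (fun j => c j * v j (L - j)%nat) M) (sumN (fun j => c j * l j) M).
Proof.
  intros H.
  assert (H1 : forall j, is_lim_seq (fun L => c j * v j (L - j)%nat) (c j * l j)).
  { intros j. apply (is_lim_seq_scal_l _ (c j) (l j)).
    apply (is_lim_seq_incr_n _ j). eapply is_lim_seq_ext; [|apply (H j)].
    intros n. now replace (n + j - j)%nat with n by lia. }
  induction M as [|M IH]; simpl; [apply H1|].
  now apply is_lim_seq_plus'.
Qed.

(** The estimate is made on the modulus of the complex error and not on its two components, so that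
    the main sum keeps the coefficient 1. *)
Lemma Dc_approx a s f : 0 <= a -> 0 <= s <= 1 -> bddC f ->
  exists K, 0 < K /\ forall n eta M, 0 <= eta ->
    (forall l, (M < l)%nat -> Cnorm (f (n + Z.of_nat l)%Z) <= eta) ->
    Cnorm (Dc a f n) <= sumN (fun j => kC s j * Cnorm (Dc (a + s) f (n + Z.of_nat j)%Z)) M + K * eta.
Proof.
  intros Ha Hs Hf. destruct (kC_abs_sum a Ha) as [K [HK HKs]].
  exists K; split; [assumption|]. intros n eta M Heta Hfar.
  set (T := fun (u : Z -> R) => sumN (fun j => kC s j * DR (a + s) u (n + Z.of_nat j)%Z) M).
  (* The limit is taken on the difference of the two sums: the limit of the error term need not be
     identified, a bound valid for every L is enough. *)
  assert (Hlim : forall u, bddR u -> is_lim_seq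
    (fun L => sumN (fun i => kC (- a) i * u (n + Z.of_nat i)%Z) L
      - sumN (fun j => kC s j * sumN (fun i => kC (- (a + s)) i * u (n + Z.of_nat (j + i))%Z) (L - j)) M)
    (DR a u n - T u)).
  { intros u Hu. apply is_lim_seq_minus'.
    - apply is_series_lim_sumN, Series_correct, DR_ex; assumption.
    - apply (sumN_lim_finite (kC s)
        (fun j L => sumN (fun i => kC (- (a + s)) i * u (n + Z.of_nat (j + i))%Z) L)).
      intros j. eapply is_lim_seq_ext;
        [|apply is_series_lim_sumN, Series_correct, DR_ex; [lra|exact Hu]].
      intros L. apply sumN_ext; intros i _. do 2 f_equal. lia. }
  assert (Hd : Cnorm (DR a (reZ f) n - T (reZ f), DR a (imZ f) n - T (imZ f)) <= K * eta).
  { eapply Cnorm_lim_le with (L0 := M);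
      [apply Hlim, bddC_re, Hf|apply Hlim, bddC_im, Hf|nra|].
    intros L HL. cbv beta.
    rewrite (approximate_inverse s M a (fun x => reZ f (n + Z.of_nat x)%Z)) by assumption.
    rewrite (approximate_inverse s M a (fun x => imZ f (n + Z.of_nat x)%Z)) by assumption.
    set (z := fun i => (sumN (fun j => kC (- a) j * reZ f (n + Z.of_nat (i + j))%Z) (L - i),
                        sumN (fun j => kC (- a) j * imZ f (n + Z.of_nat (i + j))%Z) (L - i))).
    set (r := fun i => - (cp (low M (kC s)) (kC (- s)) i - delta0 i)).
    match goal with |- Cnorm (?x, ?y) <= _ =>
      replace x with (sumN (fun i => r i * fst (z i)) L);
      [replace y with (sumN (fun i => r i * snd (z i)) L)|] end.
    2:{ rewrite (sumN_ext (fun i => r i * snd (z i)) (fun i => -1 * ((cp (low M (kC s)) (kC (- s)) i - delta0 i) * snd (z i)))) by (intros; unfold r; ring).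
        rewrite sumN_scal. unfold z; simpl snd. ring. }
    2:{ rewrite (sumN_ext (fun i => r i * fst (z i)) (fun i => -1 * ((cp (low M (kC s)) (kC (- s)) i - delta0 i) * fst (z i)))) by (intros; unfold r; ring).
        rewrite sumN_scal. unfold z; simpl fst. ring. }
    eapply Rle_trans; [apply Cnorm_sumN_le|].
    apply Rle_trans with (sumN (fun i => Rabs (cp (low M (kC s)) (kC (- s)) i - delta0 i) * (K * eta)) L).
    - apply sumN_le; intros i Hi. unfold r. rewrite Rabs_Ropp.
      (* The error vanishes for i <= M; for i > M the inner sum only sees values of f beyond n + M,
         of modulus at most eta. *)
      destruct (Nat.le_gt_cases i M) as [Hi'|Hi'].
      + pose proof (err_eq_0 s M i Hi') as He. cbv zeta in He. rewrite He, Rabs_R0. lra.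
      + apply Rmult_le_compat_l; [apply Rabs_pos|].
        unfold z. eapply Rle_trans;
          [apply (Cnorm_sumN_le (kC (- a)) (fun j => f (n + Z.of_nat (i + j))%Z))|].
        apply Rle_trans with (sumN (fun j => Rabs (kC (- a) j) * eta) (L - i)).
        * apply sumN_le; intros j _. apply Rmult_le_compat_l; [apply Rabs_pos|].
          apply Hfar; lia.
        * rewrite sumN_scal_r. apply Rmult_le_compat_r; auto.
    - rewrite sumN_scal_r. rewrite <- (Rmult_1_l (K * eta)) at 2.
      apply Rmult_le_compat_r; [nra|]. exact (err_mass s M Hs L). }
  apply Rle_trans with (Cnorm (T (reZ f), T (imZ f)) + K * eta).
  - replace (Dc a f n) with (Cadd (T (reZ f), T (imZ f))
      (DR a (reZ f) n - T (reZ f), DR a (imZ f) n - T (imZ f))).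
    + eapply Rle_trans; [apply Cnorm_triang|]. lra.
    + unfold Dc, Cadd; simpl. f_equal; ring.
  - apply Rplus_le_compat_r. unfold T.
    eapply Rle_trans;
      [apply (Cnorm_sumN_le (kC s) (fun j => Dc (a + s) f (n + Z.of_nat j)%Z))|].
    apply sumN_le; intros j _. rewrite Rabs_pos_eq by (apply kC_nonneg; lra). lra.
Qed.

(** The rectangle n <= N, j <= M lies in the triangle n + j <= N + M, on which the double sum is a
    Cauchy product against h. *)
Lemma sumN_rectangle_le (w k h : nat -> R) N M :
  (forall i, 0 <= w i) -> (forall i, 0 <= k i) -> (forall i, 0 <= h i) ->
  sumN (fun n => w n * sumN (fun j => k j * h (n + j)%nat) M) N
  <= sumN (fun l => cp w k l * h l) (N + M).
Proof.
  intros Hw Hk Hh. rewrite sumN_cp_weighted.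
  assert (Hkh : forall n i, 0 <= k i * h (n + i)%nat) by (intros; apply Rmult_le_pos; auto).
  apply Rle_trans with (sumN (fun n => w n * sumN (fun j => k j * h (n + j)%nat) (N + M - n)) N).
  - apply sumN_le; intros n Hn. apply Rmult_le_compat_l; [auto|].
    apply sumN_mono; [lia|apply Hkh].
  - apply sumN_mono; [lia|]. intros n. apply Rmult_le_pos; [auto|].
    apply sumN_nonneg; auto.
Qed.

Lemma Dc_step a s f (w w' : nat -> R) : 0 <= a -> 0 <= s <= 1 -> bddC f -> null_right f ->
  (forall n, 0 <= w n) -> (forall l, cp w (kC s) l <= w' l) ->
  forall N eps, 0 < eps -> exists M,
    sumN (fun n => w n * Cnorm (Dc a f (Z.of_nat n))) N
    <= sumN (fun l => w' l * Cnorm (Dc (a + s) f (Z.of_nat l))) M + eps.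
Proof.
  intros Ha Hs Hb Hnull Hw Hww N eps Heps.
  destruct (Dc_approx a s f Ha Hs Hb) as [K [HK H]].
  set (W := sumN w N). assert (HW : 0 <= W) by (apply sumN_nonneg; auto).
  (* The errors K * eta, weighted by w, add up to K * eta * W <= eps. One M serves all n >= 0, since
     n + l > P as soon as l > M. *)
  set (eta := eps / (K * (W + 1))).
  assert (Heta : 0 < eta) by (apply Rdiv_lt_0_compat; [assumption|nra]).
  destruct (Hnull eta Heta) as [P HP]. set (M := Z.to_nat P).
  exists (N + M)%nat.
  apply Rle_trans with (sumN (fun n => w n *
    sumN (fun j => kC s j * Cnorm (Dc (a + s) f (Z.of_nat (n + j)))) M + w n * (K * eta)) N).
  - apply sumN_le; intros n _. rewrite <- Rmult_plus_distr_l.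
    apply Rmult_le_compat_l; [auto|].
    eapply Rle_trans; [apply (H (Z.of_nat n) eta M); [lra|]|].
    + intros l Hl. left; apply HP. unfold M in Hl. lia.
    + apply Rplus_le_compat_r. right. apply sumN_ext; intros j _. do 3 f_equal. lia.
  - rewrite sumN_plus, sumN_scal_r. apply Rplus_le_compat.
    + eapply Rle_trans; [apply (sumN_rectangle_le w (kC s) (fun l => Cnorm (Dc (a + s) f (Z.of_nat l))))|].
      * assumption.
      * intros; apply kC_nonneg; lra.
      * intros; apply Cnorm_nonneg.
      * apply sumN_le; intros l _. apply Rmult_le_compat_r; [apply Cnorm_nonneg|apply Hww].
    + fold W. assert (He : K * eta * (W + 1) = eps) by (unfold eta; field; split; lra).
      assert (0 < K * eta) by nra. nra.
Qed.

(** The cutoff is n0 = 0 on the half n >= 0 and n0 = 1 on the reflected half n < 0, so that the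
    index 0 is counted once. *)
Definition wt (n0 : nat) (a : R) (n : nat) : R := if (n0 <=? n)%nat then kC (a + 1) n else 0.

Lemma wt_nonneg n0 a n : 0 <= a -> 0 <= wt n0 a n.
Proof. intros Ha. unfold wt. destruct (n0 <=? n)%nat; [apply kC_nonneg|]; lra. Qed.

Lemma cp_wt_le n0 a s l : 0 <= a -> 0 <= s -> cp (wt n0 a) (kC s) l <= wt n0 (a + s) l.
Proof.
  intros Ha Hs. unfold wt at 2. destruct (Nat.leb_spec n0 l) as [Hl|Hl].
  - replace (a + s + 1) with (a + 1 + s) by ring. rewrite <- kC_add.
    apply sumN_le; intros i _. apply Rmult_le_compat_r; [now apply kC_nonneg|].
    unfold wt. destruct (n0 <=? i)%nat; [lra|apply kC_nonneg; lra].
  - right. apply sumN_zero; intros i Hi. unfold wt.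
    rewrite (proj2 (Nat.leb_gt n0 i)) by lia. ring.
Qed.

(** The form with N, eps and M compares the two sums before either is known to converge. *)
Lemma Dc_order_le n0 a b f : 0 <= a <= b -> bddC f -> null_right f ->
  forall N eps, 0 < eps -> exists M,
    sumN (fun n => wt n0 a n * Cnorm (Dc a f (Z.of_nat n))) N
    <= sumN (fun n => wt n0 b n * Cnorm (Dc b f (Z.of_nat n))) M + eps.
Proof.
  intros Hab Hf Hn.
  assert (Hind : forall m a, 0 <= a <= b -> b <= a + INR m ->
    forall N eps, 0 < eps -> exists M,
    sumN (fun n => wt n0 a n * Cnorm (Dc a f (Z.of_nat n))) N
    <= sumN (fun n => wt n0 b n * Cnorm (Dc b f (Z.of_nat n))) M + eps).
  { clear a Hab. induction m as [|m IH]; intros a Ha Hb N eps Heps.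
    - simpl INR in Hb. replace b with a by lra. exists N. lra.
    - set (s := Rmin 1 (b - a)).
      assert (Hs : 0 <= s <= 1) by (unfold s; split; [apply Rmin_glb; lra|apply Rmin_l]).
      assert (Hs2 : s <= b - a) by apply Rmin_r.
      destruct (Dc_step a s f (wt n0 a) (wt n0 (a + s))) with (N := N) (eps := eps / 2)
        as [M HM]; try lra; auto.
      + intros n; apply wt_nonneg; lra.
      + intros l; apply cp_wt_le; lra.
      + destruct (IH (a + s)) with (N := M) (eps := eps / 2) as [M' HM']; try lra.
        * rewrite S_INR in Hb. unfold s, Rmin. pose proof (pos_INR m).
          destruct (Rle_dec 1 (b - a)); lra.
        * exists M'. lra. }
  destruct (INR_unbounded (b - a)) as [m Hm]. apply (Hind m a Hab). lra.
Qed.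

(** * Fractional differences as absolutely convergent series *)

Definition nullZ (f : seqZ) : Prop :=
  forall eps, 0 < eps -> exists N : Z, forall n : Z, (N < Z.abs n)%Z -> Cnorm (f n) < eps.

Lemma nullZ_right f : nullZ f -> null_right f.
Proof.
  intros H eps Heps. destruct (H eps Heps) as [N HN]. exists (Z.max 0 N).
  intros n Hn. apply HN. lia.
Qed.

Lemma nullZ_refl f : nullZ f -> nullZ (reflZ f).
Proof.
  intros H eps Heps. destruct (H eps Heps) as [N HN]. exists N.
  intros n Hn. apply HN. lia.
Qed.

Lemma finite_range_bounded (t : Z -> R) (N : nat) :
  exists B, forall n, (Z.abs n <= Z.of_nat N)%Z -> t n <= B.
Proof.
  induction N as [|N [B HB]].
  - exists (t 0%Z). intros n Hn. replace n with 0%Z by lia. lra.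
  - exists (Rmax B (Rmax (t (Z.of_nat (S N))) (t (- Z.of_nat (S N))%Z))). intros n Hn.
    destruct (Z.eq_dec n (Z.of_nat (S N))) as [->|H1].
    { eapply Rle_trans; [|apply Rmax_r]. apply Rmax_l. }
    destruct (Z.eq_dec n (- Z.of_nat (S N))%Z) as [->|H2].
    { eapply Rle_trans; [|apply Rmax_r]. apply Rmax_r. }
    eapply Rle_trans; [|apply Rmax_l]. apply HB. lia.
Qed.

Lemma nullZ_bdd f : nullZ f -> bddC f.
Proof.
  intros H. destruct (H 1 Rlt_0_1) as [N HN].
  destruct (finite_range_bounded (fun n => Cnorm (f n)) (Z.to_nat N)) as [B HB].
  exists (Rmax 1 B). intros n.
  destruct (Z_lt_le_dec N (Z.abs n)) as [Hn|Hn].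
  - eapply Rle_trans; [|apply Rmax_l]. left; now apply HN.
  - eapply Rle_trans; [|apply Rmax_r]. apply HB. lia.
Qed.

Lemma bddC_refl f : bddC f -> bddC (reflZ f).
Proof. intros [B H]; exists B; intros n; apply H. Qed.

Lemma cv_Wp_iff g f n l : cv_C (Wp_neg_terms g f n) l <->
  is_series (fun j => kC g j * reZ f (n + Z.of_nat j)%Z) (fst l) /\
  is_series (fun j => kC g j * imZ f (n + Z.of_nat j)%Z) (snd l).
Proof.
  unfold cv_C, sumC; cbn [fst snd]. rewrite !is_series_Un_cv.
  replace (fun N => sumN (fun j => fst (Wp_neg_terms g f n j)) N)
    with (sumN (fun j => kC g j * reZ f (n + Z.of_nat j)%Z)).
  2:{ extensionality N. apply sumN_ext; intros j _. unfold Wp_neg_terms, reZ; simpl. ring. }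
  replace (fun N => sumN (fun j => snd (Wp_neg_terms g f n j)) N)
    with (sumN (fun j => kC g j * imZ f (n + Z.of_nat j)%Z)).
  2:{ extensionality N. apply sumN_ext; intros j _. unfold Wp_neg_terms, imZ; simpl. ring. }
  tauto.
Qed.

(** Summation by parts through [kC_pascal]; the last term is the boundary contribution at J. *)
Lemma sumN_pascal g (y : nat -> R) J :
  sumN (fun j => kC (g - 1) j * y j) J
  = sumN (fun j => kC g j * y j) J - sumN (fun j => kC g j * y (S j)) J + kC g J * y (S J).
Proof.
  induction J as [|J IH]; [simpl; ring|].
  rewrite !tech5, IH, kC_pascal. ring.
Qed.

Lemma is_series_pascal g (y : nat -> R) l l' :
  is_series (fun j => kC g j * y j) l -> is_series (fun j => kC g j * y (S j)) l' ->
  is_lim_seq (fun J => kC g J * y (S J)) 0 ->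
  is_series (fun j => kC (g - 1) j * y j) (l - l').
Proof.
  intros H1 H2 H3. apply is_series_Un_cv, is_lim_seq_Reals.
  replace (l - l') with (l - l' + 0) by ring.
  eapply is_lim_seq_ext; [intros J; symmetry; apply sumN_pascal|].
  apply is_lim_seq_plus'; [|assumption].
  apply is_lim_seq_minus'; now apply is_series_lim_sumN.
Qed.

(** The boundary term of [sumN_pascal] disappears: a bounded kernel against a sequence tending to 0.
    Here the decay in the definition of [tau] enters. *)
Lemma is_lim_seq_kC_null g f (comp : Cx -> R) n :
  (forall z, Rabs (comp z) <= Cnorm z) -> g <= 1 -> null_right f ->
  is_lim_seq (fun J => kC g J * comp (f (n + Z.of_nat (S J))%Z)) 0.
Proof.
  intros Hc Hg Hf. destruct (kC_bounded g Hg) as [K [HK HKb]].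
  apply is_lim_seq_Reals. intros eps Heps.
  destruct (Hf (eps / K)) as [P HP]; [now apply Rdiv_lt_0_compat|].
  exists (Z.to_nat (P - n)). intros J HJ. unfold R_dist. rewrite Rminus_0_r, Rabs_mult.
  assert (Hx : Cnorm (f (n + Z.of_nat (S J))%Z) < eps / K) by (apply HP; lia).
  pose proof (Hc (f (n + Z.of_nat (S J))%Z)) as H1.
  apply Rle_lt_trans with (K * Rabs (comp (f (n + Z.of_nat (S J))%Z))).
  - apply Rmult_le_compat_r; [apply Rabs_pos|apply HKb].
  - replace eps with (K * (eps / K)) by (field; lra). apply Rmult_lt_compat_l; lra.
Qed.

(** Each W_+ lowers the order of the kernel by 1. Starting from g = m - a, the m-th iterate has
    kernel [k^(-a)] and is [Dc a f]. *)
Lemma Wp_iter_cv g f (n0 : Z) : g <= 1 -> null_right f ->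
  (forall n, (n0 <= n)%Z -> exists l, cv_C (Wp_neg_terms g f n) l) ->
  forall i n, (n0 <= n)%Z ->
    cv_C (Wp_neg_terms (g - INR i) f n) (Nat.iter i Wp (Wp_neg g f) n).
Proof.
  intros Hg Hf Hex. induction i as [|i IH]; intros n Hn.
  - simpl INR. rewrite Rminus_0_r.
    apply (epsilon_spec (inhabits C0) (cv_C (Wp_neg_terms g f n))), Hex, Hn.
  - pose proof (IH n Hn) as H1. assert (H2 := IH (n + 1)%Z ltac:(lia)).
    apply cv_Wp_iff in H1, H2. destruct H1 as [H1 H1'], H2 as [H2 H2'].
    set (G := Nat.iter i Wp (Wp_neg g f)) in *.
    apply cv_Wp_iff. rewrite S_INR.
    change (Nat.iter (S i) Wp (Wp_neg g f)) with (Wp G).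
    replace (g - (INR i + 1)) with (g - INR i - 1) by ring.
    pose proof (pos_INR i).
    assert (Hsh : forall j, (n + 1 + Z.of_nat j = n + Z.of_nat (S j))%Z) by (intros; lia).
    split.
    + apply (is_series_pascal _ (fun j => reZ f (n + Z.of_nat j)%Z)); [assumption| |].
      * eapply is_series_ext; [|exact H2]. intros j. simpl. now rewrite Hsh.
      * apply (is_lim_seq_kC_null _ f fst); [apply Cnorm_fst|lra|assumption].
    + apply (is_series_pascal _ (fun j => imZ f (n + Z.of_nat j)%Z)); [assumption| |].
      * eapply is_series_ext; [|exact H2']. intros j. simpl. now rewrite Hsh.
      * apply (is_lim_seq_kC_null _ f snd); [apply Cnorm_snd|lra|assumption].
Qed.

Lemma mexp_bounds a : 0 < a -> 0 < INR (mexp a) - a <= 1.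
Proof.
  intros Ha. destruct (base_Int_part a) as [H1 H2].
  assert (H3 : (-1 < Int_part a)%Z) by (apply lt_IZR; lra).
  unfold mexp. rewrite S_INR, INR_IZR_INZ, Z2Nat.id by lia. lra.
Qed.

Lemma Wp_frac_Dc a f (n0 n : Z) : 0 < a -> null_right f ->
  (forall n, (n0 <= n)%Z -> exists l, cv_C (Wp_neg_terms (INR (mexp a) - a) f n) l) ->
  (n0 <= n)%Z -> Wp_frac a f n = Dc a f n.
Proof.
  intros Ha Hf Hex Hn. pose proof (mexp_bounds a Ha) as Hm.
  pose proof (Wp_iter_cv _ f n0 (proj2 Hm) Hf Hex (mexp a) n Hn) as H.
  apply cv_Wp_iff in H. fold (Wp_frac a f) in H.
  replace (INR (mexp a) - a - INR (mexp a)) with (- a) in H by ring.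
  destruct H as [H1 H2]. apply is_series_unique in H1, H2.
  unfold Dc, DR. rewrite H1, H2. now destruct (Wp_frac a f n).
Qed.

Lemma Wm_neg_terms_refl g f n : Wm_neg_terms g f n = Wp_neg_terms g (reflZ f) (- n)%Z.
Proof.
  extensionality j. unfold Wm_neg_terms, Wp_neg_terms, reflZ. do 2 f_equal. lia.
Qed.

Lemma Wm_iter_refl g f i : forall n,
  Nat.iter i Wm (Wm_neg g f) n = Nat.iter i Wp (Wp_neg g (reflZ f)) (- n)%Z.
Proof.
  induction i as [|i IH]; intros n.
  - simpl. unfold Wm_neg, Wp_neg. now rewrite Wm_neg_terms_refl.
  - change (Wm (Nat.iter i Wm (Wm_neg g f)) n
      = Wp (Nat.iter i Wp (Wp_neg g (reflZ f))) (- n)%Z).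
    unfold Wm, Wp. rewrite !IH. do 2 f_equal. lia.
Qed.

(** Reflection turns n < 0 into -n >= 1, so the second case runs with lower end 1, exactly the range
    on which [Wdef] provides convergence. *)
Lemma Wfrac_Dc a f n : 0 < a -> nullZ f -> Wdef a f ->
  Wfrac a f n = if (0 <=? n)%Z then Dc a f n else Dc a (reflZ f) (- n)%Z.
Proof.
  intros Ha Hf [Hp Hm]. unfold Wfrac. destruct (Z.leb_spec 0 n) as [Hn|Hn].
  - apply (Wp_frac_Dc a f 0); auto. now apply nullZ_right.
  - unfold Wm_frac. rewrite Wm_iter_refl. apply (Wp_frac_Dc a (reflZ f) 1); try lia; auto.
    + now apply nullZ_right, nullZ_refl.
    + intros k Hk. destruct (Hm (- k)%Z ltac:(lia)) as [l Hl]. exists l.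
      rewrite Wm_neg_terms_refl in Hl. now rewrite Z.opp_involutive in Hl.
Qed.

(** * Sums over the integers *)

(** Groups n with -n, and 0 alone: symmetric partial sums over the integers become ordinary partial
    sums over the naturals. *)
Definition foldZ (t : Z -> R) (n : nat) : R :=
  t (Z.of_nat n) + (if (1 <=? n)%nat then t (- Z.of_nat n)%Z else 0).

Lemma sumZ_fold t N : sumZ_R t N = sumN (foldZ t) N.
Proof.
  unfold sumZ_R. induction N as [|N IH].
  - simpl. unfold foldZ; simpl. ring.
  - rewrite tech5, <- IH. replace (2 * S N)%nat with (S (S (2 * N))) by lia.
    rewrite tech5, decomp_sum by lia. change (pred (S (2 * N))) with (2 * N)%nat.
    rewrite (sumN_ext (fun i => t (Z.of_nat (S i) - Z.of_nat (S N))%Z)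
      (fun i => t (Z.of_nat i - Z.of_nat N)%Z)).
    2:{ intros i _. f_equal. lia. }
    unfold foldZ. change (1 <=? S N)%nat with true. cbv iota.
    replace (Z.of_nat (S (S (2 * N))) - Z.of_nat (S N))%Z with (Z.of_nat (S N)) by lia.
    replace (Z.of_nat 0 - Z.of_nat (S N))%Z with (- Z.of_nat (S N))%Z by lia.
    ring.
Qed.

Lemma foldZ_nonneg t n : (forall x, 0 <= t x) -> 0 <= foldZ t n.
Proof.
  intros H. unfold foldZ. pose proof (H (Z.of_nat n)). pose proof (H (- Z.of_nat n)%Z).
  destruct (1 <=? n)%nat; lra.
Qed.

Lemma sumZ_growing t : (forall x, 0 <= t x) -> Un_growing (sumZ_R t).
Proof.
  intros H n. rewrite !sumZ_fold. simpl. pose proof (foldZ_nonneg t (S n) H). lra.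
Qed.

Lemma sumZ_ext t t' N : (forall n, (Z.abs n <= Z.of_nat N)%Z -> t n = t' n) ->
  sumZ_R t N = sumZ_R t' N.
Proof. intros H. apply sumN_ext; intros i Hi. apply H. lia. Qed.

Lemma sumZ_le t t' N : (forall n, (Z.abs n <= Z.of_nat N)%Z -> t n <= t' n) ->
  sumZ_R t N <= sumZ_R t' N.
Proof. intros H. apply sumN_le; intros i Hi. apply H. lia. Qed.

Lemma sumZ_plus t t' N : sumZ_R (fun n => t n + t' n) N = sumZ_R t N + sumZ_R t' N.
Proof. apply (sumN_plus (fun i => t (Z.of_nat i - Z.of_nat N)%Z)). Qed.

Lemma sumZ_scal c t N : sumZ_R (fun n => c * t n) N = c * sumZ_R t N.
Proof. apply (sumN_scal c (fun i => t (Z.of_nat i - Z.of_nat N)%Z)). Qed.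

Lemma sumZ_nonneg t N : (forall x, 0 <= t x) -> 0 <= sumZ_R t N.
Proof. intros H. apply sumN_nonneg; auto. Qed.

Lemma sumZ_term_le t N n : (forall x, 0 <= t x) -> (Z.abs n <= Z.of_nat N)%Z ->
  t n <= sumZ_R t N.
Proof.
  intros H Hn. unfold sumZ_R.
  replace n with (Z.of_nat (Z.to_nat (n + Z.of_nat N)) - Z.of_nat N)%Z at 1 by lia.
  apply (sumN_term_le (fun i => t (Z.of_nat i - Z.of_nat N)%Z)); [lia|auto].
Qed.

Lemma sumZ_mono t N M : (forall x, 0 <= t x) -> (N <= M)%nat -> sumZ_R t N <= sumZ_R t M.
Proof.
  intros H HNM. rewrite !sumZ_fold. apply sumN_mono; [assumption|].
  intros; now apply foldZ_nonneg.
Qed.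

Lemma cvZ_bounded t B : (forall x, 0 <= t x) -> (forall N, sumZ_R t N <= B) ->
  exists l, cvZ_R t l.
Proof.
  intros Ht HB. destruct (growing_cv (sumZ_R t)) as [l Hl].
  - now apply sumZ_growing.
  - exists B. intros x [n ->]. apply HB.
  - now exists l.
Qed.

Lemma cvZ_sup t l N : (forall x, 0 <= t x) -> cvZ_R t l -> sumZ_R t N <= l.
Proof. intros Ht H. apply Un_cv_ge_term; [now apply sumZ_growing|assumption]. Qed.

Lemma seriesZ_eq t l : cvZ_R t l -> seriesZ_R t = l.
Proof.
  intros H. unfold seriesZ_R. apply (UL_sequence (sumZ_R t)); [|exact H].
  apply (epsilon_spec (inhabits 0) (cvZ_R t)). now exists l.
Qed.

Lemma seriesZ_cv t : (exists l, cvZ_R t l) -> cvZ_R t (seriesZ_R t).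
Proof. intros [l Hl]. now rewrite (seriesZ_eq t l Hl). Qed.

(** * The norm and its partial sums *)

(** Partial sum of [q] rewritten with [Dc]. It can be estimated before membership in [tau] is known,
    and a = 0 gives the partial sums of the l^1 norm. *)
Definition qpart (a : R) (f : seqZ) (N : nat) : R :=
  sumN (fun n => wt 0 a n * Cnorm (Dc a f (Z.of_nat n))) N
  + sumN (fun n => wt 1 a n * Cnorm (Dc a (reflZ f) (Z.of_nat n))) N.

Definition inL1 (f : seqZ) : Prop := exists A, forall N, sumZ_R (fun n => Cnorm (f n)) N <= A.

Lemma Dc_order_0 f n : Dc 0 f n = f n.
Proof. unfold Dc. rewrite !DR_order_0. unfold reZ, imZ. now destruct (f n). Qed.

Lemma qpart_order_0 f N : qpart 0 f N = sumZ_R (fun n => Cnorm (f n)) N.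
Proof.
  unfold qpart. rewrite sumZ_fold, <- sumN_plus. apply sumN_ext; intros n _.
  rewrite !Dc_order_0. unfold foldZ, wt, reflZ. rewrite Rplus_0_l, kC_1.
  destruct n; simpl; ring.
Qed.

Lemma sumZ_q_terms a f N : 0 < a -> nullZ f -> Wdef a f ->
  sumZ_R (q_terms a f) N = qpart a f N.
Proof.
  intros Ha Hf Hw. unfold qpart. rewrite sumZ_fold, <- sumN_plus.
  apply sumN_ext; intros n _. unfold foldZ, q_terms.
  rewrite !Wfrac_Dc by assumption. rewrite (proj2 (Z.leb_le 0 (Z.of_nat n))) by lia.
  replace (Z.abs_nat (Z.of_nat n)) with n by lia.
  replace (Z.abs_nat (- Z.of_nat n)) with n by lia. rewrite Z.opp_involutive.
  unfold wt at 1. simpl (0 <=? n)%nat. cbv iota. f_equal. unfold wt.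
  destruct (Nat.leb_spec 1 n) as [Hn|Hn]; [|ring].
  now rewrite (proj2 (Z.leb_gt 0 (- Z.of_nat n))) by lia.
Qed.

Lemma inL1_null f : inL1 f -> nullZ f.
Proof.
  intros [A HA] eps Heps.
  assert (H0 : forall x, 0 <= Cnorm (f x)) by (intros; apply Cnorm_nonneg).
  destruct (cvZ_bounded _ A H0 HA) as [l Hl].
  destruct (Hl eps Heps) as [N HN]. exists (Z.of_nat N). intros n Hn.
  specialize (HN N (Nat.le_refl N)). unfold R_dist in HN.
  (* The index n enters the symmetric sum exactly when passing from M to S M = |n|. *)
  set (M := (Z.abs_nat n - 1)%nat).
  assert (HNM : sumZ_R (fun n => Cnorm (f n)) N <= sumZ_R (fun n => Cnorm (f n)) M).
  { apply sumZ_mono; [auto|]. unfold M. lia. }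
  pose proof (cvZ_sup _ l (S M) H0 Hl) as H1.
  pose proof (cvZ_sup _ l N H0 Hl) as H2.
  rewrite Rabs_left1 in HN by lra.
  assert (H3 : sumZ_R (fun n => Cnorm (f n)) M + Cnorm (f n)
    <= sumZ_R (fun n => Cnorm (f n)) (S M)); [|lra].
  rewrite !sumZ_fold, tech5. apply Rplus_le_compat_l. unfold foldZ.
  change (1 <=? S M)%nat with true. cbv iota.
  pose proof (H0 (Z.of_nat (S M))). pose proof (H0 (- Z.of_nat (S M))%Z).
  destruct (Z_lt_le_dec n 0).
  - replace (- Z.of_nat (S M))%Z with n in * by (unfold M; lia). lra.
  - replace (Z.of_nat (S M)) with n in * by (unfold M; lia). lra.
Qed.

Lemma sumZ_refl t N : sumZ_R (reflZ t) N = sumZ_R t N.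
Proof.
  unfold sumZ_R. rewrite sumN_rev. apply sumN_ext; intros i Hi. unfold reflZ. f_equal. lia.
Qed.

Lemma inL1_refl f : inL1 f -> inL1 (reflZ f).
Proof.
  intros [A HA]; exists A; intros N.
  specialize (HA N). rewrite <- (sumZ_refl (fun n => Cnorm (f n))) in HA. exact HA.
Qed.

Lemma inL1_bdd f : inL1 f -> bddC f.
Proof. intros H. now apply nullZ_bdd, inL1_null. Qed.

(** A bounded kernel against a summable sequence. Thus summability alone gives [Wdef], whose order m
    - a lies in (0,1]. *)
Lemma inL1_Wp_neg g f n : 0 <= g <= 1 -> inL1 f -> exists l, cv_C (Wp_neg_terms g f n) l.
Proof.
  intros Hg [A HA].
  destruct (kC_bounded g (proj2 Hg)) as [K [HK HKb]].
  assert (H0 : forall x, 0 <= Cnorm (f x)) by (intros; apply Cnorm_nonneg).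
  assert (Hex : forall comp : Cx -> R, (forall z, Rabs (comp z) <= Cnorm z) ->
    ex_series (fun j => kC g j * comp (f (n + Z.of_nat j)%Z))).
  { intros comp Hc. apply ex_series_Rabs, ex_series_bounded with (K * A).
    - intros; apply Rabs_pos.
    - intros N. apply Rle_trans with (sumN (fun j => K * Cnorm (f (n + Z.of_nat j)%Z)) N).
      + apply sumN_le; intros j _. rewrite Rabs_mult.
        apply Rmult_le_compat; auto using Rabs_pos.
      + rewrite sumN_scal. apply Rmult_le_compat_l; [lra|].
        set (P := (Z.abs_nat n + N)%nat).
        eapply Rle_trans; [|apply (HA P)]. unfold sumZ_R.
        set (c := Z.to_nat (n + Z.of_nat P)).
        rewrite (sumN_ext _ (fun j => (fun i => Cnorm (f (Z.of_nat i - Z.of_nat P)%Z)) (j + c)%nat)).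
        * eapply Rle_trans;
            [apply (sumN_shift_le (fun i => Cnorm (f (Z.of_nat i - Z.of_nat P)%Z))); intros; apply H0|].
          apply sumN_mono; [unfold c, P; lia|intros; apply H0].
        * intros j _. do 2 f_equal. unfold c, P. lia. }
  exists (Series (fun j => kC g j * reZ f (n + Z.of_nat j)%Z),
          Series (fun j => kC g j * imZ f (n + Z.of_nat j)%Z)).
  apply cv_Wp_iff; simpl. split; apply Series_correct.
  - apply (Hex fst), Cnorm_fst.
  - apply (Hex snd), Cnorm_snd.
Qed.

Lemma inL1_Wdef a f : 0 < a -> inL1 f -> Wdef a f.
Proof.
  intros Ha Hf. pose proof (mexp_bounds a Ha). split; intros n Hn.
  - apply inL1_Wp_neg; [lra|assumption].
  - rewrite Wm_neg_terms_refl. apply inL1_Wp_neg; [lra|now apply inL1_refl].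
Qed.

Lemma qpart_order_le a b f B : 0 <= a <= b -> nullZ f ->
  (forall N, qpart b f N <= B) -> forall N, qpart a f N <= B.
Proof.
  intros Hab Hf HB N. apply le_epsilon; intros eps Heps.
  destruct (Dc_order_le 0 a b f) with (N := N) (eps := eps / 2) as [M1 H1];
    [assumption|now apply nullZ_bdd|now apply nullZ_right|lra|].
  destruct (Dc_order_le 1 a b (reflZ f)) with (N := N) (eps := eps / 2) as [M2 H2];
    [assumption|now apply nullZ_bdd, nullZ_refl|now apply nullZ_right, nullZ_refl|lra|].
  assert (Hm : forall n0 g M, (M <= M1 + M2)%nat ->
    sumN (fun n => wt n0 b n * Cnorm (Dc b g (Z.of_nat n))) M
    <= sumN (fun n => wt n0 b n * Cnorm (Dc b g (Z.of_nat n))) (M1 + M2)).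
  { intros n0 g M HM. apply sumN_mono; [assumption|]. intros n.
    apply Rmult_le_pos; [apply wt_nonneg; lra|apply Cnorm_nonneg]. }
  assert (H3 := Hm 0%nat f M1 ltac:(lia)).
  assert (H4 := Hm 1%nat (reflZ f) M2 ltac:(lia)).
  specialize (HB (M1 + M2)%nat). unfold qpart in *. lra.
Qed.

Lemma q_terms_nonneg a f n : 0 < a -> 0 <= q_terms a f n.
Proof.
  intros Ha. apply Rmult_le_pos; [apply kC_nonneg; lra|apply Cnorm_nonneg].
Qed.

Lemma tau_null a f : tau a f -> nullZ f.
Proof. intros [H _]. exact H. Qed.

Lemma tau_qpart_le a f N : 0 < a -> tau a f -> qpart a f N <= q a f.
Proof.
  intros Ha [Hn [Hw Hl]]. rewrite <- sumZ_q_terms by assumption.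
  apply cvZ_sup; [intros; now apply q_terms_nonneg|]. now apply seriesZ_cv.
Qed.

Lemma tau_q_le a f B : 0 < a -> tau a f -> (forall N, qpart a f N <= B) -> q a f <= B.
Proof.
  intros Ha [Hn [Hw Hl]] HB. apply (Un_cv_le_const (sumZ_R (q_terms a f))).
  - now apply seriesZ_cv.
  - intros N. now rewrite sumZ_q_terms.
Qed.

Lemma tau_l1_le a f N : 0 < a -> tau a f -> sumZ_R (fun n => Cnorm (f n)) N <= q a f.
Proof.
  intros Ha Hf. rewrite <- qpart_order_0. apply (qpart_order_le 0 a); [lra|now apply (tau_null a)|].
  intros M. now apply tau_qpart_le.
Qed.

(** Reduces membership to bounds on partial sums; later membership proofs use this form. From left
    to right, summability is the comparison of order 0 with order a. *)
Lemma tau_iff a f : 0 < a ->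
  (tau a f <-> inL1 f /\ exists B, forall N, qpart a f N <= B).
Proof.
  intros Ha. split.
  - intros Hf. split; exists (q a f); intros N; [now apply tau_l1_le|now apply tau_qpart_le].
  - intros [Hf [B HB]]. split; [now apply inL1_null|]. split; [now apply inL1_Wdef|].
    apply cvZ_bounded with B; [intros; now apply q_terms_nonneg|].
    intros N. rewrite sumZ_q_terms; auto using inL1_null, inL1_Wdef.
Qed.

Lemma inL1_iff f : inL1 f <-> in_l1 f.
Proof.
  split.
  - intros [A HA]. apply cvZ_bounded with A; [intros; apply Cnorm_nonneg|assumption].
  - intros [l Hl]. exists l; intros N. apply cvZ_sup; [intros; apply Cnorm_nonneg|assumption].
Qed.

Lemma l1norm_le f B : inL1 f -> (forall N, sumZ_R (fun n => Cnorm (f n)) N <= B) -> l1norm f <= B.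
Proof.
  intros Hf HB. apply inL1_iff in Hf. apply (Un_cv_le_const (sumZ_R (fun n => Cnorm (f n)))).
  - now apply seriesZ_cv.
  - assumption.
Qed.

(** * Absolutely convergent sums and convolution of real sequences *)

Definition l1le (t : Z -> R) (A : R) : Prop := forall N, sumZ_R (fun n => Rabs (t n)) N <= A.
Definition summable (t : Z -> R) : Prop := exists A, l1le t A.

Notation SZ := seriesZ_R.

Lemma l1le_nonneg t A : l1le t A -> 0 <= A.
Proof.
  intros H. eapply Rle_trans; [|apply (H 0%nat)]. apply sumZ_nonneg; intros; apply Rabs_pos.
Qed.

Lemma summable_cv t : summable t -> cvZ_R t (SZ t).
Proof.
  intros [A HA]. apply seriesZ_cv.
  assert (Hex : ex_series (foldZ t)).
  { apply ex_series_Rabs, ex_series_bounded with A; [intros; apply Rabs_pos|].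
    intros N. eapply Rle_trans; [|apply (HA N)]. rewrite sumZ_fold.
    apply sumN_le; intros n _. unfold foldZ. eapply Rle_trans; [apply Rabs_triang|].
    apply Rplus_le_compat_l. destruct (1 <=? n)%nat; [lra|rewrite Rabs_R0; lra]. }
  destruct Hex as [l Hl]. exists l. apply is_series_Un_cv in Hl.
  unfold cvZ_R. now replace (sumZ_R t) with (sumN (foldZ t)) by
    (extensionality N; symmetry; apply sumZ_fold).
Qed.

Lemma SZ_ext t t' : (forall n, t n = t' n) -> SZ t = SZ t'.
Proof. intros H. f_equal. now extensionality n. Qed.

Lemma summable_le t t' : (forall n, Rabs (t n) <= Rabs (t' n)) -> summable t' -> summable t.
Proof.
  intros H [A HA]. exists A; intros N. eapply Rle_trans; [|apply (HA N)].
  apply sumZ_le; auto.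
Qed.

Lemma l1le_plus t t' A B : l1le t A -> l1le t' B -> l1le (fun n => t n + t' n) (A + B).
Proof.
  intros HA HB N. eapply Rle_trans.
  - apply (sumZ_le _ (fun n => Rabs (t n) + Rabs (t' n))). intros; apply Rabs_triang.
  - rewrite sumZ_plus. specialize (HA N); specialize (HB N); lra.
Qed.

Lemma l1le_scal c t A : l1le t A -> l1le (fun n => c * t n) (Rabs c * A).
Proof.
  intros HA N.
  rewrite (sumZ_ext _ (fun n => Rabs c * Rabs (t n))) by (intros; apply Rabs_mult).
  rewrite sumZ_scal. apply Rmult_le_compat_l; [apply Rabs_pos|apply HA].
Qed.

Lemma summable_plus t t' : summable t -> summable t' -> summable (fun n => t n + t' n).
Proof. intros [A HA] [B HB]. exists (A + B). now apply l1le_plus. Qed.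

Lemma summable_scal c t : summable t -> summable (fun n => c * t n).
Proof. intros [A HA]. exists (Rabs c * A). now apply l1le_scal. Qed.

Lemma summable_minus t t' : summable t -> summable t' -> summable (fun n => t n - t' n).
Proof.
  intros H H'. apply (summable_le _ (fun n => t n + -1 * t' n)).
  - intros n. right. f_equal. ring.
  - apply summable_plus; [assumption|now apply summable_scal].
Qed.

Lemma summable_abs t : summable t -> summable (fun n => Rabs (t n)).
Proof. apply summable_le. intros n. rewrite Rabs_Rabsolu. lra. Qed.

Lemma SZ_plus t t' : summable t -> summable t' ->
  SZ (fun n => t n + t' n) = SZ t + SZ t'.
Proof.
  intros H H'. apply seriesZ_eq. unfold cvZ_R.
  replace (sumZ_R (fun n => t n + t' n)) with (fun N => sumZ_R t N + sumZ_R t' N)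
    by (extensionality N; symmetry; apply sumZ_plus).
  apply CV_plus; now apply summable_cv.
Qed.

Lemma SZ_scal c t : summable t -> SZ (fun n => c * t n) = c * SZ t.
Proof.
  intros H. apply seriesZ_eq. apply summable_cv in H.
  apply is_lim_seq_Reals. apply is_lim_seq_Reals in H.
  eapply is_lim_seq_ext; [intros N; symmetry; apply sumZ_scal|].
  apply (is_lim_seq_scal_l _ c _ H).
Qed.

Lemma SZ_minus t t' : summable t -> summable t' ->
  SZ (fun n => t n - t' n) = SZ t - SZ t'.
Proof.
  intros H H'. rewrite (SZ_ext _ (fun n => t n + -1 * t' n)) by (intros; ring).
  rewrite SZ_plus, SZ_scal by auto using summable_scal. ring.
Qed.

Lemma SZ_le t t' : summable t -> summable t' -> (forall n, t n <= t' n) -> SZ t <= SZ t'.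
Proof.
  intros H H' Hle. apply summable_cv, is_lim_seq_Reals in H, H'.
  apply (is_lim_seq_le _ _ (SZ t) (SZ t') (fun N => sumZ_le t t' N (fun n _ => Hle n)) H H').
Qed.

Lemma SZ_zero : SZ (fun _ => 0) = 0.
Proof.
  apply seriesZ_eq. intros eps Heps. exists 0%nat. intros N _.
  unfold sumZ_R. rewrite sumN_zero by auto. rewrite R_dist_eq. assumption.
Qed.

Lemma SZ_abs t : summable t -> Rabs (SZ t) <= SZ (fun n => Rabs (t n)).
Proof.
  intros H. apply Rabs_le. split.
  - rewrite <- (Rmult_1_l (SZ (fun n => Rabs (t n)))), Ropp_mult_distr_l.
    rewrite <- SZ_scal by now apply summable_abs. apply SZ_le; auto.
    + now apply summable_scal, summable_abs.
    + intros n. pose proof (Rle_abs (- t n)). rewrite Rabs_Ropp in *. lra.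
  - apply SZ_le; auto using summable_abs. intros; apply Rle_abs.
Qed.

Lemma SZ_abs_bound t A : l1le t A -> SZ (fun n => Rabs (t n)) <= A.
Proof.
  intros H. apply (Un_cv_le_const (sumZ_R (fun n => Rabs (t n)))); [|exact H].
  apply summable_cv, summable_abs. now exists A.
Qed.

Lemma SZ_nonneg_bound t A : (forall n, 0 <= t n) -> l1le t A -> SZ t <= A.
Proof.
  intros Ht H. rewrite (SZ_ext t (fun n => Rabs (t n))).
  - now apply SZ_abs_bound.
  - intros n. now rewrite Rabs_pos_eq.
Qed.

Lemma l1le_nonneg_fun t A : (forall n, 0 <= t n) -> (forall N, sumZ_R t N <= A) -> l1le t A.
Proof.
  intros Ht H N. rewrite (sumZ_ext _ t) by (intros; now rewrite Rabs_pos_eq). apply H.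
Qed.

Lemma sumZ_le_SZ t N : (forall n, 0 <= t n) -> summable t -> sumZ_R t N <= SZ t.
Proof. intros Ht H. apply cvZ_sup; [assumption|now apply summable_cv]. Qed.

Lemma SZ_sumN (t : nat -> Z -> R) N : (forall x, summable (t x)) ->
  summable (fun j => sumN (fun x => t x j) N) /\
  SZ (fun j => sumN (fun x => t x j) N) = sumN (fun x => SZ (t x)) N.
Proof.
  intros H. induction N as [|N [IH1 IH2]]; simpl.
  - split; [apply H|reflexivity].
  - split; [now apply summable_plus|]. now rewrite SZ_plus, IH2.
Qed.

Lemma SZ_sumZ (t : Z -> Z -> R) N : (forall x, summable (t x)) ->
  summable (fun j => sumZ_R (fun x => t x j) N) /\
  SZ (fun j => sumZ_R (fun x => t x j) N) = sumZ_R (fun x => SZ (t x)) N.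
Proof.
  intros H. apply (SZ_sumN (fun i => t (Z.of_nat i - Z.of_nat N)%Z)). auto.
Qed.

Lemma sumZ_exchange (t : Z -> Z -> R) M N :
  sumZ_R (fun i => sumZ_R (t i) N) M = sumZ_R (fun j => sumZ_R (fun i => t i j) M) N.
Proof.
  apply (sumN_exchange (fun i j => t (Z.of_nat i - Z.of_nat M)%Z (Z.of_nat j - Z.of_nat N)%Z)).
Qed.

Lemma sumZ_shift_le t c N : (forall n, 0 <= t n) ->
  sumZ_R (fun n => t (n + c)%Z) N <= sumZ_R t (N + Z.abs_nat c).
Proof.
  intros Ht. unfold sumZ_R. set (P := (N + Z.abs_nat c)%nat).
  set (d := Z.to_nat (c + Z.of_nat (Z.abs_nat c))).
  rewrite (sumN_ext _ (fun j => (fun i => t (Z.of_nat i - Z.of_nat P)%Z) (j + d)%nat)).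
  - eapply Rle_trans; [apply (sumN_shift_le (fun i => t (Z.of_nat i - Z.of_nat P)%Z)); auto|].
    apply sumN_mono; [unfold d, P; lia|auto].
  - intros j _. f_equal. unfold d, P. lia.
Qed.

Lemma l1le_shift t A c : l1le t A -> l1le (fun n => t (n + c)%Z) A.
Proof.
  intros H N. eapply Rle_trans; [|apply (H (N + Z.abs_nat c)%nat)].
  apply (sumZ_shift_le (fun n => Rabs (t n))). intros; apply Rabs_pos.
Qed.

Lemma l1le_refl t A : l1le t A -> l1le (reflZ t) A.
Proof. intros H N. rewrite <- (H N), <- (sumZ_refl (fun n => Rabs (t n))). apply Rle_refl. Qed.

Lemma SZ_refl t : SZ (reflZ t) = SZ t.
Proof.
  unfold SZ, cvZ_R. replace (sumZ_R (reflZ t)) with (sumZ_R t); [reflexivity|].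
  extensionality N. symmetry; apply sumZ_refl.
Qed.

(** Symmetric partial sums are not shift invariant. A shifted one is contained in a larger one,
    which gives an inequality; the shift by -c reverses it. *)
Lemma SZ_shift_nonneg t c : (forall n, 0 <= t n) -> summable t ->
  SZ (fun n => t (n + c)%Z) = SZ t.
Proof.
  assert (Hle : forall t c, (forall n, 0 <= t n) -> summable t ->
    SZ (fun n => t (n + c)%Z) <= SZ t).
  { clear; intros t c Ht H. apply SZ_nonneg_bound; [auto|].
    apply (l1le_shift t). apply l1le_nonneg_fun; [assumption|].
    intros N. now apply sumZ_le_SZ. }
  intros Ht [A HA]. apply Rle_antisym; [apply Hle; [assumption|now exists A]|].
  rewrite (SZ_ext t (fun n => t (n - c + c)%Z)) by (intros; f_equal; lia).
  apply (Hle (fun n => t (n + c)%Z) (- c)%Z); [auto|].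
  exists A. now apply l1le_shift.
Qed.

Lemma SZ_shift t c : summable t -> SZ (fun n => t (n + c)%Z) = SZ t.
Proof.
  intros H. assert (Ha := summable_abs t H).
  assert (Hsh : forall t, summable t -> summable (fun n => t (n + c)%Z)).
  { intros t' [A HA]. exists A. now apply l1le_shift. }
  assert (Hs : summable (fun n => Rabs (t n) + t n)) by now apply summable_plus.
  rewrite (SZ_ext (fun n => t (n + c)%Z)
    (fun n => (fun x => Rabs (t x) + t x) (n + c)%Z - (fun x => Rabs (t x)) (n + c)%Z))
    by (intros; cbv beta; ring).
  rewrite SZ_minus by (apply (Hsh (fun x => Rabs (t x) + t x)) || apply (Hsh (fun x => Rabs (t x)));
    assumption).
  rewrite (SZ_shift_nonneg (fun x => Rabs (t x) + t x)), (SZ_shift_nonneg (fun x => Rabs (t x)));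
    auto using Rabs_pos.
  - rewrite SZ_plus by assumption. ring.
  - intros n. pose proof (Rle_abs (- t n)). rewrite Rabs_Ropp in *. lra.
Qed.

Lemma SZ_finite t (p : nat) : (forall n, (n < 0 \/ Z.of_nat p < n)%Z -> t n = 0) ->
  SZ t = sumN (fun i => t (Z.of_nat i)) p.
Proof.
  intros H. apply seriesZ_eq. intros eps Heps. exists p. intros N HN.
  rewrite sumZ_fold, (sumN_ext (foldZ t) (fun i => t (Z.of_nat i))).
  - rewrite (sumN_extend _ p N) by (try lia; intros; apply H; lia).
    now rewrite R_dist_eq.
  - intros i _. unfold foldZ. destruct (Nat.leb_spec 1 i); [|ring].
    rewrite (H (- Z.of_nat i)%Z) by lia. ring.
Qed.

(** Finitely many rows can be exchanged with a series by [SZ_sumZ], and their sum is below the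
    column total. Only one inequality is needed, since the transpose gives the other. *)
Lemma Fubini_nonneg (t : Z -> Z -> R) B : (forall i j, 0 <= t i j) ->
  (forall M N, sumZ_R (fun i => sumZ_R (t i) N) M <= B) ->
  (forall i, summable (t i)) /\ l1le (fun i => SZ (t i)) B /\
  SZ (fun i => SZ (t i)) <= SZ (fun j => SZ (fun i => t i j)).
Proof.
  intros Ht HB.
  assert (Hrow : forall t B, (forall i j, 0 <= t i j) ->
    (forall M N, sumZ_R (fun i => sumZ_R (t i) N) M <= B) -> forall i, summable (t i)).
  { clear; intros t B Ht HB i. exists B. apply l1le_nonneg_fun; [auto|]. intros N.
    eapply Rle_trans; [|apply (HB (Z.abs_nat i) N)].
    apply (sumZ_term_le (fun i => sumZ_R (t i) N)); [|lia].
    intros; apply sumZ_nonneg; auto. }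
  assert (Hpos : forall t, (forall j, 0 <= t j) -> summable t -> 0 <= SZ t).
  { clear; intros t Ht Hs. eapply Rle_trans; [|apply (sumZ_le_SZ t 0)]; auto.
    now apply sumZ_nonneg. }
  assert (Htot : forall t B, (forall i j, 0 <= t i j) ->
    (forall M N, sumZ_R (fun i => sumZ_R (t i) N) M <= B) -> l1le (fun i => SZ (t i)) B).
  { intros t' B' Ht' HB'. pose proof (Hrow t' B' Ht' HB') as Hr.
    apply l1le_nonneg_fun; [intros; apply Hpos; auto|]. intros M.
    destruct (SZ_sumZ t' M Hr) as [_ <-].
    apply SZ_nonneg_bound; [intros; apply sumZ_nonneg; auto|].
    apply l1le_nonneg_fun; [intros; apply sumZ_nonneg; auto|].
    intros N. rewrite <- sumZ_exchange. apply HB'. }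
  assert (HB' : forall M N, sumZ_R (fun j => sumZ_R (fun i => t i j) N) M <= B).
  { intros M N. rewrite <- sumZ_exchange. apply HB. }
  pose proof (Hrow t B Ht HB) as Hr.
  pose proof (Hrow (fun j i => t i j) B (fun j i => Ht i j) HB') as Hc.
  split; [assumption|]. split; [now apply Htot|].
  assert (Hs : summable (fun j => SZ (fun i => t i j))).
  { exists B. apply (Htot (fun j i => t i j)); auto. }
  apply SZ_nonneg_bound; [intros; apply Hpos; auto|].
  apply l1le_nonneg_fun; [intros; apply Hpos; auto|]. intros M.
  destruct (SZ_sumZ t M Hr) as [H1 <-].
  apply SZ_le; [assumption|assumption|]. intros j.
  apply sumZ_le_SZ; auto.
Qed.

Lemma Fubini (t : Z -> Z -> R) B :
  (forall M N, sumZ_R (fun i => sumZ_R (fun j => Rabs (t i j)) N) M <= B) ->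
  SZ (fun i => SZ (t i)) = SZ (fun j => SZ (fun i => t i j)).
Proof.
  intros HB.
  assert (Heq : forall t B, (forall i j, 0 <= t i j) ->
    (forall M N, sumZ_R (fun i => sumZ_R (t i) N) M <= B) ->
    SZ (fun i => SZ (t i)) = SZ (fun j => SZ (fun i => t i j))).
  { clear; intros t B Ht HB. apply Rle_antisym.
    - now apply (Fubini_nonneg t B).
    - apply (Fubini_nonneg (fun j i => t i j) B); auto.
      intros M N. rewrite <- sumZ_exchange. apply HB. }
  (* The signed case is the difference of the nonnegative families |t| + t and |t|. *)
  set (p := fun i j => Rabs (t i j) + t i j).
  set (m := fun i j => Rabs (t i j)).
  assert (Hm : forall i j, 0 <= m i j) by (intros; apply Rabs_pos).
  assert (Hp : forall i j, 0 <= p i j).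
  { intros i j. unfold p. pose proof (Rle_abs (- t i j)). rewrite Rabs_Ropp in *. lra. }
  assert (HpB : forall M N, sumZ_R (fun i => sumZ_R (p i) N) M <= 2 * B).
  { intros M N. apply Rle_trans with (sumZ_R (fun i => sumZ_R (fun j => 2 * m i j) N) M).
    - apply sumZ_le; intros i _. apply sumZ_le; intros j _. unfold p, m.
      pose proof (Rle_abs (t i j)). lra.
    - rewrite (sumZ_ext _ (fun i => 2 * sumZ_R (m i) N)) by (intros; apply sumZ_scal).
      rewrite sumZ_scal. specialize (HB M N). unfold m. lra. }
  assert (HpB' : forall M N, sumZ_R (fun j => sumZ_R (fun i => p i j) N) M <= 2 * B)
    by (intros M N; rewrite <- sumZ_exchange; apply HpB).
  assert (HmB' : forall M N, sumZ_R (fun j => sumZ_R (fun i => m i j) N) M <= B)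
    by (intros M N; rewrite <- sumZ_exchange; apply HB).
  pose proof (Heq p _ Hp HpB) as E1. pose proof (Heq m _ Hm HB) as E2.
  destruct (Fubini_nonneg p _ Hp HpB) as [P1 [P2 _]].
  destruct (Fubini_nonneg m _ Hm HB) as [M1 [M2 _]].
  destruct (Fubini_nonneg (fun j i => p i j) _ (fun j i => Hp i j) HpB') as [P1' [P2' _]].
  destruct (Fubini_nonneg (fun j i => m i j) _ (fun j i => Hm i j) HmB') as [M1' [M2' _]].
  rewrite (SZ_ext (fun i => SZ (t i)) (fun i => SZ (p i) - SZ (m i))).
  2:{ intros i. rewrite <- SZ_minus by auto. apply SZ_ext; intros j. unfold p, m. ring. }
  rewrite (SZ_ext (fun j => SZ (fun i => t i j))
    (fun j => SZ (fun i => p i j) - SZ (fun i => m i j))).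
  2:{ intros j. rewrite <- SZ_minus by auto. apply SZ_ext; intros i. unfold p, m. ring. }
  rewrite !SZ_minus by (eexists; eassumption). rewrite E1, E2. reflexivity.
Qed.

(** * Convolution of real sequences on the integers *)

Definition convR (u v : Z -> R) (n : Z) : R := SZ (fun j => u (n - j)%Z * v j).

Lemma l1le_bdd u A n : l1le u A -> Rabs (u n) <= A.
Proof.
  intros H. eapply Rle_trans; [|apply (H (Z.abs_nat n))].
  apply (sumZ_term_le (fun n => Rabs (u n))); [intros; apply Rabs_pos|lia].
Qed.

Lemma summable_bdd u : summable u -> bddR u.
Proof. intros [A HA]. exists A. intros n. now apply l1le_bdd. Qed.

Lemma convR_terms_summable u v n : bddR u -> summable v ->
  summable (fun j => u (n - j)%Z * v j).
Proof.
  intros [A HA] Hv. apply (summable_le _ (fun j => A * v j)).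
  - intros j. rewrite !Rabs_mult. apply Rmult_le_compat_r; [apply Rabs_pos|].
    eapply Rle_trans; [apply HA|apply Rle_abs].
  - now apply summable_scal.
Qed.

Lemma convR_bdd u v A B n : (forall x, Rabs (u x) <= A) -> l1le v B ->
  Rabs (convR u v n) <= A * B.
Proof.
  intros Hu Hv.
  assert (HA : 0 <= A) by (eapply Rle_trans; [apply Rabs_pos|apply (Hu 0%Z)]).
  assert (Hs : summable (fun j => u (n - j)%Z * v j)).
  { apply convR_terms_summable; [now exists A|now exists B]. }
  eapply Rle_trans; [now apply SZ_abs|]. apply SZ_abs_bound. intros N.
  apply Rle_trans with (sumZ_R (fun j => A * Rabs (v j)) N).
  - apply sumZ_le; intros j _. rewrite Rabs_mult.
    apply Rmult_le_compat_r; [apply Rabs_pos|apply Hu].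
  - rewrite sumZ_scal. apply Rmult_le_compat_l; auto.
Qed.

Lemma l1le_convolution_kernel u v A B M N : l1le u A -> l1le v B ->
  sumZ_R (fun i => sumZ_R (fun j => Rabs (u (i - j)%Z * v j)) N) M <= A * B.
Proof.
  intros Hu Hv. pose proof (l1le_nonneg u A Hu) as HA. rewrite sumZ_exchange.
  apply Rle_trans with (sumZ_R (fun j => A * Rabs (v j)) N).
  - apply sumZ_le; intros j _.
    rewrite (sumZ_ext _ (fun i => Rabs (v j) * Rabs (u (i + - j)%Z))).
    2:{ intros i _. rewrite Rabs_mult. apply Rmult_comm. }
    rewrite sumZ_scal, Rmult_comm. apply Rmult_le_compat_r; [apply Rabs_pos|].
    now apply l1le_shift.
  - rewrite sumZ_scal. apply Rmult_le_compat_l; auto.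
Qed.

Lemma convR_l1le u v A B : l1le u A -> l1le v B -> l1le (convR u v) (A * B).
Proof.
  intros Hu Hv N.
  destruct (Fubini_nonneg (fun i j => Rabs (u (i - j)%Z * v j)) (A * B)) as [H1 [H2 _]].
  - intros; apply Rabs_pos.
  - intros M P. now apply l1le_convolution_kernel.
  - eapply Rle_trans; [|apply (H2 N)]. apply sumZ_le; intros i _.
    eapply Rle_trans; [|apply Rle_abs]. apply SZ_abs, convR_terms_summable.
    + apply summable_bdd. now exists A.
    + now exists B.
Qed.

Lemma convR_summable u v : summable u -> summable v -> summable (convR u v).
Proof. intros [A HA] [B HB]. exists (A * B). now apply convR_l1le. Qed.

Lemma convR_comm u v n : summable u -> summable v -> convR u v n = convR v u n.
Proof.
  intros Hu Hv. unfold convR.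
  rewrite <- SZ_refl. rewrite <- (SZ_shift _ (- n)%Z).
  - apply SZ_ext; intros j. unfold reflZ. rewrite Rmult_comm. do 2 f_equal; lia.
  - destruct (convR_terms_summable u v n (summable_bdd u Hu) Hv) as [A HA].
    exists A. apply (l1le_refl _ _ HA).
Qed.

Lemma convR_assoc u v w n : summable u -> summable v -> summable w ->
  convR u (convR v w) n = convR (convR u v) w n.
Proof.
  intros [A HA] [B HB] [D HD]. unfold convR at 1 3.
  pose proof (l1le_nonneg u A HA) as HA0.
  assert (Hu : summable u) by now exists A. assert (Hv : summable v) by now exists B.
  assert (Hw : summable w) by now exists D.
  transitivity (SZ (fun j => SZ (fun i => u (n - j)%Z * (v (j - i)%Z * w i)))).
  { apply SZ_ext; intros j. unfold convR. rewrite <- SZ_scal; [reflexivity|].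
    apply convR_terms_summable; auto using summable_bdd. }
  rewrite (Fubini _ (A * (B * D))).
  - apply SZ_ext; intros i. unfold convR.
    rewrite Rmult_comm, <- SZ_scal by (apply convR_terms_summable; auto using summable_bdd).
    rewrite <- (SZ_shift (fun j => w i * (u (n - i - j)%Z * v j)) (- i)%Z).
    2:{ apply summable_scal, convR_terms_summable; auto using summable_bdd. }
    apply SZ_ext; intros j. replace (n - i - (j + - i))%Z with (n - j)%Z by lia.
    replace (j + - i)%Z with (j - i)%Z by lia. ring.
  - intros M N.
    apply Rle_trans with (sumZ_R (fun j => A * sumZ_R (fun i => Rabs (v (j - i)%Z * w i)) N) M).
    + apply sumZ_le; intros j _.
      rewrite (sumZ_ext _ (fun i => Rabs (u (n - j)%Z) * Rabs (v (j - i)%Z * w i)))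
        by (intros; apply Rabs_mult).
      rewrite sumZ_scal. apply Rmult_le_compat_r.
      * apply sumZ_nonneg; intros; apply Rabs_pos.
      * now apply l1le_bdd.
    + rewrite sumZ_scal. apply Rmult_le_compat_l; [assumption|].
      now apply l1le_convolution_kernel.
Qed.

Lemma convR_plus_l u u' v n : summable u -> summable u' -> summable v ->
  convR (fun x => u x + u' x) v n = convR u v n + convR u' v n.
Proof.
  intros Hu Hu' Hv. unfold convR.
  rewrite <- SZ_plus by (apply convR_terms_summable; auto using summable_bdd).
  apply SZ_ext; intros j; ring.
Qed.

Lemma convR_plus_r u v v' n : summable u -> summable v -> summable v' ->
  convR u (fun x => v x + v' x) n = convR u v n + convR u v' n.
Proof.
  intros Hu Hv Hv'. unfold convR.
  rewrite <- SZ_plus by (apply convR_terms_summable; auto using summable_bdd).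
  apply SZ_ext; intros j; ring.
Qed.

Lemma convR_scal_l c u v n : summable u -> summable v ->
  convR (fun x => c * u x) v n = c * convR u v n.
Proof.
  intros Hu Hv. unfold convR.
  rewrite <- SZ_scal by (apply convR_terms_summable; auto using summable_bdd).
  apply SZ_ext; intros j; ring.
Qed.

Lemma convR_scal_r c u v n : summable u -> summable v ->
  convR u (fun x => c * v x) n = c * convR u v n.
Proof.
  intros Hu Hv. unfold convR.
  rewrite <- SZ_scal by (apply convR_terms_summable; auto using summable_bdd).
  apply SZ_ext; intros j; ring.
Qed.

Lemma convR_minus_l u u' v n : summable u -> summable u' -> summable v ->
  convR (fun x => u x - u' x) v n = convR u v n - convR u' v n.
Proof.
  intros Hu Hu' Hv. unfold convR.
  rewrite <- SZ_minus by (apply convR_terms_summable; auto using summable_bdd).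
  apply SZ_ext; intros j; ring.
Qed.

Lemma convR_minus_r u v v' n : summable u -> summable v -> summable v' ->
  convR u (fun x => v x - v' x) n = convR u v n - convR u v' n.
Proof.
  intros Hu Hv Hv'. unfold convR.
  rewrite <- SZ_minus by (apply convR_terms_summable; auto using summable_bdd).
  apply SZ_ext; intros j; ring.
Qed.

Lemma convR_refl u v n : convR (reflZ u) (reflZ v) n = reflZ (convR u v) n.
Proof.
  unfold convR, reflZ at 3. rewrite <- SZ_refl. apply SZ_ext; intros j.
  unfold reflZ. do 2 f_equal; lia.
Qed.

(** * The one-sided convolution estimate *)

(** A one-sided weighted norm, stated as a bound on all partial sums; the real and imaginary parts
    of a sequence and of its reflection are measured with it. *)
Definition P0le (a : R) (u : Z -> R) (A : R) : Prop :=
  forall N, sumN (fun n => kC (a + 1) n * Rabs (DR a u (Z.of_nat n))) N <= A.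

Definition kernel_pos (a : R) (j : Z) : R := if (0 <=? j)%Z then kC (- a) (Z.to_nat j) else 0.
Definition kernel (a : R) : Z -> R := reflZ (kernel_pos a).

Lemma sumZ_supp_nonneg t N : (forall n, (n < 0)%Z -> t n = 0) ->
  sumZ_R t N = sumN (fun n => t (Z.of_nat n)) N.
Proof.
  intros H. rewrite sumZ_fold. apply sumN_ext; intros n _. unfold foldZ.
  destruct (Nat.leb_spec 1 n); [rewrite (H (- Z.of_nat n)%Z) by lia|]; ring.
Qed.

Lemma kernel_pos_neg a n : (n < 0)%Z -> kernel_pos a n = 0.
Proof. intros H. unfold kernel_pos. now rewrite (proj2 (Z.leb_gt 0 n) H). Qed.

Lemma kernel_pos_nat a n : kernel_pos a (Z.of_nat n) = kC (- a) n.
Proof.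
  unfold kernel_pos. rewrite (proj2 (Z.leb_le 0 (Z.of_nat n))) by lia. now rewrite Nat2Z.id.
Qed.

Lemma kernel_summable a : 0 <= a -> summable (kernel a).
Proof.
  intros Ha. destruct (kC_abs_sum a Ha) as [K [_ HK]]. exists K. apply l1le_refl. intros N.
  rewrite sumZ_supp_nonneg by (intros; rewrite kernel_pos_neg, Rabs_R0 by assumption; reflexivity).
  eapply Rle_trans; [|apply (HK N)]. right. apply sumN_ext; intros.
  now rewrite kernel_pos_nat.
Qed.

Lemma DR_convR_kernel a u n : 0 <= a -> bddR u -> DR a u n = convR u (kernel a) n.
Proof.
  intros Ha Hu. unfold convR. rewrite <- SZ_refl. symmetry. apply seriesZ_eq.
  pose proof (Series_correct _ (DR_ex a u n Ha Hu)) as H. apply is_series_Un_cv in H.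
  unfold cvZ_R, DR. eapply Un_cv_ext; [|exact H].
  intros N. symmetry. rewrite sumZ_supp_nonneg.
  - apply sumN_ext; intros j _. unfold reflZ, kernel, reflZ.
    rewrite Z.opp_involutive, kernel_pos_nat, Z.sub_opp_r. ring.
  - intros j Hj. unfold reflZ, kernel, reflZ.
    rewrite Z.opp_involutive, kernel_pos_neg by assumption. ring.
Qed.

(** On summable sequences D^a is convolution with the summable [kernel a], hence commutes with every
    convolution. *)
Lemma DR_convR a u v n : 0 <= a -> summable u -> summable v ->
  DR a (convR u v) n = convR (DR a u) v n.
Proof.
  intros Ha Hu Hv. pose proof (kernel_summable a Ha) as Hk.
  rewrite DR_convR_kernel by auto using summable_bdd, convR_summable.
  replace (DR a u) with (convR u (kernel a))
    by (extensionality x; symmetry; auto using DR_convR_kernel, summable_bdd).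
  rewrite <- !convR_assoc by assumption.
  replace (convR v (kernel a)) with (convR (kernel a) v); [reflexivity|].
  extensionality x. now apply convR_comm.
Qed.

Lemma DR_summable a u : 0 <= a -> summable u -> summable (DR a u).
Proof.
  intros Ha Hu. replace (DR a u) with (convR u (kernel a))
    by (extensionality x; symmetry; auto using DR_convR_kernel, summable_bdd).
  auto using convR_summable, kernel_summable.
Qed.

Lemma P0le_nonneg a u A : 0 <= a -> P0le a u A -> 0 <= A.
Proof.
  intros Ha H. eapply Rle_trans; [|apply (H 0%nat)]. apply sumN_nonneg; intros.
  apply Rmult_le_pos; [apply kC_nonneg; lra|apply Rabs_pos].
Qed.

Lemma P0le_ext a u v A : (forall n, (0 <= n)%Z -> u n = v n) -> P0le a u A -> P0le a v A.
Proof.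
  intros H HA N. eapply Rle_trans; [|apply (HA N)]. right. apply sumN_ext; intros n _.
  do 2 f_equal. apply DR_ext. intros x Hx. symmetry; apply H. lia.
Qed.

Lemma P0le_weaken a u A B : A <= B -> P0le a u A -> P0le a u B.
Proof. intros H HA N. specialize (HA N). lra. Qed.

Lemma P0le_plus a u v A B : 0 <= a -> bddR u -> bddR v -> P0le a u A -> P0le a v B ->
  P0le a (fun n => u n + v n) (A + B).
Proof.
  intros Ha Hu Hv HA HB N. specialize (HA N). specialize (HB N).
  eapply Rle_trans; [|apply (Rplus_le_compat _ _ _ _ HA HB)]. rewrite <- sumN_plus.
  apply sumN_le; intros n _. rewrite DR_plus by assumption. rewrite <- Rmult_plus_distr_l.
  apply Rmult_le_compat_l; [apply kC_nonneg; lra|apply Rabs_triang].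
Qed.

Lemma P0le_scal a c u A : P0le a u A -> P0le a (fun n => c * u n) (Rabs c * A).
Proof.
  intros HA N. rewrite (sumN_ext _ (fun n => Rabs c * (kC (a + 1) n * Rabs (DR a u (Z.of_nat n))))).
  - rewrite sumN_scal. apply Rmult_le_compat_l; [apply Rabs_pos|apply HA].
  - intros n _. rewrite DR_scal, Rabs_mult. ring.
Qed.

Lemma bddR_sumN (F : nat -> Z -> R) N : (forall l, bddR (F l)) ->
  bddR (fun n => sumN (fun l => F l n) N).
Proof.
  intros H. induction N as [|N IH]; simpl; [apply H|]. now apply bddR_plus.
Qed.

Lemma P0le_sumN a (c : nat -> R) (F : nat -> Z -> R) (A : nat -> R) N : 0 <= a ->
  (forall l, bddR (F l)) -> (forall l, P0le a (F l) (A l)) ->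
  P0le a (fun n => sumN (fun l => c l * F l n) N) (sumN (fun l => Rabs (c l) * A l) N).
Proof.
  intros Ha Hb H. induction N as [|N IH]; simpl; [now apply P0le_scal|].
  apply (P0le_plus a (fun n => sumN (fun l => c l * F l n) N) (fun n => c (S N) * F (S N) n)).
  - assumption.
  - apply (bddR_sumN (fun l n => c l * F l n)). intros; now apply bddR_scal.
  - now apply bddR_scal.
  - assumption.
  - now apply P0le_scal.
Qed.

(** For fixed N only finitely many values of D^a occur, each continuous for the sup norm; so uniform
    approximation suffices and convergence in the weighted norm is not asked. *)
Lemma P0le_limit a w C : 0 <= a -> bddR w ->
  (forall eta, 0 < eta -> exists w', bddR w' /\ (forall n, Rabs (w n - w' n) <= eta) /\ P0le a w' C) ->
  P0le a w C.
Proof.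
  intros Ha Hw H N. apply le_epsilon; intros eps Heps.
  destruct (DR_bound a Ha) as [K [HK HKb]].
  set (S := sumN (kC (a + 1)) N).
  assert (HS : 0 < S).
  { apply Rlt_le_trans with (kC (a + 1) 0); [simpl; lra|]. apply sumN_term_le; [lia|].
    intros; apply kC_nonneg; lra. }
  destruct (H (eps / (K * S))) as [w' [Hw' [Hd HC]]].
  { apply Rdiv_lt_0_compat; [assumption|nra]. }
  apply Rle_trans with (sumN (fun n => kC (a + 1) n * Rabs (DR a w' (Z.of_nat n))
    + kC (a + 1) n * (K * (eps / (K * S)))) N).
  - apply sumN_le; intros n _. rewrite <- Rmult_plus_distr_l.
    apply Rmult_le_compat_l; [apply kC_nonneg; lra|].
    assert (HD : Rabs (DR a (fun x => w x - w' x) (Z.of_nat n)) <= K * (eps / (K * S))).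
    { apply HKb; [|assumption]. left. apply Rdiv_lt_0_compat; [assumption|nra]. }
    rewrite DR_minus in HD by assumption.
    replace (DR a w (Z.of_nat n)) with
      (DR a w' (Z.of_nat n) + (DR a w (Z.of_nat n) - DR a w' (Z.of_nat n))) by ring.
    eapply Rle_trans; [apply Rabs_triang|]. lra.
  - rewrite sumN_plus, sumN_scal_r. fold S. apply Rplus_le_compat; [apply HC|].
    right. field. lra.
Qed.

(* A factor supported on n <= 0 commutes past D: for x >= 0, (D u)(x - j) only
   involves nonnegative arguments. *)
Lemma P0le_convR_neg a u v A B : 0 <= a -> summable u -> (forall n, (0 < n)%Z -> v n = 0) ->
  P0le a u A -> l1le v B -> P0le a (convR u v) (A * B).
Proof.
  intros Ha Hu Hv HA HB N. pose proof (P0le_nonneg a u A Ha HA) as HA0.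
  assert (Hvs : summable v) by now exists B.
  assert (HD : bddR (DR a u)) by auto using summable_bdd, DR_summable.
  assert (Hs : forall x, summable (fun j => kC (a + 1) x * Rabs (DR a u (Z.of_nat x - j)%Z * v j))).
  { intros x. apply summable_scal, summable_abs, convR_terms_summable; assumption. }
  apply Rle_trans with (sumN (fun x => SZ (fun j => kC (a + 1) x * Rabs (DR a u (Z.of_nat x - j)%Z * v j))) N).
  - apply sumN_le; intros x _. rewrite DR_convR by assumption.
    rewrite SZ_scal by now apply summable_abs, convR_terms_summable.
    apply Rmult_le_compat_l; [apply kC_nonneg; lra|].
    apply SZ_abs, convR_terms_summable; assumption.
  - destruct (SZ_sumN _ N Hs) as [Hs' <-].
    apply SZ_nonneg_bound.
    { intros j. apply sumN_nonneg; intros.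
      apply Rmult_le_pos; [apply kC_nonneg; lra|apply Rabs_pos]. }
    apply l1le_nonneg_fun.
    { intros j. apply sumN_nonneg; intros.
      apply Rmult_le_pos; [apply kC_nonneg; lra|apply Rabs_pos]. }
    intros M. apply Rle_trans with (sumZ_R (fun j => A * Rabs (v j)) M).
    + apply sumZ_le; intros j _.
      rewrite (sumN_ext _ (fun x => kC (a + 1) x * Rabs (DR a u (Z.of_nat x - j)%Z) * Rabs (v j)))
        by (intros; rewrite Rabs_mult; ring).
      rewrite sumN_scal_r.
      destruct (Z_lt_le_dec 0 j) as [Hj|Hj]; [rewrite (Hv j Hj), Rabs_R0; lra|].
      apply Rmult_le_compat_r; [apply Rabs_pos|].
      (* Since j <= 0 the translation goes to the right by c, where the weight k^(a+1) is larger. *)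
      set (c := Z.to_nat (- j)).
      apply Rle_trans with (sumN (fun x => (fun y => kC (a + 1) y * Rabs (DR a u (Z.of_nat y))) (x + c)%nat) N).
      * apply sumN_le; intros x _.
        replace (Z.of_nat x - j)%Z with (Z.of_nat (x + c)) by (unfold c; lia).
        apply Rmult_le_compat_r; [apply Rabs_pos|]. apply kC_mono; [assumption|lia].
      * eapply Rle_trans; [|apply (HA (N + c)%nat)].
        apply (sumN_shift_le (fun y => kC (a + 1) y * Rabs (DR a u (Z.of_nat y)))).
        intros; apply Rmult_le_pos; [apply kC_nonneg; lra|apply Rabs_pos].
    + rewrite sumZ_scal. apply Rmult_le_compat_l; auto.
Qed.

(* [atom a l] is the sequence on n >= 0 whose difference of order a is the
   unit mass at l. *)
Definition atom (a : R) (l : nat) (n : Z) : R :=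
  if ((0 <=? n)%Z && (n <=? Z.of_nat l)%Z)%bool then kC a (Z.to_nat (Z.of_nat l - n)) else 0.

Lemma atom_out a l n : (n < 0 \/ Z.of_nat l < n)%Z -> atom a l n = 0.
Proof.
  intros H. unfold atom. destruct (Z.leb_spec 0 n); destruct (Z.leb_spec n (Z.of_nat l));
    simpl; try reflexivity; lia.
Qed.

Lemma atom_sub a l i : (i <= l)%nat -> atom a l (Z.of_nat l - Z.of_nat i)%Z = kC a i.
Proof.
  intros H. unfold atom.
  destruct (Z.leb_spec 0 (Z.of_nat l - Z.of_nat i));
  destruct (Z.leb_spec (Z.of_nat l - Z.of_nat i) (Z.of_nat l)); simpl; try lia.
  f_equal. lia.
Qed.

Lemma atom_low a l i : atom a l (Z.of_nat l - Z.of_nat i)%Z = low l (kC a) i.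
Proof.
  destruct (Nat.le_gt_cases i l) as [H|H].
  - now rewrite atom_sub, low_le.
  - rewrite low_gt, atom_out by lia. reflexivity.
Qed.

Lemma summable_supp_nonneg t p : (forall n, (n < 0 \/ Z.of_nat p < n)%Z -> t n = 0) -> summable t.
Proof.
  intros H. exists (sumN (fun n => Rabs (t (Z.of_nat n))) p). intros N.
  rewrite sumZ_supp_nonneg by (intros; rewrite H, Rabs_R0 by lia; reflexivity).
  destruct (Nat.le_gt_cases N p).
  - apply sumN_mono; [assumption|intros; apply Rabs_pos].
  - right. apply sumN_extend; [lia|]. intros i Hi. rewrite H by lia. apply Rabs_R0.
Qed.

Lemma atom_summable a l : summable (atom a l).
Proof. apply (summable_supp_nonneg _ l), atom_out. Qed.

Lemma DR_atom a l x : DR a (atom a l) (Z.of_nat x) = if (x =? l)%nat then 1 else 0.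
Proof.
  destruct (Nat.le_gt_cases x l) as [H|H].
  - rewrite (DR_finite a _ _ (l - x)) by (intros; apply atom_out; lia).
    rewrite (sumN_ext _ (fun j => kC (- a) j * kC a (l - x - j)%nat)).
    + fold (cp (kC (- a)) (kC a) (l - x)). rewrite kC_cancel.
      destruct (Nat.eqb_spec x l) as [->|Hn]; [now rewrite Nat.sub_diag|].
      destruct (l - x)%nat eqn:E; [lia|reflexivity].
    + intros j Hj. f_equal. rewrite <- (atom_sub a l (l - x - j)) by lia. f_equal. lia.
  - destruct (Nat.eqb_spec x l) as [->|Hn]; [lia|].
    apply DR_zero. intros; apply atom_out; lia.
Qed.

Lemma convR_atoms_far a l m n : (Z.of_nat (l + m) < n)%Z -> convR (atom a l) (atom a m) n = 0.
Proof.
  intros H. unfold convR. rewrite (SZ_ext _ (fun _ => 0)); [apply SZ_zero|].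
  intros j. destruct (Z_lt_le_dec (Z.of_nat m) j).
  - rewrite (atom_out a m) by lia. ring.
  - rewrite (atom_out a l) by lia. ring.
Qed.

(** Counted downwards from its last point, an atom is the kernel [k^a] truncated at l; the product
    is then an ordinary Cauchy product counted down from l + m. *)
Lemma convR_atoms a l m p : convR (atom a l) (atom a m) (Z.of_nat (l + m) - Z.of_nat p)%Z
  = cp (low m (kC a)) (low l (kC a)) p.
Proof.
  unfold convR. rewrite <- SZ_refl. rewrite <- (SZ_shift _ (- Z.of_nat m)%Z).
  - rewrite (SZ_finite _ p).
    + apply sumN_ext; intros i Hi. unfold reflZ. rewrite <- !atom_low, Rmult_comm.
      f_equal; f_equal; lia.
    + intros i Hi. unfold reflZ. destruct (Z_lt_le_dec i 0).
      * rewrite (atom_out a m) by lia. ring.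
      * rewrite (atom_out a l) by lia. ring.
  - destruct (convR_terms_summable (atom a l) (atom a m) (Z.of_nat (l + m) - Z.of_nat p)%Z)
      as [A HA]; auto using summable_bdd, atom_summable.
    exists A. apply (l1le_refl _ _ HA).
Qed.

Lemma low_high M x : forall i, low M x i = x i - high M x i.
Proof. intros i. unfold low, high. destruct (i <=? M)%nat; ring. Qed.

Lemma cp_high_high l m x p : (p <= l + m)%nat -> cp (high l x) (high m x) p = 0.
Proof.
  intros H. apply sumN_zero; intros i Hi. destruct (Nat.le_gt_cases i l).
  - rewrite high_le by assumption. ring.
  - rewrite (high_le m) by lia. ring.
Qed.

Lemma cp_kC_cancel a y p : cp (kC (- a)) (cp (kC a) y) p = y p.
Proof.
  rewrite cp_assoc, (cp_ext _ delta0 _ y) by auto using kC_cancel. apply cp_delta0_l.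
Qed.

(** Write each truncation as [k^a] minus its tail. The product of the two tails starts only at l + m
    + 2, so it is absent here; in the other terms [k^(-a)] cancels one factor [k^a]. *)
Lemma cp_truncated_kernels a l m p : (p <= l + m)%nat ->
  cp (kC (- a)) (cp (low m (kC a)) (low l (kC a))) p
  = kC a p - high l (kC a) p - high m (kC a) p.
Proof.
  intros Hp. set (k := kC a).
  rewrite (cp_ext _ (kC (- a)) _
    (fun i => cp k (fun j => k j - high l k j - high m k j) i)); [apply cp_kC_cancel|auto|].
  intros i Hi. rewrite !cp_minus_r.
  rewrite (cp_ext (low m k) (fun j => k j - high m k j) (low l k) (fun j => k j - high l k j))
    by (intros; apply low_high).
  rewrite cp_minus_l, !cp_minus_r, cp_high_high by lia.
  rewrite (cp_comm (high m k) k). ring.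
Qed.

Lemma DR_convR_atoms a l m x : (x <= l + m)%nat ->
  DR a (convR (atom a l) (atom a m)) (Z.of_nat x)
  = kC a (l + m - x) - high l (kC a) (l + m - x) - high m (kC a) (l + m - x).
Proof.
  intros Hx. rewrite <- cp_truncated_kernels by lia.
  rewrite (DR_finite a _ _ (l + m - x)) by (intros; apply convR_atoms_far; lia).
  apply sumN_ext; intros j Hj. f_equal. rewrite <- convR_atoms. f_equal. lia.
Qed.

Lemma P0le_convR_atoms a l m : 0 <= a ->
  P0le a (convR (atom a l) (atom a m)) (2 * exp a * kC (a + 1) l * kC (a + 1) m).
Proof.
  intros Ha. revert l m.
  assert (Hw : forall l m, (m <= l)%nat ->
    P0le a (convR (atom a l) (atom a m)) (2 * exp a * kC (a + 1) l * kC (a + 1) m)).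
  { intros l m Hml N. set (L := (l + m)%nat).
    assert (Hk : forall n, 0 <= kC a n) by (intros; now apply kC_nonneg).
    assert (Hk1 : forall n, 0 <= kC (a + 1) n) by (intros; apply kC_nonneg; lra).
    apply Rle_trans with (sumN (fun x => kC (a + 1) x
      * Rabs (DR a (convR (atom a l) (atom a m)) (Z.of_nat x))) L).
    { destruct (Nat.le_gt_cases N L).
      - apply sumN_mono; [assumption|]. intros; apply Rmult_le_pos; [auto|apply Rabs_pos].
      - right. apply sumN_extend; [lia|]. intros i Hi. rewrite DR_zero.
        + rewrite Rabs_R0; ring.
        + intros y Hy. apply convR_atoms_far. fold L. lia. }
    (* With p = L - x: for p <= m the difference is k^a(p) and the weight at most k^(a+1)(L); for m
       < p <= l it is 0; for p > l it is -k^a(p), but x < m and the weight is at most k^(a+1)(m).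
       Both sums equal k^(a+1)(L) k^(a+1)(m), and L <= 2l allows doubling. *)
    apply Rle_trans with (sumN (fun x => kC (a + 1) L * low m (kC a) (L - x)
      + kC (a + 1) m * kC a (L - x)) L).
    - apply sumN_le; intros x Hx. rewrite DR_convR_atoms by assumption. fold L.
      pose proof (Hk (L - x)%nat). pose proof (Hk1 x). pose proof (Hk1 L). pose proof (Hk1 m).
      assert (kC (a + 1) x <= kC (a + 1) L) by (apply kC_mono; assumption).
      destruct (Nat.le_gt_cases (L - x) m) as [Hxm|Hxm].
      + rewrite !high_le, low_le by lia. rewrite Rabs_pos_eq by lra. nra.
      + rewrite (high_gt m), low_gt by assumption.
        destruct (Nat.le_gt_cases (L - x) l) as [Hxl|Hxl].
        * rewrite high_le by assumption.
          replace (kC a (L - x) - 0 - kC a (L - x)) with 0 by ring. rewrite Rabs_R0. nra.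
        * rewrite high_gt by assumption.
          assert (kC (a + 1) x <= kC (a + 1) m) by (apply kC_mono; [assumption|lia]).
          rewrite Rabs_left1 by lra. nra.
    - rewrite sumN_plus, !sumN_scal.
      rewrite <- (sumN_rev (low m (kC a))), <- (sumN_rev (kC a)), kC_sum.
      rewrite (sumN_ext (low m (kC a)) (fun j => low m (kC a) j * 1)) by (intros; ring).
      rewrite sumN_low by lia. rewrite sumN_scal_r, kC_sum.
      assert (Hd : kC (a + 1) L <= exp a * kC (a + 1) l) by (apply kC_doubling; [assumption|lia]).
      pose proof (Hk1 m). pose proof (Hk1 L). nra. }
  intros l m. destruct (Nat.le_ge_cases m l) as [H|H]; [now apply Hw|].
  replace (2 * exp a * kC (a + 1) l * kC (a + 1) m)
    with (2 * exp a * kC (a + 1) m * kC (a + 1) l) by ring.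
  eapply P0le_ext; [|apply Hw, H]. intros n _. apply convR_comm; apply atom_summable.
Qed.

(** * Splitting at 0 and synthesis from atoms *)

Definition posZ (u : Z -> R) (n : Z) : R := if (0 <=? n)%Z then u n else 0.
Definition negZ (u : Z -> R) (n : Z) : R := if (0 <=? n)%Z then 0 else u n.

Lemma posZ_negZ u n : u n = posZ u n + negZ u n.
Proof. unfold posZ, negZ. destruct (0 <=? n)%Z; ring. Qed.

Lemma posZ_nonneg u n : (0 <= n)%Z -> posZ u n = u n.
Proof. intros H. unfold posZ. now rewrite (proj2 (Z.leb_le 0 n) H). Qed.

Lemma posZ_neg u n : (n < 0)%Z -> posZ u n = 0.
Proof. intros H. unfold posZ. now rewrite (proj2 (Z.leb_gt 0 n) H). Qed.

Lemma l1le_posZ u A : l1le u A -> l1le (posZ u) A.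
Proof.
  intros H N. eapply Rle_trans; [|apply (H N)]. apply sumZ_le; intros n _.
  unfold posZ. destruct (0 <=? n)%Z; [lra|rewrite Rabs_R0; apply Rabs_pos].
Qed.

Lemma l1le_negZ u A : l1le u A -> l1le (negZ u) A.
Proof.
  intros H N. eapply Rle_trans; [|apply (H N)]. apply sumZ_le; intros n _.
  unfold negZ. destruct (0 <=? n)%Z; [rewrite Rabs_R0; apply Rabs_pos|lra].
Qed.

Definition synth (a : R) (u : Z -> R) (N : nat) (n : Z) : R :=
  sumN (fun l => DR a u (Z.of_nat l) * atom a l n) N.

Lemma summable_sumN (F : nat -> Z -> R) N : (forall l, summable (F l)) ->
  summable (fun n => sumN (fun l => F l n) N).
Proof. intros H. now apply SZ_sumN. Qed.

Lemma synth_summable a u N : summable (synth a u N).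
Proof.
  apply (summable_sumN (fun l n => DR a u (Z.of_nat l) * atom a l n)).
  intros; apply summable_scal, atom_summable.
Qed.

Lemma DR_sumN a (c : nat -> R) (F : nat -> Z -> R) N n : 0 <= a -> (forall l, bddR (F l)) ->
  DR a (fun x => sumN (fun l => c l * F l x) N) n = sumN (fun l => c l * DR a (F l) n) N.
Proof.
  intros Ha H. induction N as [|N IH]; simpl; [apply DR_scal|].
  rewrite (DR_plus a (fun x => sumN (fun l => c l * F l x) N)), IH, DR_scal; auto using bddR_scal.
  apply (bddR_sumN (fun l x => c l * F l x)). auto using bddR_scal.
Qed.

Lemma DR_synth a u N x : 0 <= a ->
  DR a (synth a u N) (Z.of_nat x) = if (x <=? N)%nat then DR a u (Z.of_nat x) else 0.
Proof.
  intros Ha. unfold synth. rewrite DR_sumN by auto using summable_bdd, atom_summable.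
  destruct (Nat.leb_spec x N) as [H|H].
  - rewrite (sumN_single _ N x H).
    + rewrite DR_atom, Nat.eqb_refl. ring.
    + intros i _ Hi. rewrite DR_atom.
      destruct (Nat.eqb_spec x i); [congruence|ring].
  - apply sumN_zero; intros i Hi. rewrite DR_atom.
    destruct (Nat.eqb_spec x i); [lia|ring].
Qed.

Lemma P0le_tail a u A eps : 0 <= a -> P0le a u A -> 0 < eps -> exists N, forall M,
  sumN (fun n => kC (a + 1) n * Rabs (if (n <=? N)%nat then 0 else DR a u (Z.of_nat n))) M <= eps.
Proof.
  intros Ha HA Heps. set (h := fun n => kC (a + 1) n * Rabs (DR a u (Z.of_nat n))).
  assert (Hh : forall n, 0 <= h n).
  { intros; apply Rmult_le_pos; [apply kC_nonneg; lra|apply Rabs_pos]. }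
  destruct (ex_series_bounded h A Hh HA) as [l Hl].
  apply is_series_Un_cv in Hl.
  assert (Hg : Un_growing (sumN h)) by (intros n; simpl; specialize (Hh (S n)); lra).
  destruct (Hl eps Heps) as [N HN]. exists N. intros M.
  specialize (HN N (Nat.le_refl N)). unfold R_dist in HN.
  pose proof (Un_cv_ge_term _ l N Hg Hl). rewrite Rabs_left1 in HN by lra.
  set (g := fun n => kC (a + 1) n * Rabs (if (n <=? N)%nat then 0 else DR a u (Z.of_nat n))).
  apply Rle_trans with (sumN g (N + M)).
  { apply sumN_mono; [lia|]. intros n.
    apply Rmult_le_pos; [apply kC_nonneg; lra|apply Rabs_pos]. }
  assert (sumN g (N + M) = sumN h (N + M) - sumN h N) as ->.
  { rewrite (sumN_ext g (fun n => h n - low N h n)).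
    - rewrite sumN_minus. f_equal.
      rewrite (sumN_ext (low N h) (fun j => low N h j * 1)) by (intros; ring).
      rewrite sumN_low by lia. apply sumN_ext; intros; ring.
    - intros n _. unfold g, h, low. destruct (n <=? N)%nat; [rewrite Rabs_R0|]; ring. }
  pose proof (Un_cv_ge_term _ l (N + M) Hg Hl). lra.
Qed.

Lemma summable_inL1 u : summable u -> inL1 (fun n => (u n, 0)).
Proof.
  intros [A HA]. exists A. intros N. rewrite (sumZ_ext _ (fun n => Rabs (u n))); [apply HA|].
  intros; apply Cnorm_real.
Qed.

(** The comparison of orders 0 and a, applied to t seen as a complex sequence with zero imaginary
    part. *)
Lemma l1le_P0le a t A : 0 <= a -> summable t -> (forall n, (n < 0)%Z -> t n = 0) ->
  P0le a t A -> l1le t A.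
Proof.
  intros Ha Ht Hneg HA N. apply le_epsilon; intros eps Heps.
  set (f := fun n => (t n, 0) : Cx).
  assert (Hf : inL1 f) by now apply summable_inL1.
  assert (HD : forall b n, Cnorm (Dc b f n) = Rabs (DR b t n)).
  { intros b n. unfold Dc. rewrite (DR_zero b (imZ f)) by reflexivity. apply Cnorm_real. }
  destruct (Dc_order_le 0 0 a f) with (N := N) (eps := eps) as [M HM];
    auto using inL1_bdd, nullZ_right, inL1_null; [lra|].
  rewrite sumZ_supp_nonneg by (intros; rewrite Hneg, Rabs_R0 by assumption; reflexivity).
  eapply Rle_trans; [|eapply Rle_trans; [exact HM|]].
  - right. apply sumN_ext; intros n _. rewrite HD, DR_order_0. unfold wt.
    simpl (0 <=? n)%nat. cbv iota. rewrite Rplus_0_l, kC_1. ring.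
  - apply Rplus_le_compat_r. eapply Rle_trans; [|apply (HA M)].
    right. apply sumN_ext; intros n _. now rewrite HD.
Qed.

(** On n >= 0 the difference D^a of the error is exactly the tail of D^a u; [l1le_P0le] turns the
    small weighted tail into a small l^1 norm. *)
Lemma synth_approx a u A eps : 0 <= a -> summable u -> P0le a u A -> 0 < eps ->
  exists N, l1le (fun n => posZ u n - synth a u N n) eps.
Proof.
  intros Ha Hu HA Heps. destruct (P0le_tail a u A eps Ha HA Heps) as [N HN].
  exists N.
  assert (Hp : summable (posZ u)) by (destruct Hu as [B HB]; exists B; now apply l1le_posZ).
  pose proof (synth_summable a u N) as Hs.
  apply (l1le_P0le a); [assumption|now apply summable_minus| |].
  - intros n Hn. rewrite posZ_neg by assumption. unfold synth.
    rewrite sumN_zero; [ring|]. intros; rewrite atom_out by lia; ring.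
  - intros M. eapply Rle_trans; [|apply (HN M)]. right. apply sumN_ext; intros n _.
    rewrite DR_minus by auto using summable_bdd. rewrite DR_synth by assumption.
    rewrite (DR_ext a (posZ u) u) by (intros; apply posZ_nonneg; lia).
    destruct (n <=? N)%nat; do 2 f_equal; ring.
Qed.

Lemma convR_sumN_l (c : nat -> R) (F : nat -> Z -> R) v N n :
  (forall l, summable (F l)) -> summable v ->
  convR (fun x => sumN (fun l => c l * F l x) N) v n = sumN (fun l => c l * convR (F l) v n) N.
Proof.
  intros HF Hv. induction N as [|N IH]; simpl; [now apply convR_scal_l|].
  rewrite (convR_plus_l (fun x => sumN (fun l => c l * F l x) N)), IH, convR_scal_l;
    auto using summable_scal.
  apply (summable_sumN (fun l x => c l * F l x)). auto using summable_scal.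
Qed.

(** Bilinear expansion: the bound for two atoms factors into the weights at l and m, which
    reassemble the one-sided sums of u and v. The constant does not depend on N and M. *)
Lemma P0le_convR_synth a u v A B N M : 0 <= a -> P0le a u A -> P0le a v B ->
  P0le a (convR (synth a u N) (synth a v M)) (2 * exp a * (A * B)).
Proof.
  intros Ha HA HB. pose proof (P0le_nonneg a v B Ha HB) as HB0.
  pose proof (exp_pos a) as He.
  assert (Hk : forall n, 0 <= kC (a + 1) n) by (intros; apply kC_nonneg; lra).
  assert (Hat : forall l, P0le a (convR (atom a l) (synth a v M)) (2 * exp a * kC (a + 1) l * B)).
  { intros l.
    apply P0le_weaken with (sumN (fun m => Rabs (DR a v (Z.of_nat m)) * (2 * exp a * kC (a + 1) l * kC (a + 1) m)) M).
    - rewrite (sumN_ext _ (fun m => 2 * exp a * kC (a + 1) l * (kC (a + 1) m * Rabs (DR a v (Z.of_nat m)))))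
        by (intros; ring).
      rewrite sumN_scal. apply Rmult_le_compat_l; [|apply HB].
      apply Rmult_le_pos; [lra|auto].
    - eapply P0le_ext; [|apply (P0le_sumN a (fun m => DR a v (Z.of_nat m))
        (fun m => convR (atom a l) (atom a m)))]; auto using P0le_convR_atoms.
      + intros n _. rewrite convR_comm by auto using atom_summable, synth_summable.
        unfold synth. rewrite convR_sumN_l by auto using atom_summable.
        apply sumN_ext; intros m _. f_equal. apply convR_comm; apply atom_summable.
      + intros m. apply summable_bdd, convR_summable; apply atom_summable. }
  apply P0le_weaken with (sumN (fun l => Rabs (DR a u (Z.of_nat l)) * (2 * exp a * kC (a + 1) l * B)) N).
  - rewrite (sumN_ext _ (fun l => 2 * exp a * B * (kC (a + 1) l * Rabs (DR a u (Z.of_nat l)))))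
      by (intros; ring).
    rewrite sumN_scal. replace (2 * exp a * (A * B)) with (2 * exp a * B * A) by ring.
    apply Rmult_le_compat_l; [nra|apply HA].
  - eapply P0le_ext; [|apply (P0le_sumN a (fun l => DR a u (Z.of_nat l))
      (fun l => convR (atom a l) (synth a v M)))]; auto.
    + intros n _. unfold synth at 2. rewrite convR_sumN_l by auto using atom_summable, synth_summable.
      reflexivity.
    + intros l. apply summable_bdd, convR_summable; [apply atom_summable|apply synth_summable].
Qed.

Lemma P0le_convR_pos a u v A B : 0 <= a -> l1le u A -> l1le v B -> P0le a u A -> P0le a v B ->
  P0le a (convR (posZ u) (posZ v)) (2 * exp a * (A * B)).
Proof.
  intros Ha HuA HvB HA HB.
  assert (Hu : summable u) by now exists A. assert (Hv : summable v) by now exists B.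
  pose proof (l1le_posZ u A HuA) as HpA. pose proof (l1le_posZ v B HvB) as HpB.
  assert (Hpu : summable (posZ u)) by now exists A.
  assert (Hpv : summable (posZ v)) by now exists B.
  pose proof (l1le_nonneg u A HuA) as HA0. pose proof (l1le_nonneg v B HvB) as HB0.
  apply P0le_limit; [assumption|now apply summable_bdd, convR_summable|].
  (* Replacing one factor at a time costs eps * B + (A + 1) * eps; eps <= 1 keeps the synthesised
     factor below A + 1. *)
  intros eta Heta. set (eps := Rmin 1 (eta / (A + B + 1))).
  assert (Heps : 0 < eps) by (apply Rmin_glb_lt; [lra|apply Rdiv_lt_0_compat; lra]).
  assert (He1 : eps <= 1) by apply Rmin_l.
  assert (He2 : eps * (A + B + 1) <= eta).
  { apply Rle_trans with (eta / (A + B + 1) * (A + B + 1)).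
    - apply Rmult_le_compat_r; [lra|apply Rmin_r].
    - right; field; lra. }
  destruct (synth_approx a u A eps Ha Hu HA Heps) as [N HN].
  destruct (synth_approx a v B eps Ha Hv HB Heps) as [M HM].
  pose proof (synth_summable a u N) as HU. pose proof (synth_summable a v M) as HV.
  exists (convR (synth a u N) (synth a v M)).
  split; [now apply summable_bdd, convR_summable|]. split; [|now apply P0le_convR_synth].
  intros n.
  replace (convR (posZ u) (posZ v) n - convR (synth a u N) (synth a v M) n)
    with (convR (fun x => posZ u x - synth a u N x) (posZ v) n
      + convR (synth a u N) (fun x => posZ v x - synth a v M x) n)
    by (rewrite convR_minus_l, convR_minus_r by assumption; ring).
  assert (HU1 : forall x, Rabs (synth a u N x) <= A + 1).
  { intros x. replace (synth a u N x) with (posZ u x + - (posZ u x - synth a u N x)) by ring.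
    eapply Rle_trans; [apply Rabs_triang|]. rewrite Rabs_Ropp.
    pose proof (l1le_bdd _ A x HpA). pose proof (l1le_bdd _ eps x HN). simpl in *. lra. }
  eapply Rle_trans; [apply Rabs_triang|].
  apply Rle_trans with (eps * B + (A + 1) * eps); [|lra].
  apply Rplus_le_compat; apply convR_bdd; auto.
  intros x. apply (l1le_bdd _ eps x HN).
Qed.

Lemma P0le_convR a u v A B : 0 <= a -> l1le u A -> l1le v B -> P0le a u A -> P0le a v B ->
  P0le a (convR u v) ((2 * exp a + 2) * (A * B)).
Proof.
  intros Ha HuA HvB HA HB.
  assert (Hu : summable u) by now exists A. assert (Hv : summable v) by now exists B.
  assert (Hpu : summable (posZ u)) by (exists A; now apply l1le_posZ).
  assert (Hpv : summable (posZ v)) by (exists B; now apply l1le_posZ).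
  assert (Hnu : summable (negZ u)) by (exists A; now apply l1le_negZ).
  assert (Hnv : summable (negZ v)) by (exists B; now apply l1le_negZ).
  assert (Hneg : forall t n, (0 < n)%Z -> negZ t n = 0).
  { intros t n Hn. unfold negZ. now rewrite (proj2 (Z.leb_le 0 n)) by lia. }
  (* The three terms bound u+ v+, v+ u- and u v-. The last two have a factor carried by n <= 0, so
     each has constant 1. *)
  replace ((2 * exp a + 2) * (A * B)) with (2 * exp a * (A * B) + B * A + A * B) by ring.
  apply P0le_ext with (fun n => convR (posZ u) (posZ v) n + convR (posZ v) (negZ u) n
    + convR u (negZ v) n).
  { intros n _. rewrite (convR_comm (posZ v)) by assumption.
    rewrite <- convR_plus_l by assumption.
    replace (fun x => posZ u x + negZ u x) with u by (extensionality x; apply posZ_negZ).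
    rewrite <- convR_plus_r by assumption.
    replace (fun x => posZ v x + negZ v x) with v by (extensionality x; apply posZ_negZ).
    reflexivity. }
  apply (P0le_plus a (fun n => convR (posZ u) (posZ v) n + convR (posZ v) (negZ u) n));
    auto using bddR_plus, summable_bdd, convR_summable.
  - apply P0le_plus; auto using summable_bdd, convR_summable, P0le_convR_pos.
    apply P0le_convR_neg; auto using l1le_negZ.
    apply P0le_ext with v; [|assumption]. intros n Hn. now rewrite posZ_nonneg.
  - apply P0le_convR_neg; auto using l1le_negZ.
Qed.

(** * Linear structure of the spaces *)

Lemma Dc_add a f g n : 0 <= a -> bddC f -> bddC g ->
  Dc a (addZ f g) n = Cadd (Dc a f n) (Dc a g n).
Proof.
  intros Ha Hf Hg. unfold Dc, Cadd; simpl. f_equal.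
  - apply (DR_plus a (reZ f) (reZ g)); auto using bddC_re.
  - apply (DR_plus a (imZ f) (imZ g)); auto using bddC_im.
Qed.

Lemma Dc_scal a c f n : 0 <= a -> bddC f -> Dc a (scalZ c f) n = Cmul c (Dc a f n).
Proof.
  intros Ha Hf. unfold Dc, Cmul; simpl. rewrite <- !DR_scal.
  rewrite <- DR_minus, <- DR_plus by auto using bddR_scal, bddC_re, bddC_im. reflexivity.
Qed.

Lemma qpart_add a f g N : 0 <= a -> bddC f -> bddC g ->
  qpart a (addZ f g) N <= qpart a f N + qpart a g N.
Proof.
  intros Ha Hf Hg.
  assert (H : forall n0 f g, bddC f -> bddC g ->
    sumN (fun n => wt n0 a n * Cnorm (Dc a (addZ f g) (Z.of_nat n))) N
    <= sumN (fun n => wt n0 a n * Cnorm (Dc a f (Z.of_nat n))) N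
      + sumN (fun n => wt n0 a n * Cnorm (Dc a g (Z.of_nat n))) N).
  { clear f g Hf Hg. intros n0 f g Hf Hg. rewrite <- sumN_plus. apply sumN_le; intros n _.
    rewrite <- Rmult_plus_distr_l, Dc_add by assumption.
    apply Rmult_le_compat_l; [now apply wt_nonneg|apply Cnorm_triang]. }
  pose proof (H 0%nat f g Hf Hg) as H0.
  pose proof (H 1%nat (reflZ f) (reflZ g) (bddC_refl f Hf) (bddC_refl g Hg)) as H1.
  change (addZ (reflZ f) (reflZ g)) with (reflZ (addZ f g)) in H1. unfold qpart. lra.
Qed.

Lemma qpart_scal a c f N : 0 <= a -> bddC f -> qpart a (scalZ c f) N = Cnorm c * qpart a f N.
Proof.
  intros Ha Hf. unfold qpart. rewrite Rmult_plus_distr_l, <- !sumN_scal.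
  change (reflZ (scalZ c f)) with (scalZ c (reflZ f)).
  f_equal; apply sumN_ext; intros n _; rewrite Dc_scal, Cnorm_mul; auto using bddC_refl; ring.
Qed.

(** Sup-norm continuity of a fixed partial sum, with K depending on N; it closes the limit argument
    in [tau_complete]. *)
Lemma qpart_uniform a N : 0 <= a -> exists K, 0 < K /\ forall f B, 0 <= B ->
  (forall n, Cnorm (f n) <= B) -> qpart a f N <= K * B.
Proof.
  intros Ha. destruct (DR_bound a Ha) as [K [HK H]].
  set (W := sumN (wt 0 a) N + sumN (wt 1 a) N).
  assert (HW : 0 <= W).
  { apply Rplus_le_le_0_compat; apply sumN_nonneg; intros; now apply wt_nonneg. }
  exists (2 * K * (W + 1)); split; [nra|]. intros f B HB Hf.
  assert (HD : forall f, (forall n, Cnorm (f n) <= B) -> forall n, Cnorm (Dc a f n) <= 2 * K * B).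
  { clear f Hf; intros f Hf n. eapply Rle_trans; [apply Cnorm_le_abs|]. simpl.
    assert (Rabs (DR a (reZ f) n) <= K * B).
    { apply H; [assumption|]. intros x; eapply Rle_trans; [apply Cnorm_fst|apply Hf]. }
    assert (Rabs (DR a (imZ f) n) <= K * B).
    { apply H; [assumption|]. intros x; eapply Rle_trans; [apply Cnorm_snd|apply Hf]. }
    lra. }
  apply Rle_trans with (W * (2 * K * B)).
  - unfold qpart, W. rewrite Rmult_plus_distr_r, <- !sumN_scal_r.
    apply Rplus_le_compat; apply sumN_le; intros n _;
      (apply Rmult_le_compat_l; [now apply wt_nonneg|]); apply HD.
    + assumption.
    + intros x; apply Hf.
  - assert (0 <= K * B) by nra. nra.
Qed.

Lemma subZ_eq f g : subZ f g = addZ f (scalZ (-1, 0) g).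
Proof.
  extensionality n. unfold subZ, addZ, scalZ, Csub, Cadd, Copp, Cmul; simpl. f_equal; ring.
Qed.

Lemma inL1_iff_qpart f : inL1 f <-> exists A, forall N, qpart 0 f N <= A.
Proof.
  split; intros [A HA]; exists A; intros N; [rewrite qpart_order_0|rewrite <- qpart_order_0]; apply HA.
Qed.

Lemma inL1_add f g : inL1 f -> inL1 g -> inL1 (addZ f g).
Proof.
  intros Hf Hg. assert (Bf := inL1_bdd f Hf). assert (Bg := inL1_bdd g Hg).
  rewrite inL1_iff_qpart in *. destruct Hf as [A HA], Hg as [B HB]. exists (A + B); intros N.
  eapply Rle_trans; [apply qpart_add; auto; lra|]. specialize (HA N); specialize (HB N); lra.
Qed.

Lemma inL1_scal c f : inL1 f -> inL1 (scalZ c f).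
Proof.
  intros Hf. assert (Bf := inL1_bdd f Hf).
  rewrite inL1_iff_qpart in *. destruct Hf as [A HA]. exists (Cnorm c * A); intros N.
  rewrite qpart_scal by (auto; lra). apply Rmult_le_compat_l; [apply Cnorm_nonneg|apply HA].
Qed.

Lemma tau_inL1 a f : 0 < a -> tau a f -> inL1 f.
Proof. intros Ha Hf. now apply (tau_iff a f Ha). Qed.

Lemma tau_bdd a f : 0 < a -> tau a f -> bddC f.
Proof. intros Ha Hf. apply inL1_bdd, (tau_inL1 a); assumption. Qed.

Lemma tau_add a f g : 0 < a -> tau a f -> tau a g -> tau a (addZ f g).
Proof.
  intros Ha Hf Hg. apply tau_iff; [assumption|].
  split; [apply inL1_add; now apply (tau_inL1 a)|].
  exists (q a f + q a g); intros N.
  eapply Rle_trans; [apply qpart_add; [lra|now apply (tau_bdd a)|now apply (tau_bdd a)]|].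
  apply Rplus_le_compat; now apply tau_qpart_le.
Qed.

Lemma tau_scal a c f : 0 < a -> tau a f -> tau a (scalZ c f).
Proof.
  intros Ha Hf. apply tau_iff; [assumption|].
  split; [apply inL1_scal; now apply (tau_inL1 a)|].
  exists (Cnorm c * q a f); intros N.
  rewrite qpart_scal by (try lra; now apply (tau_bdd a)).
  apply Rmult_le_compat_l; [apply Cnorm_nonneg|now apply tau_qpart_le].
Qed.

Lemma tau_sub a f g : 0 < a -> tau a f -> tau a g -> tau a (subZ f g).
Proof. intros Ha Hf Hg. rewrite subZ_eq. auto using tau_add, tau_scal. Qed.

Lemma q_cv a f : 0 < a -> tau a f -> Un_cv (qpart a f) (q a f).
Proof.
  intros Ha [Hn [Hw Hl]]. eapply Un_cv_ext; [|now apply seriesZ_cv].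
  intros N. now apply sumZ_q_terms.
Qed.

Lemma tau_term_le a f n : 0 < a -> tau a f -> Cnorm (f n) <= q a f.
Proof.
  intros Ha Hf. eapply Rle_trans; [|apply (tau_l1_le a f (Z.abs_nat n) Ha Hf)].
  apply (sumZ_term_le (fun n => Cnorm (f n))); [intros; apply Cnorm_nonneg|lia].
Qed.

Lemma tau_norm a : 0 < a -> is_norm (tau a) (q a).
Proof.
  intros Ha. repeat split.
  - intros f Hf. eapply Rle_trans; [apply Cnorm_nonneg|apply (tau_term_le a f 0 Ha Hf)].
  - intros f Hf H0. extensionality n. apply Cnorm_eq_0.
    pose proof (tau_term_le a f n Ha Hf). pose proof (Cnorm_nonneg (f n)). lra.
  - intros c f Hf. apply (UL_sequence (qpart a (scalZ c f))).
    + now apply q_cv, tau_scal.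
    + assert (H : Un_cv (fun N => Cnorm c * qpart a f N) (Cnorm c * q a f)).
      { apply CV_mult; [|now apply q_cv].
        intros e He; exists 0%nat; intros; rewrite R_dist_eq; assumption. }
      eapply Un_cv_ext; [|exact H]. intros N. symmetry. apply qpart_scal; [lra|].
      now apply (tau_bdd a).
  - intros f g Hf Hg. apply tau_q_le; auto using tau_add. intros N.
    eapply Rle_trans; [apply qpart_add; [lra|now apply (tau_bdd a)|now apply (tau_bdd a)]|].
    apply Rplus_le_compat; now apply tau_qpart_le.
Qed.

(** * Convolution *)

Lemma inL1_re f A : (forall N, sumZ_R (fun n => Cnorm (f n)) N <= A) -> l1le (reZ f) A.
Proof.
  intros H N. eapply Rle_trans; [|apply (H N)]. apply sumZ_le; intros; apply Cnorm_fst.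
Qed.

Lemma inL1_im f A : (forall N, sumZ_R (fun n => Cnorm (f n)) N <= A) -> l1le (imZ f) A.
Proof.
  intros H N. eapply Rle_trans; [|apply (H N)]. apply sumZ_le; intros; apply Cnorm_snd.
Qed.

Lemma inL1_summable f : inL1 f -> summable (reZ f) /\ summable (imZ f).
Proof. intros [A HA]. split; exists A; [now apply inL1_re|now apply inL1_im]. Qed.

Lemma summable_parts_inL1 f : summable (reZ f) -> summable (imZ f) -> inL1 f.
Proof.
  intros [A HA] [B HB]. exists (A + B); intros N.
  eapply Rle_trans.
  - apply (sumZ_le _ (fun n => Rabs (reZ f n) + Rabs (imZ f n))). intros; apply Cnorm_le_abs.
  - rewrite sumZ_plus. specialize (HA N); specialize (HB N); lra.
Qed.

Lemma seriesZ_C_eq t : summable (fun n => fst (t n)) -> summable (fun n => snd (t n)) ->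
  seriesZ_C t = (SZ (fun n => fst (t n)), SZ (fun n => snd (t n))).
Proof.
  intros H1 H2. apply summable_cv in H1, H2. unfold seriesZ_C.
  assert (H : cvZ_C t (epsilon (inhabits C0) (cvZ_C t))).
  { apply epsilon_spec.
    exists (SZ (fun n => fst (t n)), SZ (fun n => snd (t n))). now split. }
  destruct (epsilon (inhabits C0) (cvZ_C t)) as [x y]. destruct H as [Hx Hy]. simpl in Hx, Hy.
  f_equal; [apply (UL_sequence _ _ _ Hx H1)|apply (UL_sequence _ _ _ Hy H2)].
Qed.

Lemma conv_eq f g : inL1 f -> inL1 g -> conv f g = fun n =>
  (convR (reZ f) (reZ g) n - convR (imZ f) (imZ g) n,
   convR (reZ f) (imZ g) n + convR (imZ f) (reZ g) n).
Proof.
  intros Hf Hg. apply inL1_summable in Hf, Hg. destruct Hf as [F1 F2], Hg as [G1 G2].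
  extensionality n. unfold conv.
  assert (T : forall u v, summable u -> summable v -> summable (fun j => u (n - j)%Z * v j))
    by (intros; apply convR_terms_summable; auto using summable_bdd).
  rewrite seriesZ_C_eq.
  - simpl. unfold convR. rewrite <- SZ_minus, <- SZ_plus by auto. reflexivity.
  - exact (summable_minus _ _ (T _ _ F1 G1) (T _ _ F2 G2)).
  - exact (summable_plus _ _ (T _ _ F1 G2) (T _ _ F2 G1)).
Qed.

Lemma conv_inL1 f g : inL1 f -> inL1 g -> inL1 (conv f g).
Proof.
  intros Hf Hg. rewrite conv_eq by assumption.
  apply inL1_summable in Hf, Hg. destruct Hf as [F1 F2], Hg as [G1 G2].
  apply summable_parts_inL1.
  - apply (summable_minus (convR (reZ f) (reZ g))); now apply convR_summable.
  - apply (summable_plus (convR (reZ f) (imZ g))); now apply convR_summable.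
Qed.

Lemma conv_refl f g : inL1 f -> inL1 g -> reflZ (conv f g) = conv (reflZ f) (reflZ g).
Proof.
  intros Hf Hg. rewrite !conv_eq by auto using inL1_refl. extensionality n.
  change (reZ (reflZ f)) with (reflZ (reZ f)). change (imZ (reflZ f)) with (reflZ (imZ f)).
  change (reZ (reflZ g)) with (reflZ (reZ g)). change (imZ (reflZ g)) with (reflZ (imZ g)).
  rewrite !convR_refl. reflexivity.
Qed.

Lemma conv_assoc f g h : inL1 f -> inL1 g -> inL1 h -> conv f (conv g h) = conv (conv f g) h.
Proof.
  intros Hf Hg Hh.
  rewrite (conv_eq f), (conv_eq (conv f g)) by auto using conv_inL1.
  rewrite !conv_eq by assumption.
  apply inL1_summable in Hf, Hg, Hh. destruct Hf as [F1 F2], Hg as [G1 G2], Hh as [H1 H2].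
  extensionality n.
  set (f1 := reZ f) in *; set (f2 := imZ f) in *; set (g1 := reZ g) in *;
  set (g2 := imZ g) in *; set (h1 := reZ h) in *; set (h2 := imZ h) in *.
  unfold reZ, imZ; simpl.
  rewrite !convR_minus_r, !convR_plus_r, !convR_minus_l, !convR_plus_l
    by auto using convR_summable.
  rewrite !convR_assoc by assumption. f_equal; ring.
Qed.

Lemma conv_add_r f g h : inL1 f -> inL1 g -> inL1 h ->
  conv f (addZ g h) = addZ (conv f g) (conv f h).
Proof.
  intros Hf Hg Hh. rewrite !conv_eq by auto using inL1_add.
  apply inL1_summable in Hf, Hg, Hh. destruct Hf as [F1 F2], Hg as [G1 G2], Hh as [H1 H2].
  extensionality n. unfold addZ, Cadd; simpl.
  change (reZ (fun n => (fst (g n) + fst (h n), snd (g n) + snd (h n))))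
    with (fun n => reZ g n + reZ h n).
  change (imZ (fun n => (fst (g n) + fst (h n), snd (g n) + snd (h n))))
    with (fun n => imZ g n + imZ h n).
  rewrite !convR_plus_r by assumption. f_equal; ring.
Qed.

Lemma conv_comm f g : inL1 f -> inL1 g -> conv f g = conv g f.
Proof.
  intros Hf Hg. rewrite !conv_eq by assumption.
  apply inL1_summable in Hf, Hg. destruct Hf as [F1 F2], Hg as [G1 G2].
  extensionality n.
  rewrite (convR_comm (reZ g)), (convR_comm (imZ g) (imZ f)), (convR_comm (reZ g)),
    (convR_comm (imZ g)) by assumption.
  f_equal; ring.
Qed.

Lemma conv_scal_r c f g : inL1 f -> inL1 g -> conv f (scalZ c g) = scalZ c (conv f g).
Proof.
  intros Hf Hg. rewrite !conv_eq by auto using inL1_scal.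
  apply inL1_summable in Hf, Hg. destruct Hf as [F1 F2], Hg as [G1 G2].
  extensionality n. unfold scalZ, Cmul; simpl.
  change (reZ (fun n => (fst c * fst (g n) - snd c * snd (g n), fst c * snd (g n) + snd c * fst (g n))))
    with (fun n => fst c * reZ g n - snd c * imZ g n).
  change (imZ (fun n => (fst c * fst (g n) - snd c * snd (g n), fst c * snd (g n) + snd c * fst (g n))))
    with (fun n => fst c * imZ g n + snd c * reZ g n).
  rewrite !convR_minus_r, !convR_plus_r, !convR_scal_r by auto using summable_scal.
  f_equal; ring.
Qed.

(** * Boundedness of the product for [q] *)

Lemma weighted_sum_nonneg n0 a f N : 0 <= a ->
  0 <= sumN (fun n => wt n0 a n * Cnorm (Dc a f (Z.of_nat n))) N.
Proof.
  intros Ha. apply sumN_nonneg; intros.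
  apply Rmult_le_pos; [now apply wt_nonneg|apply Cnorm_nonneg].
Qed.

(* The negative half of [q] has no term at 0; its contribution to the one-sided
   norm of the reflected sequence is controlled by the l^1 norm. *)
Lemma tau_P0le a : 0 < a -> exists E, 1 <= E /\ forall f, tau a f ->
  forall g, g = f \/ g = reflZ f -> P0le a (reZ g) (E * q a f) /\ P0le a (imZ g) (E * q a f).
Proof.
  intros Ha. assert (Ha' : 0 <= a) by lra.
  destruct (DR_bound a Ha') as [K [HK HKb]]. exists (1 + K); split; [lra|].
  intros f Hf g Hg.
  assert (Hq : 0 <= q a f) by now apply (tau_norm a Ha).
  assert (Hmain : forall comp : Cx -> R, (forall z, Rabs (comp z) <= Cnorm z) ->
    (forall h n, DR a (fun x => comp (h x)) n = comp (Dc a h n)) ->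
    P0le a (fun x => comp (g x)) ((1 + K) * q a f)).
  { intros comp Hc HcD N. pose proof (tau_qpart_le a f N Ha Hf) as HN. unfold qpart in HN.
    pose proof (weighted_sum_nonneg 0 a f N Ha') as H1. pose proof (weighted_sum_nonneg 1 a (reflZ f) N Ha') as H2.
    destruct Hg as [->| ->].
    - apply Rle_trans with (q a f); [|nra].
      apply Rle_trans with (sumN (fun n => wt 0 a n * Cnorm (Dc a f (Z.of_nat n))) N); [|lra].
      apply sumN_le; intros n _. rewrite HcD. unfold wt.
      apply Rmult_le_compat_l; [apply kC_nonneg; lra|apply Hc].
    - set (c := fun n => Rabs (DR a (fun x => comp (reflZ f x)) (Z.of_nat n))).
      apply Rle_trans with (sumN (fun n => wt 1 a n * c n + delta0 n * c 0%nat) N).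
      + apply sumN_le; intros n _. fold (c n). unfold wt. destruct n; simpl; lra.
      + rewrite sumN_plus, sumN_scal_r, (sumN_single delta0 N 0); [|lia|].
        2:{ intros [|i] _ Hi; [congruence|reflexivity]. }
        assert (Hc0 : c 0%nat <= K * q a f).
        { apply HKb; [assumption|]. intros x. eapply Rle_trans; [apply Hc|].
          now apply (tau_term_le a f (- x)%Z). }
        assert (sumN (fun n => wt 1 a n * c n) N
          <= sumN (fun n => wt 1 a n * Cnorm (Dc a (reflZ f) (Z.of_nat n))) N).
        { apply sumN_le; intros n _. apply Rmult_le_compat_l; [now apply wt_nonneg|].
          unfold c. rewrite HcD. apply Hc. }
        simpl delta0. lra. }
  split; [apply (Hmain fst)|apply (Hmain snd)]; auto using Cnorm_fst, Cnorm_snd.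
Qed.

Lemma weighted_sum_le_P0le a f A B n0 N : 0 <= a -> P0le a (reZ f) A -> P0le a (imZ f) B ->
  sumN (fun n => wt n0 a n * Cnorm (Dc a f (Z.of_nat n))) N <= A + B.
Proof.
  intros Ha HA HB. eapply Rle_trans; [|apply (Rplus_le_compat _ _ _ _ (HA N) (HB N))].
  rewrite <- sumN_plus. apply sumN_le; intros n _. rewrite <- Rmult_plus_distr_l.
  assert (Hk : 0 <= kC (a + 1) n) by (apply kC_nonneg; lra).
  pose proof (Cnorm_le_abs (Dc a f (Z.of_nat n))) as H. simpl in H.
  pose proof (Cnorm_nonneg (Dc a f (Z.of_nat n))).
  unfold wt. destruct (n0 <=? n)%nat; [now apply Rmult_le_compat_l|].
  rewrite Rmult_0_l. apply Rmult_le_pos; lra.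
Qed.

Lemma conv_qpart a : 0 < a -> exists C, 0 < C /\ forall f g N, tau a f -> tau a g ->
  qpart a (conv f g) N <= C * q a f * q a g.
Proof.
  intros Ha. assert (Ha' : 0 <= a) by lra. destruct (tau_P0le a Ha) as [E [HE HEb]].
  pose proof (exp_pos a) as Hexp. set (D := 2 * exp a + 2).
  assert (HD : 0 < D) by (unfold D; lra).
  (* Two halves, each made of four real convolutions with constant D; E enters once per factor. As E
     >= 1, A and B bound the l^1 norms as well as the one-sided ones. *)
  exists (8 * D * (E * E)). split; [apply Rmult_lt_0_compat; nra|]. intros f g N Hf Hg.
  set (A := E * q a f). set (B := E * q a g).
  assert (Qf : 0 <= q a f) by now apply (tau_norm a Ha).
  assert (Qg : 0 <= q a g) by now apply (tau_norm a Ha).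
  assert (Lf := tau_inL1 a f Ha Hf). assert (Lg := tau_inL1 a g Ha Hg).
  assert (Hhalf : forall n0 f' g', inL1 f' -> inL1 g' ->
    l1le (reZ f') A -> l1le (imZ f') A -> l1le (reZ g') B -> l1le (imZ g') B ->
    P0le a (reZ f') A -> P0le a (imZ f') A -> P0le a (reZ g') B -> P0le a (imZ g') B ->
    sumN (fun n => wt n0 a n * Cnorm (Dc a (conv f' g') (Z.of_nat n))) N <= 4 * D * (A * B)).
  { intros n0 f' g' Lf' Lg' L1 L2 L3 L4 P1 P2 P3 P4.
    assert (S1 : summable (reZ f')) by now exists A.
    assert (S2 : summable (imZ f')) by now exists A.
    assert (S3 : summable (reZ g')) by now exists B.
    assert (S4 : summable (imZ g')) by now exists B.
    rewrite conv_eq by assumption.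
    eapply Rle_trans;
      [apply (weighted_sum_le_P0le a _ (D * (A * B) + Rabs (-1) * (D * (A * B))) (D * (A * B) + D * (A * B)));
       [assumption| |]|].
    - apply P0le_ext with (fun n => convR (reZ f') (reZ g') n + -1 * convR (imZ f') (imZ g') n).
      { intros n _. unfold reZ; simpl. ring. }
      apply P0le_plus; auto using bddR_scal, summable_bdd, convR_summable, P0le_convR, P0le_scal.
    - apply P0le_ext with (fun n => convR (reZ f') (imZ g') n + convR (imZ f') (reZ g') n).
      { reflexivity. }
      apply P0le_plus; auto using summable_bdd, convR_summable, P0le_convR.
    - rewrite Rabs_left by lra. lra. }
  destruct (HEb f Hf f (or_introl eq_refl)) as [F1 F2].
  destruct (HEb f Hf (reflZ f) (or_intror eq_refl)) as [F3 F4].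
  destruct (HEb g Hg g (or_introl eq_refl)) as [G1 G2].
  destruct (HEb g Hg (reflZ g) (or_intror eq_refl)) as [G3 G4].
  assert (HfA : forall M, sumZ_R (fun n => Cnorm (f n)) M <= A).
  { intros M. eapply Rle_trans; [now apply (tau_l1_le a)|]. unfold A. nra. }
  assert (HgB : forall M, sumZ_R (fun n => Cnorm (g n)) M <= B).
  { intros M. eapply Rle_trans; [now apply (tau_l1_le a)|]. unfold B. nra. }
  assert (L1 := inL1_re f A HfA). assert (L2 := inL1_im f A HfA).
  assert (L3 := inL1_re g B HgB). assert (L4 := inL1_im g B HgB).
  unfold qpart. rewrite conv_refl by assumption.
  pose proof (Hhalf 0%nat f g Lf Lg L1 L2 L3 L4 F1 F2 G1 G2) as H0.
  pose proof (Hhalf 1%nat (reflZ f) (reflZ g) (inL1_refl f Lf) (inL1_refl g Lg)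
    (l1le_refl _ _ L1) (l1le_refl _ _ L2) (l1le_refl _ _ L3) (l1le_refl _ _ L4) F3 F4 G3 G4) as H1.
  replace (8 * D * (E * E) * q a f * q a g) with (4 * D * (A * B) + 4 * D * (A * B))
    by (unfold A, B; ring).
  lra.
Qed.

Lemma tau_conv a f g : 0 < a -> tau a f -> tau a g -> tau a (conv f g).
Proof.
  intros Ha Hf Hg. destruct (conv_qpart a Ha) as [C [_ HC]]. apply tau_iff; [assumption|].
  split; [apply conv_inL1; now apply (tau_inL1 a)|].
  exists (C * q a f * q a g). intros N. now apply HC.
Qed.

Lemma tau_zero a : 0 < a -> tau a zeroZ.
Proof.
  intros Ha. apply tau_iff; [assumption|].
  assert (H : forall b N, qpart b zeroZ N <= 0).
  { intros b N. unfold qpart.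
    assert (HD : forall n, Dc b zeroZ n = C0).
    { intros n. unfold Dc. rewrite !DR_zero by reflexivity. reflexivity. }
    change (reflZ zeroZ) with zeroZ.
    rewrite !sumN_zero by (intros; rewrite HD, Cnorm_C0; ring). lra. }
  split; [apply inL1_iff_qpart|]; exists 0; apply H.
Qed.

(** * Completeness *)

Section Completeness.

Variables (a : R) (u : nat -> seqZ).
Hypothesis Ha : 0 < a.
Hypothesis Hu : forall i, tau a (u i).
Hypothesis Hcauchy : forall eps, 0 < eps -> exists M, forall i j, (M <= i)%nat -> (M <= j)%nat ->
  q a (subZ (u i) (u j)) < eps.

Lemma cauchy_component (comp : Cx -> R) n :
  (forall z, Rabs (comp z) <= Cnorm z) -> (forall z w, comp (Csub z w) = comp z - comp w) ->
  Cauchy_crit (fun i => comp (u i n)).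
Proof.
  intros Hc Hs eps Heps. destruct (Hcauchy eps Heps) as [M HM]. exists M. intros i j Hi Hj.
  unfold R_dist. rewrite <- Hs. eapply Rle_lt_trans; [apply Hc|].
  eapply Rle_lt_trans; [|apply (HM i j Hi Hj)].
  apply (tau_term_le a (subZ (u i) (u j)) n); auto using tau_sub.
Qed.

Lemma limit_exists : exists f : seqZ, forall n,
  Un_cv (fun i => fst (u i n)) (fst (f n)) /\ Un_cv (fun i => snd (u i n)) (snd (f n)).
Proof.
  assert (H1 : forall n, Cauchy_crit (fun i => fst (u i n))).
  { intros n. apply cauchy_component; [apply Cnorm_fst|reflexivity]. }
  assert (H2 : forall n, Cauchy_crit (fun i => snd (u i n))).
  { intros n. apply cauchy_component; [apply Cnorm_snd|reflexivity]. }
  exists (fun n => (proj1_sig (R_complete _ (H1 n)), proj1_sig (R_complete _ (H2 n)))).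
  intros n; simpl. split; apply proj2_sig.
Qed.

Lemma tau_complete : exists f, tau a f /\ Un_cv (fun i => q a (subZ (u i) f)) 0.
Proof.
  destruct limit_exists as [f Hf]. exists f.
  (* All orders b <= a are treated together: b = a controls [q], and b = 0 gives the summability
     demanded by [tau_iff]. *)
  assert (Hunif : forall eps, 0 < eps -> exists M, forall i, (M <= i)%nat ->
    (forall n, Cnorm (subZ (u i) f n) <= eps) /\
    (forall b N, 0 <= b <= a -> bddC f -> qpart b (subZ (u i) f) N <= eps)).
  { assert (Hsup : forall eps, 0 < eps -> exists M, forall i, (M <= i)%nat ->
      forall n, Cnorm (subZ (u i) f n) <= eps).
    { intros eps Heps. destruct (Hcauchy eps Heps) as [M HM]. exists M. intros i Hi n.
      destruct (Hf n) as [Hre Him]. apply is_lim_seq_Reals in Hre, Him.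
      replace (subZ (u i) f n) with (fst (u i n) - fst (f n), snd (u i n) - snd (f n))
        by reflexivity.
      apply (Cnorm_lim_le (fun j => fst (u i n) - fst (u j n)) (fun j => snd (u i n) - snd (u j n)))
        with (L0 := M); [| |lra|].
      - apply is_lim_seq_minus'; [apply is_lim_seq_const|assumption].
      - apply is_lim_seq_minus'; [apply is_lim_seq_const|assumption].
      - intros j Hj. left. eapply Rle_lt_trans; [|apply (HM i j Hi Hj)].
        apply (tau_term_le a (subZ (u i) (u j)) n); auto using tau_sub. }
    intros eps Heps. destruct (Hsup eps Heps) as [M1 HM1].
    destruct (Hcauchy eps Heps) as [M2 HM2]. exists (M1 + M2)%nat. intros i Hi.
    split; [intros n; apply HM1; lia|]. intros b N Hb Hbf.
    apply le_epsilon; intros eta Heta.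
    destruct (qpart_uniform b N (proj1 Hb)) as [K [HK HKb]].
    destruct (Hsup (eta / K)) as [M3 HM3]; [now apply Rdiv_lt_0_compat|].
    (* Chosen after N and eta: u j is so close to f uniformly that the N-th partial sum of u j - f
       is at most eta, while the Cauchy bound on u i - u j is independent of j. *)
    set (j := (M2 + M3)%nat).
    replace (subZ (u i) f) with (addZ (subZ (u i) (u j)) (subZ (u j) f)).
    2:{ extensionality n. unfold addZ, subZ, Csub, Cadd, Copp; simpl. f_equal; ring. }
    assert (Hij : tau a (subZ (u i) (u j))) by auto using tau_sub.
    assert (Hjb : forall n, Cnorm (subZ (u j) f n) <= eta / K)
      by (intros n; apply HM3; unfold j; lia).
    eapply Rle_trans; [apply qpart_add; [lra|now apply (tau_bdd a)|now exists (eta / K)]|].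
    apply Rplus_le_compat.
    - apply Rle_trans with (q a (subZ (u i) (u j))); [|left; apply HM2; unfold j; lia].
      apply (qpart_order_le b a); [assumption|now apply (tau_null a)|].
      intros; now apply tau_qpart_le.
    - eapply Rle_trans; [apply (HKb _ (eta / K)); [|exact Hjb]|].
      + left. now apply Rdiv_lt_0_compat.
      + right. field. lra. }
  assert (Hbf : bddC f).
  { destruct (Hunif 1 Rlt_0_1) as [M HM]. destruct (HM M (Nat.le_refl M)) as [H _].
    destruct (tau_bdd a (u M) Ha (Hu M)) as [B HB]. exists (B + 1). intros n.
    replace (f n) with (Cadd (u M n) (Copp (subZ (u M) f n))).
    2:{ unfold subZ, Csub, Cadd, Copp; simpl. destruct (f n); simpl. f_equal; ring. }
    eapply Rle_trans; [apply Cnorm_triang|]. rewrite Cnorm_opp.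
    specialize (H n). specialize (HB n). lra. }
  assert (Htau : forall eps, 0 < eps -> exists M, forall i, (M <= i)%nat ->
    tau a (subZ (u i) f) /\ q a (subZ (u i) f) <= eps).
  { intros eps Heps. destruct (Hunif eps Heps) as [M HM]. exists M. intros i Hi.
    destruct (HM i Hi) as [_ H].
    assert (Hd : tau a (subZ (u i) f)).
    { apply tau_iff; [assumption|]. split; [apply inL1_iff_qpart|]; exists eps; intros N; apply H;
        auto; lra. }
    split; [assumption|]. apply tau_q_le; auto. intros N; apply H; auto; lra. }
  split.
  - destruct (Htau 1 Rlt_0_1) as [M HM]. destruct (HM M (Nat.le_refl M)) as [H _].
    replace f with (subZ (u M) (subZ (u M) f)); [auto using tau_sub|].
    extensionality n. unfold subZ, Csub, Cadd, Copp; simpl. destruct (f n); simpl. f_equal; ring.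
  - intros eps Heps. destruct (Htau (eps / 2)) as [M HM]; [lra|]. exists M. intros i Hi.
    destruct (HM i Hi) as [H1 H2]. unfold R_dist. rewrite Rminus_0_r, Rabs_pos_eq; [lra|].
    now apply (tau_norm a Ha).
Qed.

End Completeness.

Lemma tau_BanachAlg a : 0 < a -> BanachAlg (tau a) (q a) conv.
Proof.
  intros Ha. assert (HL := fun f => tau_inL1 a f Ha).
  repeat match goal with |- BanachAlg _ _ _ => unfold BanachAlg | |- _ /\ _ => split end.
  - now apply tau_zero.
  - intros; now apply tau_add.
  - intros; now apply tau_scal.
  - intros; now apply tau_conv.
  - now apply tau_norm.
  - destruct (conv_qpart a Ha) as [C [HC H]]. exists C; split; [assumption|].
    intros f g Hf Hg. apply tau_q_le; auto using tau_conv.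
  - intros; apply conv_assoc; auto.
  - intros; apply conv_add_r; auto.
  - intros f g h Hf Hg Hh.
    rewrite conv_comm, conv_add_r, (conv_comm h f), (conv_comm h g); auto using inL1_add.
  - intros c f g Hf Hg. split; [|apply conv_scal_r; auto].
    rewrite conv_comm, conv_scal_r, (conv_comm g f); auto using inL1_scal.
  - intros u Hu Hc. now apply tau_complete.
Qed.

(** * Finitely supported sequences *)

(** D^a only looks to the right, so it vanishes beyond the support. The same P works for every
    order, so [q] is a fixed finite sum when a varies. *)
Lemma c00_qpart f : c00 f -> exists P, (forall n, (Z.of_nat P < Z.abs n)%Z -> f n = C0) /\
  forall a N, 0 <= a -> qpart a f N <= qpart a f P.
Proof.
  intros [N0 HN0]. exists (Z.to_nat N0). split; [intros n Hn; apply HN0; lia|].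
  intros a N Ha.
  assert (H : forall n0 g, (forall n, (Z.of_nat (Z.to_nat N0) < n)%Z -> g n = C0) ->
    sumN (fun n => wt n0 a n * Cnorm (Dc a g (Z.of_nat n))) N
    <= sumN (fun n => wt n0 a n * Cnorm (Dc a g (Z.of_nat n))) (Z.to_nat N0)).
  { intros n0 g Hg. destruct (Nat.le_gt_cases N (Z.to_nat N0)) as [H|H].
    - apply sumN_mono; [assumption|]. intros.
      apply Rmult_le_pos; [now apply wt_nonneg|apply Cnorm_nonneg].
    - right. apply sumN_extend; [lia|]. intros i Hi.
      unfold Dc. rewrite !DR_zero.
      + change (0, 0) with C0. rewrite Cnorm_C0. ring.
      + intros x Hx. unfold imZ. rewrite Hg by lia. reflexivity.
      + intros x Hx. unfold reZ. rewrite Hg by lia. reflexivity. }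
  apply Rplus_le_compat; apply H; intros n Hn; [|unfold reflZ]; apply HN0; lia.
Qed.

Lemma c00_tau a f : 0 < a -> c00 f -> tau a f.
Proof.
  intros Ha Hf. destruct (c00_qpart f Hf) as [P [_ HP]]. apply tau_iff; [assumption|]. split.
  - apply inL1_iff_qpart. exists (qpart 0 f P). intros; apply HP; lra.
  - exists (qpart a f P). intros; apply HP; lra.
Qed.

Lemma continuity_pt_sumN (F : R -> nat -> R) N x :
  (forall j, continuity_pt (fun a => F a j) x) -> continuity_pt (fun a => sumN (F a) N) x.
Proof.
  intros H. induction N as [|N IH]; simpl; [apply H|].
  apply (continuity_pt_plus (fun a => sumN (F a) N) (fun a => F a (S N))); auto.
Qed.

Lemma continuity_pt_kC (g : R -> R) n x :
  continuity_pt g x -> continuity_pt (fun a => kC (g a) n) x.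
Proof.
  intros Hg. induction n as [|n IH]; cbn [kC].
  - apply continuity_pt_const. now intros y z.
  - apply (continuity_pt_mult (fun a => kC (g a) n * (g a + INR n)) (fun _ => / INR (S n))).
    + apply (continuity_pt_mult (fun a => kC (g a) n)); [assumption|].
      apply (continuity_pt_plus g (fun _ => INR n)); [assumption|].
      apply continuity_pt_const. now intros y z.
    + apply continuity_pt_const. now intros y z.
Qed.

Lemma continuity_pt_Cnorm (X Y : R -> R) x : continuity_pt X x -> continuity_pt Y x ->
  continuity_pt (fun a => Cnorm (X a, Y a)) x.
Proof.
  intros HX HY. unfold Cnorm; simpl.
  apply (continuity_pt_comp (fun a => X a * X a + Y a * Y a) sqrt).
  - apply (continuity_pt_plus (fun a => X a * X a) (fun a => Y a * Y a));
      [apply (continuity_pt_mult X X)|apply (continuity_pt_mult Y Y)]; assumption.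
  - apply continuity_pt_sqrt. nra.
Qed.

Lemma qpart_continuous f P : (forall n, (Z.of_nat P < Z.abs n)%Z -> f n = C0) ->
  continuity_pt (fun a => qpart a f P) 0.
Proof.
  intros Hf.
  assert (Hneg : continuity_pt (fun a => - a) 0).
  { apply (continuity_pt_opp (fun a => a)). apply derivable_continuous_pt, derivable_pt_id. }
  assert (Hwt : forall n0 n, continuity_pt (fun a => wt n0 a n) 0).
  { intros n0 n. unfold wt. destruct (n0 <=? n)%nat.
    - apply continuity_pt_kC. apply (continuity_pt_plus (fun a => a) (fun _ => 1)).
      + apply derivable_continuous_pt, derivable_pt_id.
      + apply continuity_pt_const. now intros y z.
    - apply continuity_pt_const. now intros y z. }
  assert (HDR : forall t n, (forall x, (Z.of_nat P < x)%Z -> t x = 0) ->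
    continuity_pt (fun a => DR a t (Z.of_nat n)) 0).
  { intros t n Ht.
    (* Cutting at P, uniformly in a, makes the series a polynomial in a. *)
    replace (fun a => DR a t (Z.of_nat n))
      with (fun a => sumN (fun j => kC (- a) j * t (Z.of_nat n + Z.of_nat j)%Z) P).
    2:{ extensionality a. symmetry. apply DR_finite. intros x Hx. apply Ht. lia. }
    apply continuity_pt_sumN. intros j.
    apply (continuity_pt_mult (fun a => kC (- a) j)); [now apply continuity_pt_kC|].
    apply continuity_pt_const. now intros y z. }
  assert (Hhalf : forall n0 g, (forall n, (Z.of_nat P < n)%Z -> g n = C0) ->
    continuity_pt (fun a => sumN (fun n => wt n0 a n * Cnorm (Dc a g (Z.of_nat n))) P) 0).
  { intros n0 g Hg. apply continuity_pt_sumN. intros n.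
    apply (continuity_pt_mult (fun a => wt n0 a n)); [apply Hwt|].
    apply continuity_pt_Cnorm; apply HDR; intros x Hx; unfold reZ, imZ;
      rewrite Hg by assumption; reflexivity. }
  apply (continuity_pt_plus
    (fun a => sumN (fun n => wt 0 a n * Cnorm (Dc a f (Z.of_nat n))) P));
    apply Hhalf; intros n Hn; [|unfold reflZ]; apply Hf; lia.
Qed.

(** Both norms are values of the one continuous function [fun a => qpart a f P], at a and at 0. *)
Lemma q_limit_0 f : c00 f -> forall eps, 0 < eps -> exists delta, 0 < delta /\
  forall a, 0 < a -> a < delta -> Rabs (q a f - l1norm f) < eps.
Proof.
  intros Hf eps Heps. destruct (c00_qpart f Hf) as [P [Hsupp HP]].
  destruct (qpart_continuous f P Hsupp eps Heps) as [delta [Hd H]].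
  exists delta; split; [exact Hd|]. intros a Ha Had.
  assert (Ht := c00_tau a f Ha Hf).
  replace (q a f) with (qpart a f P).
  2:{ apply Rle_antisym; [now apply tau_qpart_le|].
      apply tau_q_le; auto. intros; apply HP; lra. }
  replace (l1norm f) with (qpart 0 f P).
  - apply (H a). split.
    + split; [exact I|]. lra.
    + simpl. unfold R_dist. rewrite Rminus_0_r, Rabs_pos_eq by lra. assumption.
  - apply Rle_antisym.
    + rewrite qpart_order_0. apply cvZ_sup; [intros; apply Cnorm_nonneg|].
      apply seriesZ_cv. apply inL1_iff, (tau_inL1 a); assumption.
    + apply l1norm_le; [apply (tau_inL1 a); assumption|].
      intros N. rewrite <- qpart_order_0. apply HP; lra.
Qed.

Lemma tau_l1norm_le a f : 0 < a -> tau a f -> l1norm f <= q a f.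
Proof.
  intros Ha Hf. apply l1norm_le; [now apply (tau_inL1 a)|]. intros; now apply tau_l1_le.
Qed.

Lemma tau_order a b f : 0 < a -> a < b -> tau b f -> tau a f /\ q a f <= q b f.
Proof.
  intros Ha Hab Hf.
  assert (H : forall N, qpart a f N <= q b f).
  { apply (qpart_order_le a b); [lra|now apply (tau_null b)|].
    intros; apply tau_qpart_le; [lra|assumption]. }
  assert (Ht : tau a f).
  { apply tau_iff; [assumption|]. split; [apply (tau_inL1 b); [lra|assumption]|].
    now exists (q b f). }
  split; [assumption|]. now apply tau_q_le.
Qed.

Theorem theorem2p11 :
  (forall a : R, 0 < a ->
     is_norm c00 (q a) /\
     (exists Ca, 0 < Ca /\
        forall f g, c00 f -> c00 g -> q a (conv f g) <= Ca * q a f * q a g) /\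
     BanachAlg (tau a) (q a) conv /\
     (forall f, tau a f -> in_l1 f) /\
     (exists K, 0 <= K /\ forall f, tau a f -> l1norm f <= K * q a f)) /\
  (forall a b : R, 0 < a -> a < b ->
     (forall f, c00 f -> l1norm f <= q a f /\ q a f <= q b f) /\
     (forall f, tau b f -> tau a f) /\
     (exists K, 0 <= K /\ forall f, tau b f -> q a f <= K * q b f)) /\
  (forall f, c00 f ->
     forall eps, 0 < eps -> exists delta, 0 < delta /\
       forall a, 0 < a -> a < delta -> Rabs (q a f - l1norm f) < eps).
Proof.
  split; [|split].
  - intros a Ha. assert (Hc := fun f => c00_tau a f Ha). split; [|split; [|split; [|split]]].
    + destruct (tau_norm a Ha) as [H1 [H2 [H3 H4]]]. repeat split; auto.
    + destruct (tau_BanachAlg a Ha) as [_ [_ [_ [_ [_ [[C [HC H]] _]]]]]].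
      exists C; auto.
    + now apply tau_BanachAlg.
    + intros f Hf. apply inL1_iff, (tau_inL1 a); assumption.
    + exists 1; split; [lra|]. intros f Hf. rewrite Rmult_1_l. now apply tau_l1norm_le.
  - intros a b Ha Hab. split; [|split].
    + intros f Hf. split.
      * apply tau_l1norm_le, c00_tau; assumption.
      * apply tau_order; auto. apply c00_tau; [lra|assumption].
    + intros f Hf. now apply (tau_order a b).
    + exists 1; split; [lra|]. intros f Hf. rewrite Rmult_1_l. now apply tau_order.
  - apply q_limit_0.
Qed.
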